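(* Let $k\in[0,1]$, $p\in(0,2]$, $m\in\mathbb{N}$ (so $m\ge1$), and let $f=h+\overline{g}\in\mathcal{H}_k$ with $h(z)=\sum_{n=0}^\infty a_nz^n$ not identically constant and $g(z)=\sum_{n=1}^\infty b_nz^n$. Put $a=|h(0)|$, $h_0(z)=h(z)-h(0)$, and let $q$ be the order of the zero of $h_0$ at $0$. If $|b_q|\le\frac{1}{2k|a_q|}$ (a condition regarded as trivially satisfied when $k=0$, since then $g\equiv0$), then $$F_f^p(z):=|h(z^m)|^p+E_f(k,r)\le1\qquad\text{for } r=|z|\le r_{m,k}^p(a),$$ where $r_{m,k}^p(a)$ is the unique positive root in $(0,1)$ of the equation $\lambda_{m,k}^p(a,r)=0$ with $$\lambda_{m,k}^p(a,r)=\{[(1+k)(1-a^2)+1]r-1\}(1+ar^m)^p+(1-r)(r^m+a)^p.$$ Moreover, if $k=0$, or $k=1$, or if $k\in(0,1)$ and $r_{m,k}^p(a)\le 1/3$, then the condition $|b_q|\le\frac{1}{2k|a_q|}$ can be removed and the constant $r_{m,k}^p(a)$ cannot be improved.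
   Context: $\mathbb{D}=\{z\in\mathbb{C}:|z|<1\}$, and $\mathcal{B}$ is the set of all analytic functions in $\mathbb{D}$ bounded in modulus by $1$. For $k\in[0,1]$, $\mathcal{H}_k$ is the set of harmonic mappings $f=h+\overline{g}$ in $\mathbb{D}$ with $h,g$ analytic in $\mathbb{D}$, $g(0)=0$, $h\in\mathcal{B}$ and $|g'(z)|\le k|h'(z)|$ for all $z\in\mathbb{D}$. For $f=h+\overline{g}$ with $h(z)=\sum_{n\ge0}a_nz^n$, $g(z)=\sum_{n\ge1}b_nz^n$, $h_0=h-h(0)$ and $r\in[0,1)$, set $\|h_0\|_r^2=\sum_{n\ge1}|a_n|^2r^{2n}$, $\|g\|_r^2=\sum_{n\ge1}|b_n|^2r^{2n}$ and $$E_f(k,r)=\sum_{n=1}^{\infty}|a_n|r^n+\sum_{n=1}^{\infty}|b_n|r^n+\frac{1}{1+|a_0|}\left(\frac{1+|a_0|r}{1-r}\right)\left(\|h_0\|_r^2+c(k)\|g\|_r^2\right),$$ where $c(0)=0$ and $c(k)=1/k$ for $k\in(0,1]$. *)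

(* Defs.v *)
(* Stdlib reals with Coquelicot's complex numbers. *)
From Stdlib Require Import Reals.
From Coquelicot Require Import Coquelicot.
Open Scope R_scope.

(* Stdlib's [Rpower 0 p] is [1]; here [0 ^ p = 0], as needed for [p > 0]. *)
Definition rpow (x p : R) : R := if Req_EM_T x 0 then 0 else Rpower x p.

(* Functions on the open unit disk are total functions [C -> C] whose values
   outside the disk are irrelevant. *)
Definition in_disk (z : C) : Prop := Cmod z < 1.

Definition analytic_in_disk (h : C -> C) : Prop :=
  forall z : C, in_disk z -> ex_derive (K := C_AbsRing) (V := C_NormedModule) h z.

Definition bounded_class (h : C -> C) : Prop :=
  analytic_in_disk h /\ forall z : C, in_disk z -> Cmod (h z) <= 1.

(* [f], presented by its canonical decomposition [f = h + conj g], is in H_k. *)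
Definition harmonic_class (k : R) (f h g : C -> C) : Prop :=
  (forall z : C, in_disk z -> f z = (h z + Cconj (g z))%C) /\
  bounded_class h /\
  analytic_in_disk g /\
  g (RtoC 0) = RtoC 0 /\
  (forall z : C, in_disk z ->
     Cmod (C_derive g z) <= k * Cmod (C_derive h z)).

Definition has_expansion (h : C -> C) (a : nat -> C) : Prop :=
  forall z : C, in_disk z ->
    is_pseries (K := C_AbsRing) (V := C_NormedModule) a z (h z).

Definition constant_in_disk (h : C -> C) : Prop :=
  exists c : C, forall z : C, in_disk z -> h z = c.

Definition zero_order_at_0 (u : C -> C) (q : nat) : Prop :=
  exists c : nat -> C,
    has_expansion u c /\
    c q <> RtoC 0 /\
    (forall n : nat, (n < q)%nat -> c n = RtoC 0).

(* [Series] is a total function, but every series below converges for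
   [0 <= r < 1] when the coefficients come from [has_expansion]. *)

(* Sum over [n >= 1]: the index is shifted by one. *)
Definition majorant (a : nat -> C) (r : R) : R :=
  Series (fun n => Cmod (a (S n)) * r ^ (S n)).

(* ||h_0||_r^2; the constant term [a 0] is left out. *)
Definition sq_norm (a : nat -> C) (r : R) : R :=
  Series (fun n => Cmod (a (S n)) ^ 2 * r ^ (2 * S n)).

Definition c_coef (k : R) : R := if Req_EM_T k 0 then 0 else 1 / k.

Definition E_quantity (a b : nat -> C) (k r : R) : R :=
  majorant a r + majorant b r +
  1 / (1 + Cmod (a 0%nat)) * ((1 + Cmod (a 0%nat) * r) / (1 - r)) *
    (sq_norm a r + c_coef k * sq_norm b r).

Definition F_quantity (h : C -> C) (a b : nat -> C)
    (k p : R) (m : nat) (z : C) : R :=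
  rpow (Cmod (h (z ^ m)%C)) p + E_quantity a b k (Cmod z).

Definition lambda (m : nat) (k p a r : R) : R :=
  (((1 + k) * (1 - a ^ 2) + 1) * r - 1) * rpow (1 + a * r ^ m) p
  + (1 - r) * rpow (r ^ m + a) p.

Definition lambda_root (m : nat) (k p a r : R) : Prop :=
  0 < r < 1 /\ lambda m k p a r = 0.

(* Main.v *)
(* The problem is reduced to operators on square-summable sequences: a power series bounded by [1] on the
   disk acts by Cauchy product as a contraction (Parseval on circles, with roots of unity instead
   of integrals).  Testing this contraction on suitable polynomials gives Carlson's inequalities
   [|a_n| <= B_n], where [B_n] is nonincreasing and [sum B_n r^n] equals [(1 - |a_0|^2) r / (1 - r)]
   minus the quadratic term of [E_f]; testing it on a geometric sequence gives the Schwarz-Pick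
   inequality.

   For [g = k G] with [|G'| <= |h'|], the formal quotient [w = G' / h'] is again a contraction: its
   possible poles are removed by dividing out Blaschke factors, and the inverse of a zero-free
   series is continued radius by radius.  Since [|w_j| <= 1 - |w_0|^2], Chebyshev's sum inequality
   bounds the [n]-th coefficient of [G] by [|w_0| B_n + (1 - |w_0|^2) / 2 * (B_1 + ... + B_(n-1))], so
   [G] satisfies the same bound as [h] for [r <= 1/2].  Finally [p <= 2] forces
   [r0 <= 1 / (2 + k) <= 1/2], which is why the condition on [b_q] is never needed.  Equality holds
   for [h = (c + z) / (1 + c z)] and [g = k (h - c)]. *)
Require Import Defs.
From Stdlib Require Import Reals Ranalysis5 Lra Lia Arith Wf_nat Classical ClassicalEpsilon.
From Coquelicot Require Import Coquelicot.
Open Scope R_scope.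

(** * Finite sums and Cauchy products *)

(** The plain estimate [|a_n| <= 1 - |a_0|^2] already exhausts [(1 - |a_0|^2) r / (1 - r)], so the
    quadratic term of [E_f] must be paid for by sharper coefficient bounds; this is the purpose of
    the squares subtracted in Carlson's inequalities. Contractivity is stated on truncations, hence
    is a family of finite inequalities between coefficients: it makes sense for a formal quotient
    whose convergence is still unknown, and it survives letting the radius tend to [1]. The estimate
    for [G] rests on two scalar facts, with [c = |w_0|]: [c + (1 - c^2) / 2 <= 1], which is
    [(1 - c)^2 >= 0], and [r / (1 - r) <= 1], which is [r <= 1/2]. The factor [1 + k] arises because
    [c(k) k^2 = k], so that [g] costs exactly [k] times what [G] costs. At [r = 1 / (2 + k)] this
    budget [(1 + k) (1 - a^2) r / (1 - r)] equals [1 - a^2], while for [p <= 2] the power of the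
    Schwarz-Pick bound exceeds [a^2]; the root therefore lies to the left. *)

Fixpoint rsum (f : nat -> R) (n : nat) : R :=
  match n with O => 0 | S n' => rsum f n' + f n' end.

Fixpoint csum (f : nat -> C) (n : nat) : C :=
  match n with O => 0%C | S n' => (csum f n' + f n')%C end.

Lemma rsum_ext f g n : (forall i, (i < n)%nat -> f i = g i) -> rsum f n = rsum g n.
Proof.
  induction n as [|n IH]; simpl; intros H; [reflexivity|].
  rewrite IH by (intros; apply H; lia). now rewrite H by lia.
Qed.

Lemma rsum_plus f g n : rsum (fun i => f i + g i) n = rsum f n + rsum g n.
Proof. induction n as [|n IH]; simpl; [lra|rewrite IH; ring]. Qed.

Lemma rsum_scal c f n : rsum (fun i => c * f i) n = c * rsum f n.
Proof. induction n as [|n IH]; simpl; [ring|rewrite IH; ring]. Qed.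

Lemma rsum_S_l f n : rsum f (S n) = f 0%nat + rsum (fun i => f (S i)) n.
Proof.
  induction n as [|n IH]; [simpl; ring|].
  change (rsum f (S (S n))) with (rsum f (S n) + f (S n)). rewrite IH. simpl. ring.
Qed.

Lemma rsum_le f g n : (forall i, (i < n)%nat -> f i <= g i) -> rsum f n <= rsum g n.
Proof.
  induction n as [|n IH]; simpl; intros H; [lra|].
  apply Rplus_le_compat; [apply IH; intros; apply H|apply H]; lia.
Qed.

Lemma rsum_ge0 f n : (forall i, (i < n)%nat -> 0 <= f i) -> 0 <= rsum f n.
Proof.
  induction n as [|n IH]; simpl; intros H; [lra|].
  apply Rplus_le_le_0_compat; [apply IH; intros; apply H|apply H]; lia.
Qed.

Lemma rsum_incr f n m : (n <= m)%nat -> (forall i, 0 <= f i) -> rsum f n <= rsum f m.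
Proof.
  intros H H0; induction H as [|m H IH]; simpl; [lra|]. specialize (H0 m). lra.
Qed.

Lemma rsum_const c n : rsum (fun _ => c) n = INR n * c.
Proof. induction n as [|n IH]; [simpl; ring|]. rewrite S_INR. simpl. rewrite IH. ring. Qed.

Lemma rsum_term_le f n i : (i < n)%nat -> (forall j, 0 <= f j) -> f i <= rsum f n.
Proof.
  intros Hi H. apply Rle_trans with (rsum f (S i)).
  - simpl. assert (0 <= rsum f i) by (apply rsum_ge0; auto). lra.
  - apply rsum_incr; [lia|auto].
Qed.

Lemma rsum_geom x n : (1 - x) * rsum (fun i => x ^ i) n = 1 - x ^ n.
Proof. induction n as [|n IH]; simpl; [ring|]. rewrite Rmult_plus_distr_l, IH. ring. Qed.

Lemma rsum_geom_le x n : 0 <= x < 1 -> rsum (fun i => x ^ i) n <= / (1 - x).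
Proof.
  intros H. apply Rmult_le_reg_l with (1 - x); [lra|].
  rewrite rsum_geom, Rinv_r by lra. assert (0 <= x ^ n) by (apply pow_le; lra). lra.
Qed.

Lemma csum_ext f g n : (forall i, (i < n)%nat -> f i = g i) -> csum f n = csum g n.
Proof.
  induction n as [|n IH]; simpl; intros H; [reflexivity|].
  rewrite IH by (intros; apply H; lia). now rewrite H by lia.
Qed.

Lemma csum_plus f g n : csum (fun i => f i + g i)%C n = (csum f n + csum g n)%C.
Proof. induction n as [|n IH]; simpl; [ring|rewrite IH; ring]. Qed.

Lemma csum_scal c f n : csum (fun i => c * f i)%C n = (c * csum f n)%C.
Proof. induction n as [|n IH]; simpl; [ring|rewrite IH; ring]. Qed.

Lemma csum_S_l f n : csum f (S n) = (f 0%nat + csum (fun i => f (S i)) n)%C.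
Proof.
  induction n as [|n IH]; [simpl; ring|].
  change (csum f (S (S n))) with (csum f (S n) + f (S n))%C. rewrite IH. simpl. ring.
Qed.

Lemma csum_app f n m : csum f (n + m) = (csum f n + csum (fun i => f (n + i)%nat) m)%C.
Proof.
  induction m as [|m IH]; simpl; [rewrite Nat.add_0_r; ring|].
  rewrite Nat.add_succ_r. simpl. rewrite IH. ring.
Qed.

Lemma csum_zero (f : nat -> C) n : (forall i, (i < n)%nat -> f i = 0%C) -> csum f n = 0%C.
Proof.
  induction n as [|n IH]; simpl; intros H; [reflexivity|].
  rewrite IH by (intros; apply H; lia). rewrite H by lia. ring.
Qed.

Lemma csum_swap (F : nat -> nat -> C) n m :
  csum (fun i => csum (F i) m) n = csum (fun j => csum (fun i => F i j) n) m.
Proof.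
  induction n as [|n IH]; simpl.
  - induction m as [|m IHm]; simpl; [reflexivity|rewrite <- IHm; ring].
  - now rewrite IH, <- csum_plus.
Qed.

Lemma csum_conj f n : Cconj (csum f n) = csum (fun i => Cconj (f i)) n.
Proof.
  induction n as [|n IH]; simpl.
  - unfold Cconj; simpl. now rewrite Ropp_0.
  - now rewrite Cplus_conj, IH.
Qed.

Lemma csum_RtoC f n : csum (fun i => RtoC (f i)) n = RtoC (rsum f n).
Proof. induction n as [|n IH]; simpl; [reflexivity|]. now rewrite IH, RtoC_plus. Qed.

Lemma Cmod_csum_le f n : Cmod (csum f n) <= rsum (fun i => Cmod (f i)) n.
Proof.
  induction n as [|n IH]; simpl; [rewrite Cmod_0; lra|].
  eapply Rle_trans; [apply Cmod_triangle|lra].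
Qed.

Lemma Re_csum f n : Re (csum f n) = rsum (fun i => Re (f i)) n.
Proof. induction n as [|n IH]; simpl; [reflexivity|]. now rewrite <- IH. Qed.

Lemma Im_csum f n : Im (csum f n) = rsum (fun i => Im (f i)) n.
Proof. induction n as [|n IH]; simpl; [reflexivity|]. now rewrite <- IH. Qed.

(** Recursion on the head of the left factor avoids the subtraction [n - k]; associativity then
    follows by induction from linearity alone. *)
Fixpoint conv (a b : nat -> C) (n : nat) : C :=
  match n with
  | O => (a O * b O)%C
  | S n' => (a O * b (S n') + conv (fun k => a (S k)) b n')%C
  end.

Lemma conv_csum a b n : conv a b n = csum (fun k => a k * b (n - k)%nat)%C (S n).
Proof.
  revert a; induction n as [|n IH]; intros a; [simpl; ring|].
  rewrite csum_S_l. simpl conv. now rewrite IH.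
Qed.

Lemma conv_ext a a' b b' n :
  (forall i, (i <= n)%nat -> a i = a' i) -> (forall i, (i <= n)%nat -> b i = b' i) ->
  conv a b n = conv a' b' n.
Proof.
  intros H1 H2. rewrite !conv_csum. apply csum_ext; intros i Hi.
  rewrite H1, H2 by lia. reflexivity.
Qed.

Lemma conv_plus_l a a' b n : conv (fun k => a k + a' k)%C b n = (conv a b n + conv a' b n)%C.
Proof. rewrite !conv_csum, <- csum_plus. apply csum_ext; intros; ring. Qed.

Lemma conv_scal_l c a b n : conv (fun k => c * a k)%C b n = (c * conv a b n)%C.
Proof. rewrite !conv_csum, <- csum_scal. apply csum_ext; intros; ring. Qed.

Lemma conv_S_r a b n :
  conv a b (S n) = (a (S n) * b O + conv a (fun k => b (S k)) n)%C.
Proof.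
  revert a; induction n as [|n IH]; intros a; [simpl; ring|].
  change (conv a b (S (S n))) with (a O * b (S (S n)) + conv (fun k => a (S k)) b (S n))%C.
  rewrite IH. simpl. ring.
Qed.

Lemma conv_comm a b n : conv a b n = conv b a n.
Proof.
  revert a b; induction n as [|n IH]; intros a b; [simpl; ring|].
  rewrite conv_S_r. simpl. rewrite IH. ring.
Qed.

Lemma conv_plus_r a b b' n : conv a (fun k => b k + b' k)%C n = (conv a b n + conv a b' n)%C.
Proof. rewrite conv_comm, conv_plus_l. now rewrite !(conv_comm _ a). Qed.

Lemma conv_scal_r c a b n : conv a (fun k => c * b k)%C n = (c * conv a b n)%C.
Proof. rewrite conv_comm, conv_scal_l. now rewrite (conv_comm _ a). Qed.

Lemma conv_assoc a b c n : conv (conv a b) c n = conv a (conv b c) n.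
Proof.
  revert a; induction n as [|n IH]; intros a; [simpl; ring|].
  change (conv (conv a b) c (S n))
    with (a O * b O * c (S n) +
          conv (fun k => a O * b (S k) + conv (fun j => a (S j)) b k)%C c n)%C.
  rewrite conv_plus_l, conv_scal_l, IH. simpl. ring.
Qed.

Definition delta0 (n : nat) : C := match n with O => 1%C | _ => 0%C end.

Lemma conv_one_l a n : conv delta0 a n = a n.
Proof.
  destruct n as [|n]; [simpl; ring|].
  change (1 * a (S n) + conv (fun _ => 0) a n = a (S n))%C.
  rewrite conv_csum, csum_zero by (intros; ring). ring.
Qed.

Lemma conv_one_r a n : conv a delta0 n = a n.
Proof. now rewrite conv_comm, conv_one_l. Qed.

Lemma conv_cancel (c x y : nat -> C) : c O <> 0%C ->
  (forall n, conv c x n = conv c y n) -> forall n, x n = y n.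
Proof.
  intros Hc H n. induction n as [n IH] using lt_wf_ind.
  specialize (H n). destruct n as [|n].
  - simpl in H. replace (x O) with (/ c O * (c O * x O))%C by (field; auto).
    rewrite H. field; auto.
  - simpl in H.
    rewrite (conv_ext _ (fun k => c (S k)) x y) in H by (auto; intros; apply IH; lia).
    assert (E : (c O * x (S n) = c O * y (S n))%C).
    { replace (c O * x (S n))%C
        with (c O * x (S n) + conv (fun k => c (S k)) y n - conv (fun k => c (S k)) y n)%C by ring.
      rewrite H. ring. }
    replace (x (S n)) with (/ c O * (c O * x (S n)))%C by (field; auto).
    rewrite E. field; auto.
Qed.

(** Long division of formal series: each step subtracts from [v] the multiple of [c] that cancels
    its head, then shifts. *)
Fixpoint quot (c v : nat -> C) (n : nat) : C :=
  match n with
  | O => (v O / c O)%C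
  | S n' => quot c (fun k => v (S k) - v O / c O * c (S k))%C n'
  end.

Lemma conv_quot (c v : nat -> C) n : c O <> 0%C -> conv c (quot c v) n = v n.
Proof.
  intros Hc. rewrite conv_comm. revert v. induction n as [|n IH]; intros v.
  - simpl. field; auto.
  - change (conv (quot c v) c (S n)) with
      (v O / c O * c (S n)
       + conv (quot c (fun k => v (S k) - v O / c O * c (S k))%C) c n)%C.
    rewrite IH. ring.
Qed.

(** * Power series on the unit disk *)

Lemma le_of_lim0 x y s : (forall n : nat, x <= y + s n) -> is_lim_seq s 0 -> x <= y.
Proof.
  intros H Hs.
  assert (L : Rbar_le x (y + 0)).
  { apply (is_lim_seq_le (fun _ => x) (fun n => y + s n)); auto.
    - apply is_lim_seq_const.
    - apply is_lim_seq_plus'; [apply is_lim_seq_const|exact Hs]. }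
  simpl in L. lra.
Qed.

Lemma geom_lim0 c x : 0 <= x < 1 -> is_lim_seq (fun n => c * x ^ n) 0.
Proof.
  intros H. replace 0 with (c * 0) by ring.
  apply (is_lim_seq_scal_l _ c (Finite 0)).
  apply is_lim_seq_geom. rewrite Rabs_pos_eq; lra.
Qed.

Lemma sum_n_rsum (f : nat -> R) n : sum_n f n = rsum f (S n).
Proof.
  induction n as [|n IH].
  - rewrite sum_O. simpl. ring.
  - rewrite sum_Sn, IH. reflexivity.
Qed.

Lemma is_series_rsum (f : nat -> R) (l : R) :
  is_series f l <-> is_lim_seq (rsum f) l.
Proof.
  split; intros H.
  - apply is_lim_seq_incr_1. apply is_lim_seq_ext with (sum_n f); [apply sum_n_rsum|exact H].
  - apply is_lim_seq_incr_1 in H.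
    apply (is_lim_seq_ext _ (sum_n f) l) in H; [exact H|].
    intros n; symmetry; apply sum_n_rsum.
Qed.

Lemma Cmod_le_Re_Im (z : C) : Cmod z <= Rabs (Re z) + Rabs (Im z).
Proof.
  apply Rsqr_incr_0_var; [|pose proof (Rabs_pos (Re z)); pose proof (Rabs_pos (Im z)); lra].
  unfold Rsqr. pose proof (Cmod2_alt z) as E.
  rewrite <- (pow2_abs (Re z)), <- (pow2_abs (Im z)) in E.
  pose proof (Rabs_pos (Re z)); pose proof (Rabs_pos (Im z)). nra.
Qed.

Lemma Cmod_minus_sym (x y : C) : Cmod (x - y) = Cmod (y - x).
Proof. rewrite <- Cmod_opp. f_equal. ring. Qed.

Lemma Cmod_triangle3 (x y z : C) : Cmod (x - z) <= Cmod (x - y) + Cmod (y - z).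
Proof. replace (x - z)%C with ((x - y) + (y - z))%C by ring. apply Cmod_triangle. Qed.

Lemma Cmod_rev_triangle (x y : C) : Cmod x - Cmod y <= Cmod (x - y).
Proof. pose proof (Cmod_triangle (x - y) y) as H. replace (x - y + y)%C with x in H by ring. lra. Qed.

Lemma Cminus_eq_0 (x y : C) : (x - y)%C = 0%C -> x = y.
Proof. intros H. replace x with (x - y + y)%C by ring. rewrite H. ring. Qed.

(** * Coefficient sequences converging on the whole disk, and their sums *)

Definition bdd (a : nat -> C) (K r : R) : Prop := forall n, Cmod (a n) * r ^ n <= K.

(* Equivalently, the radius of convergence is at least [1]. *)
Definition adm (a : nat -> C) : Prop := forall r, 0 < r < 1 -> exists K, bdd a K r.

Definition psum (a : nat -> C) (z : C) (n : nat) : C := csum (fun i => a i * z ^ i)%C n.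

(* Meaningful only where the series converges: [Series] is total. *)
Definition ev (a : nat -> C) (z : C) : C :=
  (Series (fun n => Re (a n * z ^ n)), Series (fun n => Im (a n * z ^ n))).

Lemma bdd_ge0 a K r : bdd a K r -> 0 <= K.
Proof. intros H. specialize (H O). simpl in H. pose proof (Cmod_ge_0 (a O)). lra. Qed.

Lemma bdd_term a K r z n : bdd a K r -> 0 < r -> Cmod (a n * z ^ n)%C <= K * (Cmod z / r) ^ n.
Proof.
  intros H Hr. rewrite Cmod_mult, Cmod_pow.
  unfold Rdiv. rewrite Rpow_mult_distr, pow_inv.
  assert (0 < r ^ n) by (apply pow_lt; lra).
  assert (0 <= Cmod z ^ n) by (apply pow_le, Cmod_ge_0).
  specialize (H n).
  replace (Cmod (a n) * Cmod z ^ n) with (Cmod (a n) * r ^ n * (Cmod z ^ n * / r ^ n)) by (field; lra).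
  apply Rmult_le_compat_r; auto.
  apply Rmult_le_pos; auto. left; apply Rinv_0_lt_compat; auto.
Qed.

Lemma ratio_lt1 z r : Cmod z < r -> 0 <= Cmod z / r < 1.
Proof.
  intros H. pose proof (Cmod_ge_0 z). split.
  - apply Rdiv_le_0_compat; lra.
  - apply Rmult_lt_reg_r with r; [lra|]. unfold Rdiv. rewrite Rmult_assoc, Rinv_l; lra.
Qed.

Lemma bdd_ex_series a K r z (p : C -> R) : bdd a K r -> Cmod z < r ->
  (forall c, Rabs (p c) <= Cmod c) -> ex_series (fun n => p (a n * z ^ n)%C).
Proof.
  intros H Hz Hp. pose proof (ratio_lt1 _ _ Hz). pose proof (Cmod_ge_0 z).
  apply (@ex_series_le R_AbsRing R_CompleteNormedModule _ (fun n => K * (Cmod z / r) ^ n)).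
  - intros n. unfold norm; simpl. unfold abs; simpl.
    eapply Rle_trans; [apply Hp|]. apply bdd_term; [auto|lra].
  - apply (@ex_series_scal_l R_AbsRing R_NormedModule K). apply ex_series_geom. rewrite Rabs_pos_eq; lra.
Qed.

Lemma Im_le_Cmod c : Rabs (Im c) <= Cmod c.
Proof. eapply Rle_trans; [apply Rmax_r|apply Rmax_Cmod]. Qed.

(** Compare with a longer partial sum, whose excess is a geometric sum, and let its length tend to
    infinity. The error depends on [z] only through [Cmod z], hence is uniform on circles. *)
Lemma ev_tail a K r z n : bdd a K r -> Cmod z < r ->
  Cmod (ev a z - psum a z n) <= K / (1 - Cmod z / r) * (Cmod z / r) ^ n.
Proof.
  intros H Hz. pose proof (ratio_lt1 _ _ Hz) as Hq. pose proof (Cmod_ge_0 z).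
  pose proof (bdd_ge0 _ _ _ H) as HK.
  set (q := Cmod z / r) in *.
  assert (LR : is_lim_seq (fun m => Re (psum a z (m + n))) (Re (ev a z))).
  { apply (is_lim_seq_incr_n (fun m => Re (psum a z m)) n).
    apply is_lim_seq_ext with (rsum (fun n => Re (a n * z ^ n)%C)).
    - intros m; unfold psum. now rewrite Re_csum.
    - apply is_series_rsum. unfold ev; simpl. apply Series_correct.
      apply (bdd_ex_series a K r z Re); auto. apply re_le_Cmod. }
  assert (LI : is_lim_seq (fun m => Im (psum a z (m + n))) (Im (ev a z))).
  { apply (is_lim_seq_incr_n (fun m => Im (psum a z m)) n).
    apply is_lim_seq_ext with (rsum (fun n => Im (a n * z ^ n)%C)).
    - intros m; unfold psum. now rewrite Im_csum.
    - apply is_series_rsum. unfold ev; simpl. apply Series_correct.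
      apply (bdd_ex_series a K r z Im); auto. apply Im_le_Cmod. }
  apply le_of_lim0 with
    (fun m => Rabs (Re (psum a z (m + n)) - Re (ev a z)) + Rabs (Im (psum a z (m + n)) - Im (ev a z))).
  - intros m. eapply Rle_trans; [apply (Cmod_triangle3 _ (psum a z (m + n)))|].
    rewrite Rplus_comm. apply Rplus_le_compat.
    + replace (psum a z (m + n) - psum a z n)%C
        with (csum (fun i => a (n + i)%nat * z ^ (n + i))%C m).
      2:{ unfold psum. rewrite Nat.add_comm, csum_app. ring. }
      eapply Rle_trans; [apply Cmod_csum_le|].
      apply Rle_trans with (rsum (fun i => K * q ^ n * q ^ i) m).
      * apply rsum_le; intros i _. rewrite Rmult_assoc, <- pow_add. apply bdd_term; [auto|lra].
      * rewrite rsum_scal. replace (K / (1 - q) * q ^ n) with (K * q ^ n * / (1 - q)) by (unfold Rdiv; ring).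
        apply Rmult_le_compat_l; [|apply rsum_geom_le; lra].
        apply Rmult_le_pos; [lra|apply pow_le; lra].
    + rewrite Cmod_minus_sym. apply Cmod_le_Re_Im.
  - replace 0 with (0 + 0) by ring. apply is_lim_seq_plus'.
    + apply -> is_lim_seq_abs_0. replace 0 with (Re (ev a z) - Re (ev a z)) by ring.
      apply is_lim_seq_minus'; [exact LR|apply is_lim_seq_const].
    + apply -> is_lim_seq_abs_0. replace 0 with (Im (ev a z) - Im (ev a z)) by ring.
      apply is_lim_seq_minus'; [exact LI|apply is_lim_seq_const].
Qed.

Lemma adm_at a z : adm a -> Cmod z < 1 -> exists K r, 0 < r < 1 /\ Cmod z < r /\ bdd a K r.
Proof.
  intros H Hz. pose proof (Cmod_ge_0 z).
  destruct (H ((Cmod z + 1) / 2)) as [K HK]; [lra|].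
  exists K, ((Cmod z + 1) / 2). repeat split; auto; lra.
Qed.

Lemma ev_lim a z : adm a -> Cmod z < 1 -> is_lim_seq (fun n => Cmod (ev a z - psum a z n)) 0.
Proof.
  intros H Hz. destruct (adm_at a z H Hz) as (K & r & Hr & Hzr & HK).
  apply is_lim_seq_le_le with (fun _ => 0) (fun n => K / (1 - Cmod z / r) * (Cmod z / r) ^ n).
  - intros n. split; [apply Cmod_ge_0|]. now apply ev_tail.
  - apply is_lim_seq_const.
  - apply geom_lim0. now apply ratio_lt1.
Qed.

Lemma ev_unique a z l s : adm a -> Cmod z < 1 ->
  (forall n, Cmod (l - psum a z n) <= s n) -> is_lim_seq s 0 -> ev a z = l.
Proof.
  intros H Hz Hs L. apply Cminus_eq_0, Cmod_eq_0.
  apply Rle_antisym; [|apply Cmod_ge_0].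
  apply le_of_lim0 with (fun n => Cmod (ev a z - psum a z n) + s n).
  - intros n. eapply Rle_trans; [apply (Cmod_triangle3 _ (psum a z n))|].
    rewrite (Cmod_minus_sym _ l). specialize (Hs n). lra.
  - replace 0 with (0 + 0) by ring. apply is_lim_seq_plus'; auto. now apply ev_lim.
Qed.

Lemma ev_ext a b z : (forall n, a n = b n) -> ev a z = ev b z.
Proof. intros H. unfold ev. f_equal; apply Series_ext; intros n; now rewrite H. Qed.

Lemma adm_ext a b : (forall n, a n = b n) -> adm a -> adm b.
Proof.
  intros H Ha r Hr. destruct (Ha r Hr) as [K HK]. exists K. intros n. rewrite <- H. apply HK.
Qed.

Lemma bdd_plus a b K L r : 0 < r -> bdd a K r -> bdd b L r -> bdd (fun n => a n + b n)%C (K + L) r.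
Proof.
  intros Hr Ha Hb n. specialize (Ha n). specialize (Hb n).
  pose proof (Cmod_triangle (a n) (b n)). assert (0 < r ^ n) by (apply pow_lt; auto). nra.
Qed.

Lemma adm_plus a b : adm a -> adm b -> adm (fun n => a n + b n)%C.
Proof.
  intros Ha Hb r Hr. destruct (Ha r Hr) as [K HK]. destruct (Hb r Hr) as [L HL].
  exists (K + L). apply bdd_plus; auto; lra.
Qed.

Lemma adm_scal c a : adm a -> adm (fun n => c * a n)%C.
Proof.
  intros Ha r Hr. destruct (Ha r Hr) as [K HK]. exists (Cmod c * K). intros n.
  rewrite Cmod_mult, Rmult_assoc. apply Rmult_le_compat_l; [apply Cmod_ge_0|apply HK].
Qed.

Lemma ev_plus a b z : adm a -> adm b -> Cmod z < 1 ->
  ev (fun n => a n + b n)%C z = (ev a z + ev b z)%C.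
Proof.
  intros Ha Hb Hz.
  apply ev_unique with
    (fun n => Cmod (ev a z - psum a z n) + Cmod (ev b z - psum b z n)); auto.
  - now apply adm_plus.
  - intros n. replace (ev a z + ev b z - _)%C
      with ((ev a z - psum a z n) + (ev b z - psum b z n))%C; [apply Cmod_triangle|].
    unfold psum. rewrite (csum_ext (fun i => (a i + b i) * z ^ i)%C
      (fun i => a i * z ^ i + b i * z ^ i)%C) by (intros; ring).
    rewrite csum_plus. ring.
  - replace 0 with (0 + 0) by ring. apply is_lim_seq_plus'; now apply ev_lim.
Qed.

Lemma ev_scal c a z : adm a -> Cmod z < 1 -> ev (fun n => c * a n)%C z = (c * ev a z)%C.
Proof.
  intros Ha Hz.
  apply ev_unique with (fun n => Cmod c * Cmod (ev a z - psum a z n)); auto.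
  - now apply adm_scal.
  - intros n. rewrite <- Cmod_mult. right. f_equal.
    unfold psum. rewrite (csum_ext (fun i => c * a i * z ^ i)%C
      (fun i => c * (a i * z ^ i))%C) by (intros; ring).
    rewrite csum_scal. ring.
  - replace (Finite 0) with (Rbar_mult (Cmod c) 0) by (simpl; f_equal; ring).
    apply is_lim_seq_scal_l. now apply ev_lim.
Qed.

Lemma adm_shift a : adm a -> adm (fun n => a (S n)).
Proof.
  intros Ha r Hr. destruct (Ha r Hr) as [K HK]. exists (K / r). intros n.
  specialize (HK (S n)). simpl in HK.
  apply Rmult_le_reg_r with r; [lra|]. unfold Rdiv. rewrite (Rmult_assoc K), Rinv_l by lra. lra.
Qed.

Lemma ev_shift a z : adm a -> Cmod z < 1 -> ev a z = (a O + z * ev (fun n => a (S n)) z)%C.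
Proof.
  intros Ha Hz. pose proof (adm_shift a Ha) as Hs.
  apply ev_unique with (fun n => match n with O => Cmod (a O + z * ev (fun n => a (S n)) z)%C
     | S n => Cmod z * Cmod (ev (fun n => a (S n)) z - psum (fun n => a (S n)) z n) end); auto.
  - intros [|n].
    + right. f_equal. unfold psum; simpl. ring.
    + rewrite <- Cmod_mult. right. f_equal. unfold psum. rewrite csum_S_l.
      rewrite (csum_ext (fun i => a (S i) * z ^ S i)%C
        (fun i => z * (a (S i) * z ^ i))%C) by (intros; simpl; ring).
      rewrite csum_scal. simpl. ring.
  - apply is_lim_seq_incr_1.
    replace (Finite 0) with (Rbar_mult (Cmod z) 0) by (simpl; f_equal; ring).
    apply is_lim_seq_scal_l. now apply ev_lim.
Qed.

Lemma adm_bounded a K : (forall n, Cmod (a n) <= K) -> adm a.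
Proof.
  intros H r Hr. exists K. intros n. specialize (H n). pose proof (Cmod_ge_0 (a n)).
  assert (r ^ n <= 1) by (rewrite <- (pow1 n); apply pow_incr; lra).
  assert (0 <= r ^ n) by (apply pow_le; lra). nra.
Qed.

Lemma bdd_finite (a : nat -> C) N r : 0 <= r -> (forall n, (N <= n)%nat -> a n = 0%C) -> exists K, bdd a K r.
Proof.
  intros Hr H. exists (rsum (fun n => Cmod (a n) * r ^ n) N). intros n.
  assert (P : forall j, 0 <= Cmod (a j) * r ^ j)
    by (intros; apply Rmult_le_pos; [apply Cmod_ge_0|apply pow_le; lra]).
  destruct (le_lt_dec N n) as [Hn|Hn].
  - rewrite H, Cmod_0, Rmult_0_l by auto. apply rsum_ge0; auto.
  - apply (rsum_term_le (fun n => Cmod (a n) * r ^ n)); auto.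
Qed.

Lemma adm_finite (a : nat -> C) N : (forall n, (N <= n)%nat -> a n = 0%C) -> adm a.
Proof. intros H r Hr. apply bdd_finite with N; auto; lra. Qed.

Lemma ev_finite (a : nat -> C) N z : Cmod z < 1 -> (forall n, (N <= n)%nat -> a n = 0%C) -> ev a z = psum a z N.
Proof.
  intros Hz H.
  assert (E : forall m, psum a z (N + m) = psum a z N).
  { intros m. unfold psum. rewrite csum_app.
    rewrite (csum_zero (fun i => a (N + i)%nat * z ^ (N + i))%C).
    - ring.
    - intros i _. rewrite H by lia. ring. }
  apply ev_unique with (fun n => Cmod (psum a z N - psum a z n)); auto.
  - now apply adm_finite with N.
  - intros; lra.
  - apply (is_lim_seq_incr_n _ N).
    apply is_lim_seq_ext with (fun _ => 0); [|apply is_lim_seq_const].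
    intros n. rewrite Nat.add_comm, E. replace (psum a z N - psum a z N)%C with (RtoC 0) by ring.
    now rewrite Cmod_0.
Qed.

Lemma ev_0 a : adm a -> ev a 0%C = a O.
Proof. intros H. rewrite ev_shift; auto; [ring|]. rewrite Cmod_0; lra. Qed.

(** Each of the [n + 1] terms of the partial geometric sum is at least [x ^ n]. This is how a linear
    factor is absorbed by a slightly smaller radius. *)
Lemma lin_geom_le x n : 0 <= x < 1 -> INR (S n) * x ^ n <= / (1 - x).
Proof.
  intros H. apply Rle_trans with (rsum (fun i => x ^ i) (S n)); [|apply rsum_geom_le; auto].
  rewrite <- rsum_const. apply rsum_le. intros i Hi.
  replace n with (i + (n - i))%nat by lia. rewrite pow_add.
  assert (0 <= x ^ i) by (apply pow_le; lra).
  assert (x ^ (n - i) <= 1) by (rewrite <- (pow1 (n - i)); apply pow_incr; lra). nra.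
Qed.

Lemma bdd_conv a b K L r s : 0 < s < r -> bdd a K r -> bdd b L r ->
  bdd (conv a b) (K * L / (1 - s / r)) s.
Proof.
  intros Hs Ha Hb n.
  assert (Hq : 0 <= s / r < 1).
  { split; [apply Rdiv_le_0_compat; lra|]. apply Rmult_lt_reg_r with r; [lra|].
    unfold Rdiv. rewrite Rmult_assoc, Rinv_l; lra. }
  pose proof (bdd_ge0 _ _ _ Ha). pose proof (bdd_ge0 _ _ _ Hb).
  assert (P : Cmod (conv a b n) * r ^ n <= INR (S n) * (K * L)).
  { rewrite conv_csum, <- rsum_const.
    apply Rle_trans with (r ^ n * rsum (fun k => Cmod (a k * b (n - k)%nat)) (S n)).
    - rewrite Rmult_comm. apply Rmult_le_compat_l; [apply pow_le; lra|]. apply (Cmod_csum_le (fun k => a k * b (n - k)%nat)%C).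
    - rewrite <- rsum_scal. apply rsum_le. intros i Hi. rewrite Cmod_mult.
      replace (r ^ n) with (r ^ i * r ^ (n - i)) by (rewrite <- pow_add; f_equal; lia).
      specialize (Ha i). specialize (Hb (n - i)%nat).
      replace (_ * _ * _) with ((Cmod (a i) * r ^ i) * (Cmod (b (n - i)%nat) * r ^ (n - i))) by ring.
      apply Rmult_le_compat; auto; apply Rmult_le_pos; try apply Cmod_ge_0; apply pow_le; lra. }
  replace (s ^ n) with (r ^ n * (s / r) ^ n).
  2:{ rewrite <- Rpow_mult_distr. f_equal. field. lra. }
  rewrite <- Rmult_assoc.
  apply Rle_trans with (INR (S n) * (K * L) * (s / r) ^ n).
  - apply Rmult_le_compat_r; [apply pow_le; lra|exact P].
  - replace (INR (S n) * (K * L) * (s / r) ^ n) with (K * L * (INR (S n) * (s / r) ^ n)) by ring.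
    apply Rmult_le_compat_l; [apply Rmult_le_pos; auto|]. now apply lin_geom_le.
Qed.

Lemma adm_conv a b : adm a -> adm b -> adm (conv a b).
Proof.
  intros Ha Hb s Hs.
  destruct (Ha ((s + 1) / 2)) as [K HK]; [lra|]. destruct (Hb ((s + 1) / 2)) as [L HL]; [lra|].
  exists (K * L / (1 - s / ((s + 1) / 2))). apply (bdd_conv a b K L ((s + 1) / 2) s); auto; lra.
Qed.

(** Peeling [n] heads off [a] gives an exact remainder, so the product formula needs only that this
    remainder tends to [0]. *)
Lemma ev_conv_split a b z n : adm a -> adm b -> Cmod z < 1 ->
  ev (conv a b) z = (psum a z n * ev b z + z ^ n * ev (conv (fun k => a (n + k)%nat) b) z)%C.
Proof.
  intros Ha Hb Hz.
  assert (An : forall n, adm (fun k => a (n + k)%nat)).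
  { intros m; induction m as [|m IH]; [exact Ha|].
    apply adm_ext with (fun k => a (m + S k)%nat); [intros; f_equal; lia|].
    apply (adm_shift _ IH). }
  induction n as [|n IH].
  - unfold psum; simpl. rewrite (ev_ext (conv a b) (conv (fun k => a k) b)) by reflexivity. ring.
  - rewrite IH. set (d := fun k => a (n + k)%nat).
    assert (E : ev (conv d b) z = (d O * ev b z + z * ev (conv (fun k => d (S k)) b) z)%C).
    { rewrite (ev_shift b z Hb Hz), (ev_shift (conv d b)); auto; [|apply adm_conv; auto; apply An].
      simpl conv.
      rewrite (ev_plus (fun n => d O * b (S n))%C (conv (fun k => d (S k)) b)), ev_scal; auto.
      - ring.
      - now apply adm_shift.
      - apply adm_scal. now apply adm_shift.
      - apply adm_conv; auto. apply adm_shift, An. }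
    rewrite E.
    rewrite (ev_ext (conv (fun k => a (S n + k)%nat) b) (conv (fun k => d (S k)) b)).
    2:{ intros k. apply conv_ext; auto. intros; unfold d; f_equal; lia. }
    unfold psum, d; simpl. rewrite Nat.add_0_r. ring.
Qed.

Lemma ev_conv a b z : adm a -> adm b -> Cmod z < 1 -> ev (conv a b) z = (ev a z * ev b z)%C.
Proof.
  intros Ha Hb Hz. pose proof (Cmod_ge_0 z) as Hz0.
  set (s := (Cmod z + 1) / 2). set (r := (s + 1) / 2).
  assert (Hs : Cmod z < s < 1) by (unfold s; lra).
  assert (Hr : s < r < 1) by (unfold r; lra).
  destruct (Ha r) as [K HK]; [lra|]. destruct (Hb r) as [L HL]; [lra|].
  pose proof (bdd_ge0 _ _ _ HK). pose proof (bdd_ge0 _ _ _ HL).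
  apply Cminus_eq_0, Cmod_eq_0. apply Rle_antisym; [|apply Cmod_ge_0].
  set (M := K * L / (1 - s / r) / (1 - Cmod z / s)).
  apply le_of_lim0 with
    (fun n => Cmod (ev b z) * Cmod (ev a z - psum a z n) + M * (Cmod z / r) ^ n).
  - intros n. rewrite (ev_conv_split a b z n) by auto.
    replace (psum a z n * ev b z + _ - _)%C with
      (z ^ n * ev (conv (fun k => a (n + k)%nat) b) z - ev b z * (ev a z - psum a z n))%C by ring.
    unfold Cminus at 1. eapply Rle_trans; [apply Cmod_triangle|].
    rewrite Cmod_opp, (Cmod_mult (ev b z)), Rplus_0_l, Rplus_comm.
    apply Rplus_le_compat_l.
    (* Dropping [n] coefficients costs a factor [1 / r ^ n], which the factor [z ^ n] of the
       remainder beats since [Cmod z < r]. *)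
    assert (B : bdd (fun k => a (n + k)%nat) (K / r ^ n) r).
    { intros k. assert (0 < r ^ n) by (apply pow_lt; lra).
      apply Rmult_le_reg_r with (r ^ n); auto. unfold Rdiv.
      rewrite (Rmult_assoc K), Rinv_l by lra. specialize (HK (n + k)%nat).
      rewrite pow_add in HK. lra. }
    assert (B2 := bdd_conv _ _ _ _ r s (conj (Rle_lt_trans _ _ _ Hz0 (proj1 Hs)) (proj1 Hr)) B HL).
    pose proof (ev_tail _ _ _ z O B2 ltac:(lra)) as T.
    unfold psum in T; simpl in T.
    replace (ev (conv (fun k => a (n + k)%nat) b) z - 0)%C
      with (ev (conv (fun k => a (n + k)%nat) b) z) in T by ring.
    rewrite Cmod_mult, Cmod_pow.
    eapply Rle_trans; [apply Rmult_le_compat_l; [apply pow_le, Cmod_ge_0|apply T]|].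
    right. unfold M, Rdiv. rewrite Rpow_mult_distr, pow_inv. 
    pose proof (ratio_lt1 z s ltac:(lra)). unfold Rdiv in *.
    ring.
  - replace 0 with (0 + 0) by ring. apply is_lim_seq_plus'.
    + replace (Finite 0) with (Rbar_mult (Cmod (ev b z)) 0) by (simpl; f_equal; ring).
      apply is_lim_seq_scal_l. now apply ev_lim.
    + apply geom_lim0. apply ratio_lt1. lra.
Qed.

(** * Derivatives of power series *)

Lemma lim0_bounded (s : nat -> R) : (forall n, 0 <= s n) -> is_lim_seq s 0 -> exists K, forall n, s n <= K.
Proof.
  intros H0 H. apply is_lim_seq_spec in H. destruct (H (mkposreal 1 Rlt_0_1)) as [N HN].
  exists (1 + rsum s N). intros n. pose proof (rsum_ge0 s N (fun i _ => H0 i)).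
  destruct (le_lt_dec N n) as [Hn|Hn].
  - specialize (HN n Hn). simpl in HN. apply Rabs_def2 in HN. lra.
  - pose proof (rsum_term_le s N n Hn H0). lra.
Qed.

Lemma pow_n_Cpow (z : C) n : pow_n (K := C_AbsRing) z n = (z ^ n)%C.
Proof. induction n as [|n IH]; [reflexivity|]. simpl. now rewrite IH. Qed.

Lemma sum_n_psum (a : nat -> C) z n :
  sum_n (G := C_NormedModule) (fun k => scal (pow_n (K := C_AbsRing) z k) (a k)) n = psum a z (S n).
Proof.
  induction n as [|n IH].
  - rewrite sum_O, pow_n_Cpow.
    change ((z ^ 0 * a O)%C = (0 + a O * z ^ 0)%C). ring.
  - rewrite sum_Sn, IH, pow_n_Cpow.
    change ((psum a z (S n) + z ^ S n * a (S n))%C = (psum a z (S n) + a (S n) * z ^ S n)%C). ring.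
Qed.

Lemma is_pseries_psum (a : nat -> C) z l :
  is_pseries (K := C_AbsRing) (V := C_NormedModule) a z l <->
  is_lim_seq (fun n => Cmod (l - psum a z n)) 0.
Proof.
  unfold is_pseries, is_series.
  set (u := sum_n (G := C_NormedModule) (fun k => scal (pow_n (K := C_AbsRing) z k) (a k))).
  assert (Hu : forall n, u n = psum a z (S n)) by (intros; apply sum_n_psum).
  transitivity (forall eps : posreal, eventually (fun n => ball_norm (V := C_NormedModule) l eps (u n))).
  { apply (@filterlim_locally_ball_norm C_AbsRing nat C_NormedModule eventually _ u l). }
  rewrite is_lim_seq_incr_1, <- is_lim_seq_spec.
  split; intros H eps; destruct (H eps) as [N HN]; exists N; intros n Hn; specialize (HN n Hn).
  - unfold ball_norm in HN. rewrite Hu in HN.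
    rewrite Rminus_0_r, Rabs_pos_eq, Cmod_minus_sym by apply Cmod_ge_0. exact HN.
  - unfold ball_norm. rewrite Hu.
    rewrite Rminus_0_r, Rabs_pos_eq, Cmod_minus_sym in HN by apply Cmod_ge_0. exact HN.
Qed.

(** The terms at the point [r] are differences of consecutive partial sums, which are bounded
    because they converge. *)
Lemma has_expansion_adm h a : has_expansion h a -> adm a.
Proof.
  intros H r Hr.
  assert (Hz : in_disk (RtoC r)) by (unfold in_disk; rewrite Cmod_R, Rabs_pos_eq; lra).
  specialize (H _ Hz). apply is_pseries_psum in H.
  destruct (lim0_bounded _ (fun n => Cmod_ge_0 _) H) as [K HK].
  exists (K + K). intros n.
  replace (Cmod (a n) * r ^ n) with (Cmod (psum a r (S n) - psum a r n)).
  - eapply Rle_trans; [apply (Cmod_triangle3 _ (h (RtoC r)))|].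
    rewrite Cmod_minus_sym. apply Rplus_le_compat; apply HK.
  - unfold psum. simpl csum. replace (_ - _)%C with (a n * RtoC r ^ n)%C by ring.
    rewrite Cmod_mult, Cmod_pow, Cmod_R, Rabs_pos_eq; lra.
Qed.

Lemma has_expansion_ev h a z : has_expansion h a -> in_disk z -> h z = ev a z.
Proof.
  intros H Hz. symmetry. apply ev_unique with (fun n => Cmod (h z - psum a z n)); auto.
  - now apply has_expansion_adm with h.
  - intros; lra.
  - now apply is_pseries_psum, H.
Qed.

Lemma ev_has_expansion a : adm a -> has_expansion (ev a) a.
Proof. intros H z Hz. apply is_pseries_psum. now apply ev_lim. Qed.

Definition der (a : nat -> C) (n : nat) : C := (RtoC (INR (S n)) * a (S n))%C.

Lemma adm_lin a : adm a -> adm (fun n => RtoC (INR (S n)) * a n)%C.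
Proof.
  intros Ha s Hs. set (r := (s + 1) / 2). assert (Hr : s < r < 1) by (unfold r; lra).
  destruct (Ha r) as [K HK]; [lra|]. exists (K * / (1 - s / r)). intros n.
  assert (Hq : 0 <= s / r < 1).
  { split; [apply Rdiv_le_0_compat; lra|]. apply Rmult_lt_reg_r with r; [lra|].
    unfold Rdiv. rewrite Rmult_assoc, Rinv_l; lra. }
  rewrite Cmod_mult, Cmod_R, Rabs_pos_eq by apply pos_INR.
  replace (s ^ n) with (r ^ n * (s / r) ^ n).
  2:{ rewrite <- Rpow_mult_distr. f_equal. field. lra. }
  replace (_ * _ * _) with ((Cmod (a n) * r ^ n) * (INR (S n) * (s / r) ^ n)) by ring.
  pose proof (bdd_ge0 _ _ _ HK).
  apply Rmult_le_compat; auto.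
  - apply Rmult_le_pos; [apply Cmod_ge_0|apply pow_le; lra].
  - apply Rmult_le_pos; [apply pos_INR|apply pow_le; lra].
  - now apply lin_geom_le.
Qed.

Lemma adm_der a : adm a -> adm (der a).
Proof.
  intros H. apply (adm_lin (fun n => a (S n))). now apply adm_shift.
Qed.

Lemma bdd_rsum a K r s n : bdd a K r -> 0 <= s < r ->
  rsum (fun i => Cmod (a i) * s ^ i) n <= K / (1 - s / r).
Proof.
  intros H Hs. assert (Hq : 0 <= s / r < 1).
  { split; [apply Rdiv_le_0_compat; lra|]. apply Rmult_lt_reg_r with r; [lra|].
    unfold Rdiv. rewrite Rmult_assoc, Rinv_l; lra. }
  pose proof (bdd_ge0 _ _ _ H).
  apply Rle_trans with (rsum (fun i => K * (s / r) ^ i) n).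
  - apply rsum_le. intros i _.
    replace (s ^ i) with (r ^ i * (s / r) ^ i).
    2:{ rewrite <- Rpow_mult_distr. f_equal. field. lra. }
    rewrite <- Rmult_assoc. apply Rmult_le_compat_r; [apply pow_le; lra|apply H].
  - rewrite rsum_scal. apply Rmult_le_compat_l; auto. now apply rsum_geom_le.
Qed.

(** The remainders satisfy [E_(n+1) = w E_n + (n + 1) z^n (w - z)^2], and [m^2 + m <= (m + 1)^2]
    closes the induction. The factor [r] on the left avoids the exponent [n - 1]. *)
Lemma pow_taylor2 (z w : C) r n : 0 < r -> Cmod z <= r -> Cmod w <= r ->
  Cmod (w ^ S n - z ^ S n - RtoC (INR (S n)) * z ^ n * (w - z))%C * r
   <= INR (S n) ^ 2 * r ^ n * Cmod (w - z) ^ 2.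
Proof.
  intros Hr Hz Hw. induction n as [|n IH].
  - simpl. replace (_ - _)%C with (RtoC 0) by ring. rewrite Cmod_0.
    pose proof (pow2_ge_0 (Cmod (w - z))). lra.
  - set (E := (w ^ S n - z ^ S n - RtoC (INR (S n)) * z ^ n * (w - z))%C) in *.
    replace (_ - _)%C with (w * E + RtoC (INR (S n)) * z ^ n * (w - z) ^ 2)%C.
    2:{ unfold E. rewrite (S_INR (S n)), RtoC_plus. simpl. ring. }
    pose proof (Cmod_triangle (w * E) (RtoC (INR (S n)) * z ^ n * (w - z) ^ 2)) as T.
    rewrite !Cmod_mult, !Cmod_pow, Cmod_R, Rabs_pos_eq in T by apply pos_INR.
    pose proof (Cmod_ge_0 E). pose proof (pos_INR (S n)).
    assert (Cmod z ^ n <= r ^ n) by (apply pow_incr; split; [apply Cmod_ge_0|auto]).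
    assert (0 <= Cmod z ^ n) by (apply pow_le, Cmod_ge_0).
    pose proof (pow2_ge_0 (Cmod (w - z))) as HD. set (D := Cmod (w - z) ^ 2) in *.
    assert (A1 : Cmod w * Cmod E <= r * Cmod E) by (apply Rmult_le_compat_r; auto).
    assert (A2 : INR (S n) * Cmod z ^ n * D <= INR (S n) * r ^ n * D).
    { apply Rmult_le_compat_r; auto. apply Rmult_le_compat_l; auto. }
    rewrite (S_INR (S n)). set (m := INR (S n)) in *. simpl (r ^ S n).
    assert (0 <= r ^ n) by (apply pow_le; lra).
    assert (P : 0 <= r ^ n * D) by (apply Rmult_le_pos; auto).
    apply Rle_trans with (r * (m ^ 2 * r ^ n * D) + m * r ^ n * D * r).
    + apply Rle_trans with (r * (Cmod E * r) + m * r ^ n * D * r); [|nra].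
      apply Rle_trans with ((r * Cmod E + m * r ^ n * D) * r); [|lra].
      apply Rmult_le_compat_r; lra.
    + replace (r * (m ^ 2 * r ^ n * D) + m * r ^ n * D * r) with ((m ^ 2 + m) * (r * (r ^ n * D))) by ring.
      replace ((m + 1) ^ 2 * (r * r ^ n) * D) with ((m + 1) ^ 2 * (r * (r ^ n * D))) by ring.
      apply Rmult_le_compat_r; [apply Rmult_le_pos; lra|nra].
Qed.

(** Summing the remainders of the monomials against [a] leaves the series with coefficients
    [(n + 1)^2 a_(n+1)], which converges at radius [r]. The uniform quadratic remainder yields both
    differentiability and Lipschitz bounds. *)
Lemma ev_taylor2 a r : adm a -> 0 < r < 1 -> exists K, forall z w, Cmod z <= r -> Cmod w <= r ->
  Cmod (ev a w - ev a z - (w - z) * ev (der a) z)%C <= K * Cmod (w - z) ^ 2.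
Proof.
  intros Ha Hr. set (c := fun n => (RtoC (INR (S n)) * der a n)%C).
  assert (Hd := adm_der a Ha). assert (Hc : adm c) by (apply adm_lin, Hd).
  destruct (Hc ((r + 1) / 2)) as [L HL]; [lra|].
  set (M := L / (1 - r / ((r + 1) / 2))).
  exists (M / r). intros z w Hz Hw.
  apply le_of_lim0 with (fun n => Cmod (ev a w - psum a w (S n)) + Cmod (ev a z - psum a z (S n))
    + Cmod (w - z) * Cmod (ev (der a) z - psum (der a) z n)).
  - intros n.
    set (E := fun i => (w ^ S i - z ^ S i - RtoC (INR (S i)) * z ^ i * (w - z))%C).
    assert (S1 : (psum a w (S n) - psum a z (S n) - (w - z) * psum (der a) z n)%C
       = csum (fun i => a (S i) * E i)%C n).
    { unfold psum. rewrite !csum_S_l.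
      rewrite (csum_ext (fun i => a (S i) * E i)%C (fun i =>
         (a (S i) * w ^ S i + (- (1)) * (a (S i) * z ^ S i)) + (- (w - z)) * (der a i * z ^ i))%C).
      - rewrite !csum_plus, !csum_scal. simpl. ring.
      - intros i _. unfold E, der. ring. }
    assert (S2 : Cmod (csum (fun i => a (S i) * E i)%C n) <= M / r * Cmod (w - z) ^ 2).
    { eapply Rle_trans; [apply Cmod_csum_le|].
      apply Rmult_le_reg_r with r; [lra|].
      apply Rle_trans with (Cmod (w - z) ^ 2 * rsum (fun i => Cmod (c i) * r ^ i) n).
      - rewrite <- rsum_scal, Rmult_comm, <- rsum_scal. apply rsum_le. intros i _.
        pose proof (pow_taylor2 z w r i ltac:(lra) Hz Hw) as T. fold (E i) in T.
        unfold c, der. rewrite !Cmod_mult, Cmod_R, Rabs_pos_eq by apply pos_INR.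
        pose proof (Cmod_ge_0 (a (S i))).
        apply Rle_trans with (Cmod (a (S i)) * (Cmod (E i) * r)); [lra|].
        eapply Rle_trans; [apply Rmult_le_compat_l; [auto|apply T]|]. right; ring.
      - replace (M / r * Cmod (w - z) ^ 2 * r) with (Cmod (w - z) ^ 2 * M) by (field; lra).
        apply Rmult_le_compat_l; [apply pow2_ge_0|]. apply bdd_rsum; auto. lra. }
    replace (ev a w - ev a z - (w - z) * ev (der a) z)%C with
      ((psum a w (S n) - psum a z (S n) - (w - z) * psum (der a) z n)
       + ((ev a w - psum a w (S n)) - (ev a z - psum a z (S n))
           - (w - z) * (ev (der a) z - psum (der a) z n)))%C by ring.
    eapply Rle_trans; [apply Cmod_triangle|]. rewrite S1. apply Rplus_le_compat; auto.
    unfold Cminus at 1. eapply Rle_trans; [apply Cmod_triangle|].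
    rewrite Cmod_opp, Cmod_mult. apply Rplus_le_compat_r.
    unfold Cminus at 1. eapply Rle_trans; [apply Cmod_triangle|]. rewrite Cmod_opp. lra.
  - assert (Lz : Cmod z < 1) by lra. assert (Lw : Cmod w < 1) by lra.
    replace 0 with (0 + 0 + Cmod (w - z) * 0) by ring.
    apply is_lim_seq_plus'; [apply is_lim_seq_plus'|].
    + apply (is_lim_seq_incr_1 (fun n => Cmod (ev a w - psum a w n))). now apply ev_lim.
    + apply (is_lim_seq_incr_1 (fun n => Cmod (ev a z - psum a z n))). now apply ev_lim.
    + apply (is_lim_seq_scal_l _ (Cmod (w - z)) (Finite 0)). now apply ev_lim.
Qed.

Lemma ev_bound a r : adm a -> 0 < r < 1 -> exists K, 0 <= K /\ forall z, Cmod z <= r -> Cmod (ev a z) <= K.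
Proof.
  intros Ha Hr. destruct (Ha ((r + 1) / 2)) as [K HK]; [lra|].
  pose proof (bdd_ge0 _ _ _ HK).
  assert (Hq : 0 <= r / ((r + 1) / 2) < 1).
  { split; [apply Rdiv_le_0_compat; lra|]. apply Rmult_lt_reg_r with ((r + 1) / 2); [lra|].
    unfold Rdiv at 1. rewrite Rmult_assoc, Rinv_l; lra. }
  exists (K / (1 - r / ((r + 1) / 2))). split.
  - apply Rdiv_le_0_compat; lra.
  - intros z Hz. replace (ev a z) with (ev a z - psum a z 0)%C by (unfold psum; simpl; ring).
    eapply Rle_trans; [apply (ev_tail a K ((r + 1) / 2)); auto; lra|].
    simpl. rewrite Rmult_1_r. unfold Rdiv at 1 3. apply Rmult_le_compat_l; auto.
    apply Rinv_le_contravar; [lra|].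
    assert (Cmod z / ((r + 1) / 2) <= r / ((r + 1) / 2)); [|lra].
    unfold Rdiv. apply Rmult_le_compat_r; auto. left. apply Rinv_0_lt_compat. lra.
Qed.

Lemma ev_lip a r : adm a -> 0 < r < 1 -> exists L, 0 <= L /\ forall z w, Cmod z <= r -> Cmod w <= r ->
  Cmod (ev a w - ev a z) <= L * Cmod (w - z).
Proof.
  intros Ha Hr. destruct (ev_taylor2 a r Ha Hr) as [K HK].
  destruct (ev_bound (der a) r (adm_der a Ha) Hr) as (B & HB0 & HB).
  exists (B + Rabs K * (r + r)). split.
  - pose proof (Rabs_pos K). nra.
  - intros z w Hz Hw. specialize (HK z w Hz Hw). specialize (HB z Hz).
    replace (ev a w - ev a z)%C with
      ((ev a w - ev a z - (w - z) * ev (der a) z) + (w - z) * ev (der a) z)%C by ring.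
    eapply Rle_trans; [apply Cmod_triangle|]. rewrite Cmod_mult.
    assert (D : Cmod (w - z) <= r + r).
    { unfold Cminus. eapply Rle_trans; [apply Cmod_triangle|]. rewrite Cmod_opp. lra. }
    pose proof (Cmod_ge_0 (w - z)) as D0. pose proof (Rle_abs K). pose proof (Rabs_pos K).
    set (d := Cmod (w - z)) in *.
    assert (K * d ^ 2 <= Rabs K * (r + r) * d).
    { apply Rle_trans with (Rabs K * d ^ 2); [apply Rmult_le_compat_r; [apply pow2_ge_0|auto]|].
      replace (Rabs K * (r + r) * d) with (Rabs K * ((r + r) * d)) by ring.
      apply Rmult_le_compat_l; auto. nra. }
    assert (d * Cmod (ev (der a) z) <= d * B) by (apply Rmult_le_compat_l; auto).
    lra.
Qed.

Lemma is_derive_ev h a z : has_expansion h a -> in_disk z ->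
  is_derive (K := C_AbsRing) (V := C_NormedModule) h z (ev (der a) z).
Proof.
  intros H Hz. pose proof (has_expansion_adm _ _ H) as Ha.
  unfold in_disk in Hz. pose proof (Cmod_ge_0 z) as Hz0.
  set (r := (Cmod z + 1) / 2). assert (Hr : Cmod z < r < 1) by (unfold r; lra).
  destruct (ev_taylor2 a r Ha ltac:(lra)) as [K HK].
  split; [apply is_linear_scal_l|].
  intros x Hx. apply (@is_filter_lim_locally_unique C_AbsRing (AbsRing_NormedModule C_AbsRing) z x) in Hx. subst x.
  intros eps. apply (@locally_le_locally_norm C_AbsRing (AbsRing_NormedModule C_AbsRing)).
  assert (HM : 0 < Rabs K + 1) by (pose proof (Rabs_pos K); lra).
  assert (Hd : 0 < Rmin (r - Cmod z) (eps / (Rabs K + 1))).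
  { apply Rmin_glb_lt; [lra|]. apply Rdiv_lt_0_compat; auto. apply cond_pos. }
  exists (mkposreal _ Hd). intros w Hw. unfold ball_norm in Hw.
  change (Cmod (w - z) < Rmin (r - Cmod z) (eps / (Rabs K + 1))) in Hw.
  change (Cmod ((h w - h z) - (w - z) * ev (der a) z) <= eps * Cmod (w - z)).
  pose proof (Rmin_l (r - Cmod z) (eps / (Rabs K + 1))).
  pose proof (Rmin_r (r - Cmod z) (eps / (Rabs K + 1))).
  assert (Wr : Cmod w <= r).
  { pose proof (Cmod_rev_triangle w z). lra. }
  rewrite (has_expansion_ev h a w H), (has_expansion_ev h a z H) by (unfold in_disk; lra).
  eapply Rle_trans; [apply HK; lra|].
  pose proof (Cmod_ge_0 (w - z)) as D0. set (d := Cmod (w - z)) in *.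
  assert (d * (Rabs K + 1) <= eps).
  { apply Rmult_le_reg_r with (/ (Rabs K + 1)); [now apply Rinv_0_lt_compat|].
    rewrite Rmult_assoc, Rinv_r by lra. unfold Rdiv in *. lra. }
  pose proof (Rle_abs K).
  replace (K * d ^ 2) with (K * d * d) by ring. apply Rmult_le_compat_r; auto. nra.
Qed.

Lemma C_derive_ev h a z : has_expansion h a -> in_disk z -> C_derive h z = ev (der a) z.
Proof. intros H Hz. apply is_C_derive_unique. now apply is_derive_ev. Qed.

(** * Parseval and contractions *)

Definition cis (x : R) : C := (cos x, sin x).

Lemma cis_plus x y : (cis x * cis y)%C = cis (x + y).
Proof. unfold cis, Cmult; simpl. rewrite cos_plus, sin_plus. f_equal; ring. Qed.

Lemma cis_0 : cis 0 = RtoC 1.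
Proof. unfold cis. now rewrite cos_0, sin_0. Qed.

Lemma cis_pow x n : (cis x ^ n)%C = cis (INR n * x).
Proof.
  induction n as [|n IH]; [simpl; now rewrite Rmult_0_l, cis_0|].
  rewrite Cpow_S, IH, cis_plus, S_INR. f_equal. ring.
Qed.

Lemma cis_conj x : Cconj (cis x) = cis (- x).
Proof. unfold cis, Cconj; simpl. now rewrite cos_neg, sin_neg. Qed.

Lemma Cmod_cis x : Cmod (cis x) = 1.
Proof.
  unfold Cmod, cis; simpl. rewrite !Rmult_1_r, Rplus_comm. fold (Rsqr (cos x)) (Rsqr (sin x)).
  rewrite sin2_cos2. apply sqrt_1.
Qed.

Lemma cis_neq_1 x : 0 < Rabs x < 2 * PI -> cis x <> RtoC 1.
Proof.
  intros Hx E. apply (f_equal fst) in E. simpl in E.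
  replace (cos x) with (cos (Rabs x)) in E.
  2:{ unfold Rabs. destruct (Rcase_abs x); auto. apply cos_neg. }
  set (y := Rabs x) in *. replace y with (2 * (y / 2)) in E by field.
  rewrite cos_2a_sin in E.
  assert (0 < sin (y / 2)) by (apply sin_gt_0; lra). nra.
Qed.

Lemma csum_geom_root (q : C) n : q <> 1%C -> (q ^ n)%C = 1%C -> csum (fun j => q ^ j)%C n = 0%C.
Proof.
  intros Hq Hn.
  assert (E : ((q - 1) * csum (fun j => q ^ j)%C n = q ^ n - 1)%C).
  { clear. induction n as [|n IH]; simpl; [ring|]. rewrite Cmult_plus_distr_l, IH. ring. }
  rewrite Hn in E.
  assert (Hq' : (q - 1)%C <> 0%C) by (intros F; apply Hq; now apply Cminus_eq_0).
  replace (csum (fun j => (q ^ j)%C) n) with (/ (q - 1) * ((q - 1) * csum (fun j => q ^ j) n))%C by (field; auto).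
  rewrite E. ring.
Qed.

Lemma csum_pick (f : nat -> C) m n : (m < n)%nat -> (forall i, (i < n)%nat -> i <> m -> f i = 0%C) -> csum f n = f m.
Proof.
  intros Hm H. replace n with (m + S (n - S m))%nat in * by lia. rewrite csum_app.
  rewrite csum_zero by (intros; apply H; lia). rewrite csum_S_l.
  rewrite csum_zero by (intros; apply H; lia). rewrite Nat.add_0_r. ring.
Qed.

Lemma csum_mult f g n m : (csum f n * csum g m)%C = csum (fun i => csum (fun j => f i * g j)%C m) n.
Proof.
  rewrite Cmult_comm, <- csum_scal. apply csum_ext. intros i _. rewrite csum_scal. ring.
Qed.

Lemma csum_const (c : C) n : csum (fun _ => c) n = (RtoC (INR n) * c)%C.
Proof. induction n as [|n IH]; [simpl; ring|]. rewrite S_INR, RtoC_plus. simpl. rewrite IH. ring. Qed.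

(** Expand the squared modulus and sum over the nodes first: an off-diagonal pair contributes a full
    geometric sum of an [M]-th root of unity, different from [1] because two indices below [M]
    differ by less than [M]. *)
Lemma discrete_parseval (c : nat -> C) M : (0 < M)%nat ->
  rsum (fun j => Cmod (psum c (cis (2 * PI / INR M) ^ j) M) ^ 2) M
   = INR M * rsum (fun n => Cmod (c n) ^ 2) M.
Proof.
  intros HM. apply RtoC_inj. rewrite RtoC_mult, <- !csum_RtoC.
  assert (HM' : 0 < INR M) by now apply lt_0_INR.
  set (t := 2 * PI / INR M).
  set (q := fun n m : nat => cis ((INR n - INR m) * t)).
  assert (Hq : forall n m, (n < M)%nat -> (m < M)%nat -> n <> m ->
     csum (fun j => q n m ^ j)%C M = 0%C).
  { intros n m Hn Hm Hnm. apply csum_geom_root.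
    - apply cis_neq_1. unfold t.
      assert (0 < Rabs (INR n - INR m) < INR M).
      { apply lt_INR in Hn, Hm. pose proof (pos_INR n). pose proof (pos_INR m). split.
        - apply Rabs_pos_lt. intros F. apply Hnm. apply INR_eq. lra.
        - apply Rabs_def1; lra. }
      rewrite Rabs_mult. pose proof PI_RGT_0.
      assert (Ht : 0 < 2 * PI / INR M) by (apply Rdiv_lt_0_compat; lra).
      rewrite (Rabs_pos_eq (2 * PI / INR M)) by lra. split.
      + apply Rmult_lt_0_compat; lra.
      + apply Rlt_le_trans with (INR M * (2 * PI / INR M)); [apply Rmult_lt_compat_r; lra|].
        right; field; lra.
    - unfold q. rewrite cis_pow. unfold t.
      replace (INR M * ((INR n - INR m) * (2 * PI / INR M)))
        with (0 + 2 * INR n * PI + - (0 + 2 * INR m * PI)) by (field; lra).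
      rewrite <- cis_plus, <- cis_conj. unfold cis at 1 2.
      rewrite !cos_period, !sin_period. rewrite cos_0, sin_0.
      unfold Cconj, Cmult; simpl. unfold RtoC. f_equal; ring. }
  rewrite (csum_ext _ (fun j => csum (fun n => csum (fun m => c n * Cconj (c m) * q n m ^ j)%C M) M)).
  2:{ intros j _. rewrite Cmod2_conj. unfold psum. rewrite csum_conj, csum_mult.
      apply csum_ext; intros n _. apply csum_ext; intros m _.
      rewrite Cmult_conj.
      replace (c n * (cis t ^ j) ^ n * (Cconj (c m) * Cconj ((cis t ^ j) ^ m)))%C
       with (c n * Cconj (c m) * ((cis t ^ j) ^ n * Cconj ((cis t ^ j) ^ m)))%C by ring.
      f_equal. unfold q. rewrite !cis_pow, cis_conj, cis_plus. f_equal. ring. }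
  rewrite (csum_swap (fun j n => csum (fun m => c n * Cconj (c m) * q n m ^ j)%C M) M M).
  rewrite <- csum_scal. apply csum_ext. intros n Hn.
  rewrite (csum_swap (fun j m => (c n * Cconj (c m) * q n m ^ j)%C) M M).
  rewrite (csum_pick _ n); auto.
  - rewrite (csum_ext _ (fun _ => RtoC (Cmod (c n) ^ 2))); [apply csum_const|].
    intros j _. rewrite Cmod2_conj. unfold q.
    replace ((INR n - INR n) * t) with 0 by ring. rewrite cis_0, Cpow_1_l. ring.
  - intros m Hm Hnm. rewrite csum_scal, Hq by auto. ring.
Qed.

Definition nrm2 (a : nat -> C) (r : R) (n : nat) : R := rsum (fun i => (Cmod (a i) * r ^ i) ^ 2) n.

Lemma nrm2_psum a r M : 0 <= r -> (0 < M)%nat ->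
  rsum (fun j => Cmod (psum a (RtoC r * cis (2 * PI / INR M) ^ j) M) ^ 2) M = INR M * nrm2 a r M.
Proof.
  intros Hr HM.
  rewrite (rsum_ext _ (fun j => Cmod (psum (fun n => a n * RtoC r ^ n)%C (cis (2 * PI / INR M) ^ j) M) ^ 2)).
  - rewrite discrete_parseval by auto. f_equal. apply rsum_ext. intros i _.
    now rewrite Cmod_mult, Cmod_pow, Cmod_R, Rabs_pos_eq.
  - intros j _. f_equal. f_equal. apply csum_ext. intros i _. rewrite Cpow_mult_l. ring.
Qed.

(** A pointwise inequality on a circle becomes one between mean squares. Both series are truncated
    at [M] and sampled at [M] equidistant nodes, where Parseval is exact; the truncation errors
    vanish geometrically as [M] grows. *)
Lemma circle_l2_le u v r B : adm u -> adm v -> 0 < r < 1 ->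
  (forall z, Cmod z = r -> Cmod (ev v z) <= Cmod (ev u z)) ->
  (forall n, nrm2 u r n <= B) -> forall n, nrm2 v r n <= B.
Proof.
  intros Hu Hv Hr H HB N.
  assert (HB0 : 0 <= B) by (specialize (HB O); exact HB).
  set (s := (r + 1) / 2). assert (Hs : r < s < 1) by (unfold s; lra).
  destruct (Hu s) as [K HK]; [lra|]. destruct (Hv s) as [L HL]; [lra|].
  pose proof (bdd_ge0 _ _ _ HK) as K0. pose proof (bdd_ge0 _ _ _ HL) as L0.
  assert (Hq : 0 <= r / s < 1).
  { split; [apply Rdiv_le_0_compat; lra|]. apply Rmult_lt_reg_r with s; [lra|].
    unfold Rdiv. rewrite Rmult_assoc, Rinv_l; lra. }
  set (q := r / s) in *. set (c := (K + L) / (1 - q)).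
  assert (c0 : 0 <= c) by (apply Rdiv_le_0_compat; lra).
  (* With [M = n + S N] and truncation error [e = c * q ^ M], the bound comes from [(x + 2 e)^2 <=
     (1 + 2 e) x^2 + 2 e + 4 e^2], that is [2 x <= x^2 + 1], averaged over the nodes. *)
  apply le_of_lim0 with (fun n => (2 * (c * q ^ (n + S N)) * (B + 1) + 4 * (c * q ^ (n + S N)) ^ 2)).
  - intros n. set (M := (n + S N)%nat). set (e := c * q ^ M).
    assert (e0 : 0 <= e) by (apply Rmult_le_pos; auto; apply pow_le; lra).
    assert (HM : (0 < M)%nat) by (unfold M; lia).
    assert (HM' : 0 < INR M) by now apply lt_0_INR.
    apply Rle_trans with (nrm2 v r M).
    { apply rsum_incr; [unfold M; lia|intros; apply pow2_ge_0]. }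
    apply Rmult_le_reg_l with (INR M); auto.
    rewrite <- nrm2_psum by (auto; lra).
    apply Rle_trans with (rsum (fun j => (1 + 2 * e) *
       Cmod (psum u (RtoC r * cis (2 * PI / INR M) ^ j) M) ^ 2 + (2 * e + 4 * e ^ 2)) M).
    + apply rsum_le. intros j _.
      set (z := (RtoC r * cis (2 * PI / INR M) ^ j)%C).
      assert (Hz : Cmod z = r).
      { unfold z. rewrite Cmod_mult, Cmod_pow, Cmod_cis, pow1, Cmod_R, Rabs_pos_eq; lra. }
      pose proof (ev_tail u K s z M HK ltac:(lra)) as T1.
      pose proof (ev_tail v L s z M HL ltac:(lra)) as T2.
      rewrite Hz in T1, T2. fold q in T1, T2.
      assert (E : K / (1 - q) * q ^ M + L / (1 - q) * q ^ M = e) by (unfold e, c; field; lra).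
      assert (0 <= K / (1 - q) * q ^ M)
        by (apply Rmult_le_pos; [apply Rdiv_le_0_compat; lra|apply pow_le; lra]).
      assert (0 <= L / (1 - q) * q ^ M)
        by (apply Rmult_le_pos; [apply Rdiv_le_0_compat; lra|apply pow_le; lra]).
      specialize (H z Hz).
      pose proof (Cmod_rev_triangle (psum v z M) (ev v z)) as R1.
      rewrite Cmod_minus_sym in R1.
      pose proof (Cmod_rev_triangle (ev u z) (psum u z M)) as R2.
      assert (P : Cmod (psum v z M) <= Cmod (psum u z M) + 2 * e) by lra.
      pose proof (Cmod_ge_0 (psum v z M)). pose proof (Cmod_ge_0 (psum u z M)).
      set (x := Cmod (psum u z M)) in *. set (y := Cmod (psum v z M)) in *.
      apply Rle_trans with ((x + 2 * e) ^ 2); [apply pow_incr; lra|].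
      assert (0 <= e * (x - 1) ^ 2) by (apply Rmult_le_pos; auto; apply pow2_ge_0). nra.
    + rewrite rsum_plus, rsum_scal, rsum_const, nrm2_psum by (auto; lra).
      specialize (HB M). change (c * q ^ (n + S N)) with e.
      replace ((1 + 2 * e) * (INR M * nrm2 u r M) + INR M * (2 * e + 4 * e ^ 2))
        with (INR M * ((1 + 2 * e) * nrm2 u r M + (2 * e + 4 * e ^ 2))) by ring.
      apply Rmult_le_compat_l; [lra|]. nra.
  - apply is_lim_seq_ext with (fun n => (2 * (B + 1) * c * q ^ S N) * q ^ n
       + (4 * c ^ 2 * (q ^ S N) ^ 2) * (q ^ 2) ^ n).
    + intros n. replace ((q ^ 2) ^ n) with ((q ^ n) ^ 2) by (rewrite <- !pow_mult; f_equal; lia).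
      rewrite pow_add. ring.
    + replace 0 with (0 + 0) by ring. apply is_lim_seq_plus'; apply geom_lim0; nra.
Qed.

Lemma nrm2_le_limit a B n : (forall r, 0 < r < 1 -> nrm2 a r n <= B) -> nrm2 a 1 n <= B.
Proof.
  intros H. set (S := nrm2 a 1 n).
  assert (P : forall r, 0 < r < 1 -> S * r ^ (2 * n) <= B).
  { intros r Hr. eapply Rle_trans; [|apply (H r Hr)]. unfold S, nrm2.
    rewrite Rmult_comm, <- rsum_scal. apply rsum_le. intros i Hi.
    rewrite pow1, Rmult_1_r, Rpow_mult_distr, Rmult_comm.
    apply Rmult_le_compat_l; [apply pow2_ge_0|].
    replace (2 * n)%nat with (i * 2 + 2 * (n - i))%nat by lia.
    rewrite pow_add, pow_mult.
    assert (r ^ (2 * (n - i)) <= 1) by (rewrite <- (pow1 (2 * (n - i))); apply pow_incr; lra).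
    pose proof (pow2_ge_0 (r ^ i)). nra. }
  assert (L : Rbar_le (S * 1) B).
  { apply (is_lim_seq_le (fun k => S * (1 - / (INR k + 2)) ^ (2 * n)) (fun _ => B)).
    - intros k. apply P. pose proof (pos_INR k).
      assert (0 < / (INR k + 2)) by (apply Rinv_0_lt_compat; lra).
      assert (/ (INR k + 2) < 1) by (rewrite <- Rinv_1; apply Rinv_lt_contravar; lra). lra.
    - apply (is_lim_seq_scal_l _ S (Finite 1)).
      assert (L1 : is_lim_seq (fun k => 1 - / (INR k + 2)) 1).
      { replace (Finite 1) with (Finite (1 - 0)) by (f_equal; ring).
        apply is_lim_seq_minus'; [apply is_lim_seq_const|].
        replace (Finite 0) with (Rbar_inv p_infty) by reflexivity.
        apply is_lim_seq_inv; [|discriminate].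
        eapply is_lim_seq_plus; [apply is_lim_seq_INR|apply is_lim_seq_const|reflexivity]. }
      clear P. induction (2 * n)%nat as [|m IH]; simpl.
      + apply is_lim_seq_const.
      + replace (Finite 1) with (Finite (1 * 1)) by (f_equal; ring). apply is_lim_seq_mult'; auto.
    - apply is_lim_seq_const. }
  simpl in L. lra.
Qed.

Lemma nrm2_ge0 a r n : 0 <= nrm2 a r n.
Proof. apply rsum_ge0. intros; apply pow2_ge_0. Qed.

Lemma nrm2_ext a b r n : (forall i, (i < n)%nat -> a i = b i) -> nrm2 a r n = nrm2 b r n.
Proof. intros H. apply rsum_ext. intros i Hi. now rewrite H. Qed.

(* The truncated lower triangular Toeplitz matrices of [a] have operator norm at most [1]. *)
Definition contractive (a : nat -> C) : Prop :=
  forall x n, nrm2 (conv a x) 1 n <= nrm2 x 1 n.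

Definition trunc (N : nat) (x : nat -> C) (n : nat) : C := if lt_dec n N then x n else 0%C.

Lemma trunc_lt N x n : (n < N)%nat -> trunc N x n = x n.
Proof. intros H. unfold trunc. destruct (lt_dec n N); [auto|lia]. Qed.

Lemma trunc_ge N x n : (N <= n)%nat -> trunc N x n = 0%C.
Proof. intros H. unfold trunc. destruct (lt_dec n N); [lia|auto]. Qed.

Lemma nrm2_trunc_le x N r n : nrm2 (trunc N x) r n <= nrm2 x r N.
Proof.
  destruct (le_lt_dec n N) as [H|H].
  - rewrite (nrm2_ext (trunc N x) x) by (intros; apply trunc_lt; lia).
    apply rsum_incr; auto. intros; apply pow2_ge_0.
  - right. rewrite <- (nrm2_ext (trunc N x) x) by (intros; apply trunc_lt; lia).
    replace n with (N + (n - N))%nat by lia. unfold nrm2.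
    induction (n - N)%nat as [|m IH]; [now rewrite Nat.add_0_r|].
    rewrite Nat.add_succ_r. simpl. rewrite trunc_ge, Cmod_0 by lia. simpl in IH. rewrite IH. ring.
Qed.

Lemma nrm2_scal (c : R) a r n : 0 <= c -> nrm2 (fun k => RtoC c * a k)%C r n = c ^ 2 * nrm2 a r n.
Proof.
  intros Hc. unfold nrm2. rewrite <- rsum_scal. apply rsum_ext. intros i _.
  rewrite Cmod_mult, Cmod_R, Rabs_pos_eq by auto. ring.
Qed.

Lemma nrm2_le_1 a r n : 0 <= r <= 1 -> nrm2 a r n <= nrm2 a 1 n.
Proof.
  intros Hr. apply rsum_le. intros i _. rewrite pow1.
  pose proof (Cmod_ge_0 (a i)).
  assert (0 <= r ^ i) by (apply pow_le; lra).
  assert (r ^ i <= 1) by (rewrite <- (pow1 i); apply pow_incr; lra).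
  apply pow_incr. nra.
Qed.

Lemma conv_nrm2_le a beta x n : adm a -> 0 <= beta ->
  (forall z, Cmod z < 1 -> Cmod (ev a z) <= beta) ->
  nrm2 (conv a x) 1 n <= beta ^ 2 * nrm2 x 1 n.
Proof.
  intros Ha Hb H. apply nrm2_le_limit. intros r Hr.
  set (t := trunc n x).
  assert (Ht : adm t) by (apply adm_finite with n; intros; now apply trunc_ge).
  rewrite (nrm2_ext _ (conv a t)).
  2:{ intros i Hi. apply conv_ext; auto. intros; symmetry; apply trunc_lt; lia. }
  apply circle_l2_le with (fun k => RtoC beta * t k)%C; auto.
  - now apply adm_scal.
  - now apply adm_conv.
  - intros z Hz. rewrite ev_conv, ev_scal by (auto; lra). rewrite !Cmod_mult, Cmod_R, Rabs_pos_eq by auto.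
    apply Rmult_le_compat_r; [apply Cmod_ge_0|apply H; lra].
  - intros m. rewrite nrm2_scal by auto. apply Rmult_le_compat_l; [apply pow2_ge_0|].
    eapply Rle_trans; [apply nrm2_trunc_le|]. apply nrm2_le_1; lra.
Qed.

Lemma bounded_contractive a : adm a -> (forall z, Cmod z < 1 -> Cmod (ev a z) <= 1) -> contractive a.
Proof.
  intros Ha H x n. pose proof (conv_nrm2_le a 1 x n Ha Rle_0_1 H). lra.
Qed.

(** * Carlson's inequalities *)

Definition sq (a : nat -> C) (n : nat) : R := rsum (fun i => Cmod (a i) ^ 2) n.

Lemma nrm2_1 a n : nrm2 a 1 n = sq a n.
Proof. apply rsum_ext. intros i _. now rewrite pow1, Rmult_1_r. Qed.

Lemma sq_ge0 a n : 0 <= sq a n.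
Proof. apply rsum_ge0. intros; apply pow2_ge_0. Qed.

Lemma rsum_app f n m : rsum f (n + m) = rsum f n + rsum (fun i => f (n + i)%nat) m.
Proof.
  induction m as [|m IH]; simpl; [rewrite Nat.add_0_r; ring|].
  rewrite Nat.add_succ_r. simpl. rewrite IH. ring.
Qed.

Lemma rsum_zero f n : (forall i, (i < n)%nat -> f i = 0) -> rsum f n = 0.
Proof.
  induction n as [|n IH]; simpl; intros H; [reflexivity|].
  rewrite IH by (intros; apply H; lia). rewrite H by lia. ring.
Qed.

Lemma contractive_sq a x n : contractive a -> sq (conv a x) n <= sq x n.
Proof. intros H. rewrite <- !nrm2_1. apply H. Qed.

Definition zshift (n : nat) (y : nat -> C) (k : nat) : C :=
  if lt_dec k n then 0%C else y (k - n)%nat.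

Lemma zshift_lt n y k : (k < n)%nat -> zshift n y k = 0%C.
Proof. intros H. unfold zshift. destruct (lt_dec k n); [auto|lia]. Qed.

Lemma zshift_add n y k : zshift n y (n + k) = y k.
Proof. unfold zshift. destruct (lt_dec (n + k) n); [lia|f_equal; lia]. Qed.

Lemma conv_zshift_lt a n y k : (k < n)%nat -> conv a (zshift n y) k = 0%C.
Proof.
  intros H. rewrite conv_csum. apply csum_zero. intros i Hi. rewrite zshift_lt by lia. ring.
Qed.

Lemma conv_zshift_add a n y k : conv a (zshift n y) (n + k) = conv a y k.
Proof.
  rewrite !conv_csum. replace (S (n + k)) with (S k + n)%nat by lia. rewrite csum_app.
  rewrite (csum_zero (fun i => a (S k + i)%nat * zshift n y (n + k - (S k + i)))%C).
  - rewrite Cplus_0_r. apply csum_ext. intros i Hi.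
    replace (n + k - i)%nat with (n + (k - i))%nat by lia. now rewrite zshift_add.
  - intros i Hi. rewrite zshift_lt by lia. ring.
Qed.

(** The test series is [1 + z^n y(z)]. Its two parts have disjoint supports, and its image has
    entries [a_0, ..., a_(n-1)] followed by [a_(n+i) + (a y)_i]. *)
Lemma contractive_test a n m y : contractive a -> (1 <= n)%nat ->
  sq a n + rsum (fun i => Cmod (a (n + i)%nat + conv a y i) ^ 2) m <= 1 + sq y m.
Proof.
  intros Ha Hn. pose proof (contractive_sq a (fun k => delta0 k + zshift n y k)%C (n + m) Ha) as H.
  unfold sq in H. rewrite !rsum_app in H.
  rewrite (rsum_ext _ (fun i => Cmod (a i) ^ 2)) in H.
  2:{ intros i Hi. rewrite conv_plus_r, conv_one_r, conv_zshift_lt by auto. now rewrite Cplus_0_r. }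
  rewrite (rsum_ext (fun i => Cmod (conv a _ (n + i)) ^ 2)
     (fun i => Cmod (a (n + i)%nat + conv a y i) ^ 2)) in H.
  2:{ intros i Hi. now rewrite conv_plus_r, conv_one_r, conv_zshift_add. }
  rewrite (rsum_ext (fun i => Cmod (delta0 (n + i) + _) ^ 2) (fun i => Cmod (y i) ^ 2)) in H.
  2:{ intros i Hi. rewrite zshift_add. destruct n as [|n]; [lia|]. simpl delta0. now rewrite Cplus_0_l. }
  replace (rsum (fun i => Cmod (delta0 i + zshift n y i) ^ 2) n) with 1 in H.
  - exact H.
  - destruct n as [|n]; [lia|]. rewrite rsum_S_l, rsum_zero.
    + rewrite zshift_lt by lia. simpl delta0. rewrite Cplus_0_r, Cmod_1. ring.
    + intros i Hi. rewrite zshift_lt by lia. simpl delta0. rewrite Cplus_0_r, Cmod_0. ring.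
Qed.

Lemma contractive_sq_le1 a n : contractive a -> sq a n <= 1.
Proof.
  intros Ha. destruct n as [|n]; [unfold sq; simpl; lra|].
  pose proof (contractive_test a (S n) 0 a Ha ltac:(lia)) as H. 
  change (sq a (S n) + 0 <= 1 + 0) in H. lra.
Qed.

Lemma polar (x : C) : exists u, Cmod u = 1 /\ x = (RtoC (Cmod x) * u)%C.
Proof.
  destruct (Req_dec (Cmod x) 0) as [H|H].
  - exists (RtoC 1). rewrite Cmod_1, H. split; auto. apply Cmod_eq_0 in H. rewrite H. ring.
  - assert (Hx : RtoC (Cmod x) <> 0%C) by (intros F; apply H; now apply RtoC_inj).
    exists (x / RtoC (Cmod x))%C. split.
    + rewrite Cmod_div by auto. rewrite (Cmod_R (Cmod x)), Rabs_pos_eq by apply Cmod_ge_0. field; auto.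
    + field. auto.
Qed.

Lemma align_phase (x y : C) : exists u, Cmod u = 1 /\ Cmod (x + y * u) = Cmod x + Cmod y.
Proof.
  destruct (polar x) as (u & Hu & Ex). destruct (polar y) as (v & Hv & Ey).
  exists (u * Cconj v)%C. split.
  - rewrite Cmod_mult, Cmod_conj, Hu, Hv. ring.
  - pose proof (Cmod2_conj v) as E. rewrite Hv in E.
    replace (x + y * (u * Cconj v))%C with (RtoC (Cmod x + Cmod y) * u)%C.
    + rewrite Cmod_mult, Hu, Cmod_R, Rabs_pos_eq; [ring|].
      pose proof (Cmod_ge_0 x); pose proof (Cmod_ge_0 y); lra.
    + rewrite Ex at 2. rewrite Ey at 2.
      replace (RtoC (Cmod x) * u + RtoC (Cmod y) * v * (u * Cconj v))%C
        with (RtoC (Cmod x) * u + RtoC (Cmod y) * u * (v * Cconj v))%C by ring.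
      rewrite <- E, RtoC_plus. replace (1 ^ 2) with 1 by ring. ring.
Qed.

(** For [s < 1] the choice [l = 1 / (1 - s)] turns the hypothesis into
    [b^2 / (1 - s) <= 1 - s + S - X]. For [s = 1] the inequality reads [b^2 (1 + 2 l) <= S - X], and
    a large [l] forces [b = 0]. The terms [S] and [X] carry the additional coordinate of the even
    case. *)
Lemma test_optimize s b S X : 0 <= s <= 1 ->
  (forall l, 0 <= l -> s + X + (b * (1 + l * s)) ^ 2 <= 1 + S + (l * b) ^ 2 * s) ->
  b ^ 2 <= (1 - s) * (1 - s + S - X).
Proof.
  intros Hs H. destruct (Req_dec s 1) as [->|Hs1].
  - assert (b ^ 2 = 0); [|lra]. apply Rle_antisym; [|apply pow2_ge_0].
    apply Rnot_lt_le. intros Hb.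
    assert (HY : 0 <= Rabs (S - X) / b ^ 2)
      by (apply Rdiv_le_0_compat; [apply Rabs_pos|lra]).
    specialize (H (Rabs (S - X) / b ^ 2) HY).
    assert (E : Rabs (S - X) / b ^ 2 * b ^ 2 = Rabs (S - X)) by (field; nra).
    pose proof (Rle_abs (S - X)). pose proof (Rabs_pos (S - X)).
    set (l := Rabs (S - X) / b ^ 2) in *. nra.
  - specialize (H (/ (1 - s)) ltac:(left; apply Rinv_0_lt_compat; lra)).
    assert (E : b ^ 2 / (1 - s) <= 1 - s + S - X).
    { replace ((b * (1 + / (1 - s) * s)) ^ 2) with (b ^ 2 / (1 - s) + (/ (1 - s) * b) ^ 2 * s) in H
        by (field; lra). lra. }
    apply Rmult_le_reg_l with (/ (1 - s)); [apply Rinv_0_lt_compat; lra|].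
    replace (/ (1 - s) * ((1 - s) * (1 - s + S - X))) with (1 - s + S - X) by (field; lra).
    unfold Rdiv in E. lra.
Qed.

(** The vector giving equality in Cauchy-Schwarz for the [m]-th output: its product with [a] has
    [m]-th coefficient [|a_0|^2 + ... + |a_m|^2]. *)
Definition rev_conj (a : nat -> C) (m : nat) (j : nat) : C := Cconj (a (m - j)%nat).

Lemma conv_rev_conj a (t : C) m : conv a (fun j => t * rev_conj a m j)%C m = (t * RtoC (sq a (S m)))%C.
Proof.
  rewrite conv_scal_r. f_equal. rewrite conv_csum. unfold sq. rewrite <- csum_RtoC.
  apply csum_ext. intros i Hi. rewrite Cmod2_conj. unfold rev_conj.
  now replace (m - (m - i))%nat with i by lia.
Qed.

Lemma rsum_rev f n : rsum (fun i => f (n - i)%nat) (S n) = rsum f (S n).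
Proof.
  revert f. induction n as [|n IH]; intros f; [reflexivity|].
  rewrite rsum_S_l, (rsum_S_l f). 
  change (rsum f (S (S n))) with (rsum f (S n) + f (S n)).
  rewrite (rsum_ext (fun i => f (S n - S i)%nat) (fun i => f (n - i)%nat)) by reflexivity.
  rewrite IH, <- (rsum_S_l f). simpl. ring.
Qed.

Lemma sq_rev_conj a (t : C) m : sq (fun j => t * rev_conj a m j)%C (S m) = Cmod t ^ 2 * sq a (S m).
Proof.
  unfold sq. rewrite <- rsum_scal, <- (rsum_rev (fun i => Cmod t ^ 2 * Cmod (a i) ^ 2) m).
  apply rsum_ext. intros i _.
  unfold rev_conj. rewrite Cmod_mult, Cmod_conj. ring.
Qed.

Lemma Cmod_scal_pos (l : R) (z : C) : 0 <= l -> Cmod (RtoC l * z) = l * Cmod z.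
Proof. intros H. now rewrite Cmod_mult, Cmod_R, Rabs_pos_eq. Qed.

Lemma pow2_le_inv x y : 0 <= y -> x ^ 2 <= y ^ 2 -> x <= y.
Proof. intros Hy H. apply Rnot_lt_le. intros F. nra. Qed.

(** Test on [1 + z^(m+1) l b R(z)], with [R] the reversed conjugate of [a_0, ..., a_m]. Of the
    second block only the entry of index [2 m + 1] is kept, where [R] reinforces [b] to
    [b (1 + l s)]. *)
Lemma carlson_odd a m : contractive a -> Cmod (a (S (2 * m))) <= 1 - sq a (S m).
Proof.
  intros Ha. set (s := sq a (S m)). set (b := a (S (2 * m))).
  assert (Hs : 0 <= s <= 1) by (split; [apply sq_ge0|now apply contractive_sq_le1]).
  apply pow2_le_inv; [lra|].
  apply Rle_trans with ((1 - s) * (1 - s + 0 - 0)); [|right; ring].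
  apply test_optimize; auto. intros l Hl.
  pose proof (contractive_test a (S m) (S m) (fun j => (RtoC l * b) * rev_conj a m j)%C Ha ltac:(lia)) as T.
  rewrite sq_rev_conj, Cmod_scal_pos in T by auto. fold s in T.
  assert (L : Cmod (a (S m + m)%nat + conv a (fun j => (RtoC l * b) * rev_conj a m j)%C m) ^ 2
     <= rsum (fun i => Cmod (a (S m + i)%nat + conv a (fun j => (RtoC l * b) * rev_conj a m j)%C i) ^ 2) (S m)).
  { apply (rsum_term_le (fun i => Cmod (a (S m + i)%nat + conv a (fun j => (RtoC l * b) * rev_conj a m j)%C i) ^ 2)).
    - lia.
    - intros; apply pow2_ge_0. }
  rewrite conv_rev_conj in L. fold s in L.
  replace (S m + m)%nat with (S (2 * m)) in L by lia. fold b in L.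
  replace (b + RtoC l * b * RtoC s)%C with (RtoC (1 + l * s) * b)%C in L
    by (rewrite RtoC_plus, RtoC_mult; ring).
  rewrite Cmod_scal_pos in L by nra. rewrite Rmult_comm with (r1 := Cmod b). lra.
Qed.

(** For the index [2 m + 2] the vector acting on [a_0, ..., a_m] is preceded by one entry [sg],
    which meets [a_(m+1)]. The phase of [sg] makes [|a_(2m+2)|] and [|a_(m+1)| rho] add up, and this
    product is the additional subtracted term. *)
Lemma carlson_even a m : contractive a ->
  Cmod (a (2 * S m)%nat) <= 1 - sq a (S m) - Cmod (a (S m)) ^ 2 / (1 + Cmod (a O)).
Proof.
  intros Ha. set (s := sq a (S m)). set (A := Cmod (a (S m))).
  pose proof (Cmod_ge_0 (a O)) as a0. assert (A0 : 0 <= A) by apply Cmod_ge_0.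
  (* The size of [sg] below is chosen so that [A - |a 0| rho = rho], which cancels [rho ^ 2 - X]. *)
  set (rho := A / (1 + Cmod (a O))).
  assert (R0 : 0 <= rho) by (apply Rdiv_le_0_compat; lra).
  assert (ER : A = rho * (1 + Cmod (a O))) by (unfold rho; field; lra).
  destruct (align_phase (a (2 * S m)%nat) (a (S m) * RtoC rho)%C) as (u & Hu & Eu).
  assert (Hs : 0 <= s <= 1) by (split; [apply sq_ge0|now apply contractive_sq_le1]).
  set (sg := (RtoC rho * u)%C).
  assert (Hsg : Cmod sg = rho) by (unfold sg; rewrite Cmod_scal_pos, Hu by auto; ring).
  set (b := (a (2 * S m)%nat + a (S m) * sg)%C).
  set (X := Cmod (a (S m) + a O * sg)%C ^ 2).
  assert (HX : rho ^ 2 <= X).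
  { unfold X. apply pow_incr. split; auto.
    pose proof (Cmod_rev_triangle (a (S m)) (- (a O * sg))) as T.
    rewrite Cmod_opp, Cmod_mult, Hsg in T. fold A in T.
    replace (a (S m) - - (a O * sg))%C with (a (S m) + a O * sg)%C in T by ring. nra. }
  assert (HB : Cmod b ^ 2 <= (1 - s) * (1 - s + rho ^ 2 - X)).
  { apply test_optimize; auto. intros l Hl.
    set (y := fun j => match j with O => sg | S j => ((RtoC l * b) * rev_conj a m j)%C end).
    pose proof (contractive_test a (S m) (S (S m)) y Ha ltac:(lia)) as T.
    unfold sq at 2 in T. rewrite (rsum_S_l (fun i => Cmod (y i) ^ 2)) in T.
    change (rsum (fun i => Cmod (y (S i)) ^ 2) (S m))
      with (sq (fun j => (RtoC l * b) * rev_conj a m j)%C (S m)) in T.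
    rewrite sq_rev_conj, Cmod_scal_pos in T by auto. fold s in T.
    change (Cmod (y O)) with (Cmod sg) in T. rewrite Hsg in T.
    set (F := fun i => Cmod (a (S m + i)%nat + conv a y i)%C ^ 2) in T.
    assert (L : F O + F (S m) <= rsum F (S (S m))).
    { rewrite rsum_S_l. apply Rplus_le_compat_l.
      apply (rsum_term_le (fun i => F (S i)) (S m) m); [lia|intros; apply pow2_ge_0]. }
    unfold F in L at 1 2. rewrite conv_S_r in L.
    change (conv a (fun k => y (S k)) m) with (conv a (fun j => (RtoC l * b) * rev_conj a m j)%C m) in L.
    rewrite conv_rev_conj in L. fold s in L. change (y O) with sg in L.
    change (conv a y O) with (a O * sg)%C in L. rewrite Nat.add_0_r in L. fold X in L.
    replace (S m + S m)%nat with (2 * S m)%nat in L by lia.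
    replace (a (2 * S m)%nat + (a (S m) * sg + RtoC l * b * RtoC s))%C
      with (RtoC (1 + l * s) * b)%C in L
      by (rewrite RtoC_plus, RtoC_mult; unfold b; ring).
    rewrite Cmod_scal_pos in L by nra. rewrite Rmult_comm with (r1 := Cmod b). lra. }
  assert (HB2 : Cmod b <= 1 - s).
  { apply pow2_le_inv; [lra|]. eapply Rle_trans; [apply HB|]. nra. }
  assert (Eb : Cmod b = Cmod (a (2 * S m)%nat) + rho * A).
  { unfold b, sg. replace (a (S m) * (RtoC rho * u))%C with (a (S m) * RtoC rho * u)%C by ring.
    rewrite Eu, Cmod_mult, Cmod_R, Rabs_pos_eq by auto. fold A. ring. }
  replace (A ^ 2 / (1 + Cmod (a O))) with (rho * A) by (unfold rho; field; lra). lra.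
Qed.

(** * The Schwarz-Pick inequality *)

Lemma rsum_cauchy_schwarz f g n :
  rsum (fun i => f i * g i) n ^ 2 <= rsum (fun i => f i ^ 2) n * rsum (fun i => g i ^ 2) n.
Proof.
  induction n as [|n IH]; simpl rsum; [lra|].
  set (P := rsum (fun i => f i * g i) n) in *.
  assert (HA : 0 <= rsum (fun i => f i ^ 2) n) by (apply rsum_ge0; intros; apply pow2_ge_0).
  assert (HB : 0 <= rsum (fun i => g i ^ 2) n) by (apply rsum_ge0; intros; apply pow2_ge_0).
  set (A := rsum (fun i => f i ^ 2) n) in *. set (B := rsum (fun i => g i ^ 2) n) in *.
  set (x := f n). set (y := g n).
  assert (H : 2 * (P * (x * y)) <= A * y ^ 2 + B * x ^ 2).
  { apply pow2_le_inv.
    - pose proof (pow2_ge_0 x). pose proof (pow2_ge_0 y). nra.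
    - apply Rle_trans with (4 * (A * B) * (x * y) ^ 2).
      + replace ((2 * (P * (x * y))) ^ 2) with (4 * P ^ 2 * (x * y) ^ 2) by ring.
        apply Rmult_le_compat_r; [apply pow2_ge_0|lra].
      + pose proof (pow2_ge_0 (A * y ^ 2 - B * x ^ 2)). nra. }
  change ((P + x * y) ^ 2 <= (A + x ^ 2) * (B + y ^ 2)). nra.
Qed.

Lemma ev_geom (c z : C) : Cmod c < 1 -> Cmod z < 1 -> ((1 - c * z) * ev (fun n => c ^ n)%C z = 1)%C.
Proof.
  intros Hc Hz. assert (Ha : adm (fun n => c ^ n)%C).
  { apply adm_bounded with 1. intros n. rewrite Cmod_pow. rewrite <- (pow1 n).
    apply pow_incr. split; [apply Cmod_ge_0|lra]. }
  pose proof (ev_shift _ z Ha Hz) as E. simpl in E. rewrite ev_scal in E by auto.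
  set (G := ev (fun n => c ^ n)%C z) in *.
  replace ((1 - c * z) * G)%C with (G - c * z * G)%C by ring. rewrite E at 1. ring.
Qed.

(** Apply the contraction to a geometric sequence in [Cconj z] with a modified constant term, and
    evaluate the product at [z]. Away from its constant term [a_0], the product is bounded by
    Cauchy-Schwarz, with [|a_0|^2] deducted from the available norm. *)
Lemma schwarz_pick a z : contractive a -> adm a -> Cmod z < 1 ->
  Cmod (ev a z) <= (Cmod z + Cmod (a O)) / (1 + Cmod (a O) * Cmod z).
Proof.
  intros Hc Ha Hz. pose proof (Cmod_ge_0 z) as Hz0.
  pose proof (Cmod_ge_0 (a O)) as Ha0. set (r := Cmod z) in *. set (c0 := Cmod (a O)) in *.
  destruct (Req_dec r 0) as [Hr|Hr].
  { assert (z = 0%C) by now apply Cmod_eq_0. subst z. rewrite ev_0 by auto. fold c0.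
    rewrite Hr. right. field. }
  assert (Hr0 : 0 < r) by (destruct (Rle_lt_or_eq_dec _ _ Hz0); [auto|congruence]).
  assert (Hr2 : 0 < r ^ 2 < 1) by nra.
  (* [S] is the squared norm of the geometric tail and [y] the prescribed value of the test series
     at [z], which amounts to [t = 1 + c0 / r]. With this value the Cauchy-Schwarz bound is a
     perfect square and [(c0 + b) / y] is exactly the Schwarz-Pick quotient. *)
  set (y := (1 + c0 * r) / (1 - r ^ 2)). set (S := r ^ 2 / (1 - r ^ 2)).
  assert (HS : 0 < S) by (apply Rdiv_lt_0_compat; lra).
  set (t := (y - 1) / S).
  set (w := (RtoC t * Cconj z)%C).
  set (x := fun n => match n with O => RtoC 1 | S n => (w * Cconj z ^ n)%C end).
  assert (Hcz : Cmod (Cconj z) < 1) by (rewrite Cmod_conj; exact Hz).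
  assert (Hx' : adm (fun n => Cconj z ^ n)%C).
  { apply adm_bounded with 1. intros n. rewrite Cmod_pow, <- (pow1 n).
    apply pow_incr. split; [apply Cmod_ge_0|lra]. }
  assert (Hx : adm x).
  { apply adm_bounded with (1 + Cmod w). pose proof (Cmod_ge_0 w). intros [|n]; simpl.
    - rewrite Cmod_1. lra.
    - rewrite Cmod_mult, Cmod_pow.
      assert (Cmod (Cconj z) ^ n <= 1).
      { rewrite <- (pow1 n). apply pow_incr. split; [apply Cmod_ge_0|lra]. }
      nra. }
  assert (Ezz : (z * Cconj z)%C = RtoC (r ^ 2)) by (unfold r; now rewrite Cmod2_conj).
  assert (Ex : ev x z = RtoC y).
  { rewrite ev_shift by auto. simpl. rewrite ev_scal by auto.
    pose proof (ev_geom (Cconj z) z Hcz Hz) as G. rewrite (Cmult_comm (Cconj z)), Ezz in G.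
    set (e := ev (fun n => (Cconj z ^ n)%C) z) in *.
    assert (Hne : RtoC (1 - r ^ 2) <> 0%C) by (intros F; apply RtoC_inj in F; lra).
    assert (Ee : e = RtoC (/ (1 - r ^ 2))).
    { rewrite RtoC_inv by lra. rewrite RtoC_minus in *.
      replace e with (/ (1 - RtoC (r ^ 2)) * ((1 - RtoC (r ^ 2)) * e))%C by (field; auto).
      rewrite G. ring. }
    unfold w. replace (1 + z * (RtoC t * Cconj z * e))%C with (1 + RtoC t * (z * Cconj z) * e)%C by ring.
    rewrite Ezz, Ee, <- !RtoC_mult, <- RtoC_plus. f_equal.
    replace (t * r ^ 2 * / (1 - r ^ 2)) with (t * S) by (unfold S, Rdiv; ring).
    unfold t. field. lra. }
  set (Q := (1 - c0 ^ 2 + t ^ 2 * S) * S).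
  set (b := r * (1 + c0 * r) / (1 - r ^ 2)).
  assert (HQ : Q = b ^ 2).
  { unfold Q, t, b, y, S. field. split; lra. }
  assert (Hb : 0 <= b) by (apply Rdiv_le_0_compat; [apply Rmult_le_pos; nra|lra]).
  assert (Hp : forall n, Cmod (psum (conv a x) z (Datatypes.S n) - a O) <= b).
  { intros n. apply pow2_le_inv; auto. rewrite <- HQ. unfold psum. rewrite csum_S_l.
    replace (_ - a O)%C with (csum (fun i => conv a x (Datatypes.S i) * z ^ Datatypes.S i)%C n).
    2:{ change (conv a x O) with (a O * 1)%C. simpl (z ^ 0)%C. ring. }
    apply Rle_trans with (rsum (fun i => Cmod (conv a x (Datatypes.S i)) * r ^ Datatypes.S i) n ^ 2).
    { apply pow_incr. split; [apply Cmod_ge_0|]. eapply Rle_trans; [apply Cmod_csum_le|].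
      right. apply rsum_ext. intros i _. now rewrite Cmod_mult, Cmod_pow. }
    eapply Rle_trans; [apply rsum_cauchy_schwarz|].
    assert (G : rsum (fun i => (r ^ Datatypes.S i) ^ 2) n <= S).
    { rewrite (rsum_ext _ (fun i => r ^ 2 * (r ^ 2) ^ i)).
      2:{ intros i _. rewrite <- !pow_mult, <- pow_add. f_equal. lia. }
      rewrite rsum_scal. unfold S, Rdiv. apply Rmult_le_compat_l; [lra|]. apply rsum_geom_le; lra. }
    assert (G0 : 0 <= rsum (fun i => (r ^ Datatypes.S i) ^ 2) n)
      by (apply rsum_ge0; intros; apply pow2_ge_0).
    pose proof (contractive_sq a x (Datatypes.S n) Hc) as T.
    unfold sq in T. rewrite !rsum_S_l in T.
    change (conv a x O) with (a O * 1)%C in T. change (x O) with (RtoC 1) in T.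
    rewrite Cmult_1_r, Cmod_1 in T. fold c0 in T.
    rewrite (rsum_ext (fun i => Cmod (x (Datatypes.S i)) ^ 2) (fun i => t ^ 2 * (r ^ Datatypes.S i) ^ 2)) in T.
    2:{ intros i _. simpl x. unfold w.
        rewrite !Cmod_mult, Cmod_pow, Cmod_conj, Cmod_R. fold r.
        replace ((Rabs t * r * r ^ i) ^ 2) with (Rabs t ^ 2 * (r * r ^ i) ^ 2) by ring.
        now rewrite pow2_abs. }
    rewrite rsum_scal in T.
    assert (0 <= t ^ 2) by apply pow2_ge_0.
    apply Rmult_le_compat; auto.
    - apply rsum_ge0. intros; apply pow2_ge_0.
    - assert (t ^ 2 * rsum (fun i => (r ^ Datatypes.S i) ^ 2) n <= t ^ 2 * S)
        by (apply Rmult_le_compat_l; auto).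
      lra. }
  assert (HL : Cmod (ev a z * RtoC y - a O) <= b).
  { rewrite <- Ex, <- ev_conv by auto.
    apply le_of_lim0 with (fun n => Cmod (ev (conv a x) z - psum (conv a x) z (Datatypes.S n))).
    - intros n. eapply Rle_trans; [apply (Cmod_triangle3 _ (psum (conv a x) z (Datatypes.S n)))|].
      specialize (Hp n). lra.
    - apply (is_lim_seq_incr_1 (fun n => Cmod (ev (conv a x) z - psum (conv a x) z n))).
      apply ev_lim; auto. now apply adm_conv. }
  assert (Hy : 0 < y) by (apply Rdiv_lt_0_compat; nra).
  pose proof (Cmod_rev_triangle (ev a z * RtoC y) (a O)) as T.
  rewrite Cmod_mult, Cmod_R, Rabs_pos_eq in T by lra. fold c0 in T.
  apply Rmult_le_reg_r with y; auto.
  replace ((r + c0) / (1 + c0 * r) * y) with (c0 + b); [lra|].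
  unfold y, b. field. split; nra.
Qed.

(** * Quotients of power series *)

Definition dil (t : R) (a : nat -> C) (n : nat) : C := (a n * RtoC t ^ n)%C.

Lemma dil_conv t a b n : conv (dil t a) (dil t b) n = dil t (conv a b) n.
Proof.
  unfold dil. rewrite !conv_csum, Cmult_comm, <- csum_scal. apply csum_ext. intros i Hi.
  replace (RtoC t ^ n)%C with (RtoC t ^ i * RtoC t ^ (n - i))%C; [ring|].
  rewrite <- Cpow_add_r. f_equal. lia.
Qed.

Lemma ev_dil t a z : ev (dil t a) z = ev a (RtoC t * z)%C.
Proof.
  unfold ev, dil. f_equal; apply Series_ext; intros n; f_equal; rewrite Cpow_mult_l; ring.
Qed.

Lemma adm_dil t a : 0 <= t <= 1 -> adm a -> adm (dil t a).
Proof.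
  intros Ht Ha r Hr. destruct (Ha r Hr) as [K HK]. exists K. intros n. unfold dil.
  rewrite Cmod_mult, Cmod_pow, Cmod_R, Rabs_pos_eq by lra.
  eapply Rle_trans; [|apply (HK n)]. apply Rmult_le_compat_r; [apply pow_le; lra|].
  assert (t ^ n <= 1) by (rewrite <- (pow1 n); apply pow_incr; lra).
  pose proof (Cmod_ge_0 (a n)). nra.
Qed.

Lemma nrm2_dil t a n : 0 <= t -> nrm2 (dil t a) 1 n = nrm2 a t n.
Proof.
  intros Ht. apply rsum_ext. intros i _. unfold dil.
  now rewrite Cmod_mult, Cmod_pow, Cmod_R, Rabs_pos_eq, pow1, Rmult_1_r.
Qed.

(** Dilation commutes with Cauchy products, so a formal series can be treated on each smaller disk
    separately, without knowing in advance that it converges on the whole one. *)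
Lemma contractive_of_dil w : (forall t, 0 < t < 1 -> contractive (dil t w)) -> contractive w.
Proof.
  intros H x n. apply nrm2_le_limit. intros t Ht.
  rewrite <- nrm2_dil by lra.
  rewrite <- (nrm2_ext (conv (dil t w) (dil t x))) by (intros; apply dil_conv).
  eapply Rle_trans; [apply H; auto|]. rewrite nrm2_dil by lra. apply nrm2_le_1. lra.
Qed.

Lemma Cmod_scal_lt (t : R) (z : C) r : 0 <= t <= r -> Cmod z < 1 -> Cmod (RtoC t * z) <= r.
Proof. intros Ht Hz. rewrite Cmod_scal_pos by lra. pose proof (Cmod_ge_0 z). nra. Qed.

Lemma sq_delta0_le n : nrm2 delta0 1 n <= 1.
Proof.
  rewrite nrm2_1. destruct n as [|n]; [unfold sq; simpl; lra|].
  unfold sq. rewrite rsum_S_l, rsum_zero.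
  - simpl. rewrite Cmod_1. lra.
  - intros; simpl. rewrite Cmod_0. ring.
Qed.

Lemma Cmod_inv_bound (x y : C) d : 0 < d -> d <= Cmod x -> (x * y)%C = 1%C -> Cmod y <= / d.
Proof.
  intros Hd Hx E. apply (f_equal Cmod) in E. rewrite Cmod_mult, Cmod_1 in E.
  pose proof (Cmod_ge_0 y). apply Rmult_le_reg_l with d; auto. rewrite Rinv_r by lra. nra.
Qed.

(* Continuation in the radius: if [1/u] is a power series on the disk of radius [t], it is bounded
   there by [1/d]; writing [U, V] for the dilations of [u] to radii [t < t'], the inverse [e'] of
   [V] solves [e' + phi e' = e] with [phi = e (V - U)], where [phi] is small when [t' - t] is. *)
Lemma inverse_step u e t t' d L M : adm u -> 0 < d -> 0 <= L -> 0 <= t <= t' -> t' <= 1 ->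
  (forall z, Cmod z < 1 -> d <= Cmod (ev u z)) ->
  (forall z w, Cmod z < 1 -> Cmod w < 1 -> Cmod (ev u w - ev u z) <= L * Cmod (w - z)) ->
  (forall n, conv u e n = delta0 n) ->
  L * (t' - t) <= d / 2 ->
  (forall n, Cmod (dil t e n) <= M) -> forall n, Cmod (dil t' e n) <= 2 / d.
Proof.
  intros Hu Hd HL Ht Ht' Hlow Hlip He Hsmall HM N.
  assert (Hdelta : forall s n, dil s delta0 n = delta0 n).
  { intros s [|n]; unfold dil; simpl; ring. }
  assert (Hconv : forall s n, conv (dil s u) (dil s e) n = delta0 n).
  { intros s n. rewrite dil_conv. unfold dil. rewrite He. apply Hdelta. }
  set (U := dil t u). set (V := dil t' u). set (E := dil t e). set (E' := dil t' e).
  assert (AU : adm U) by (apply adm_dil; [lra|auto]).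
  assert (AV : adm V) by (apply adm_dil; [lra|auto]).
  assert (AE : adm E) by (apply adm_bounded with M; auto).
  set (D := fun n => (V n + (- (1)) * U n)%C).
  assert (AD : adm D) by (apply adm_plus; [auto|apply adm_scal; auto]).
  assert (BE : forall z, Cmod z < 1 -> Cmod (ev E z) <= / d).
  { intros z Hz. apply (Cmod_inv_bound (ev U z)); auto.
    - unfold U. rewrite ev_dil. apply Hlow. rewrite Cmod_scal_pos by lra.
      pose proof (Cmod_ge_0 z). nra.
    - rewrite <- ev_conv by auto. rewrite (ev_ext _ delta0) by apply Hconv.
      rewrite (ev_finite delta0 1 z Hz).
      + unfold psum; simpl. ring.
      + intros [|n] Hn; [lia|reflexivity]. }
  set (phi := conv E D).
  assert (Bphi : forall z, Cmod z < 1 -> Cmod (ev phi z) <= / 2).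
  { intros z Hz. unfold phi. rewrite ev_conv, Cmod_mult by auto.
    pose proof (Cmod_ge_0 z) as Hz0.
    assert (BD : Cmod (ev D z) <= d / 2).
    { unfold D. rewrite ev_plus, ev_scal by (auto; apply adm_scal; auto).
      unfold U, V. rewrite !ev_dil.
      replace (ev u (RtoC t' * z) + - (1) * ev u (RtoC t * z))%C
        with (ev u (RtoC t' * z) - ev u (RtoC t * z))%C by ring.
      eapply Rle_trans; [apply Hlip; rewrite Cmod_scal_pos by lra; nra|].
      replace (RtoC t' * z - RtoC t * z)%C with (RtoC (t' - t) * z)%C by (rewrite RtoC_minus; ring).
      rewrite Cmod_scal_pos by lra.
      assert (0 <= L * (t' - t)) by (apply Rmult_le_pos; lra). nra. }
    replace (/ 2) with (/ d * (d / 2)) by (field; lra).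
    apply Rmult_le_compat; auto using Cmod_ge_0. }
  assert (EQ : forall n, E' n = (E n + (- (1)) * conv phi E' n)%C).
  { intros n. rewrite <- (conv_one_r E n).
    rewrite <- (conv_ext E E (conv V E') delta0) by (auto; intros; apply Hconv).
    rewrite <- conv_assoc.
    rewrite (conv_ext (conv E V) (fun k => delta0 k + phi k)%C E' E'); auto.
    - rewrite conv_plus_l, conv_one_l. ring.
    - intros i _. unfold phi. rewrite <- (Hconv t i). fold U E. rewrite (conv_comm U E), <- conv_plus_r.
      apply conv_ext; auto. intros; unfold D; ring. }
  assert (NE : forall n, nrm2 E 1 n <= (/ d) ^ 2).
  { intros n. rewrite <- (nrm2_ext (conv E delta0)) by (intros; apply conv_one_r).
    assert (Hd' : 0 <= / d) by (left; now apply Rinv_0_lt_compat).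
    eapply Rle_trans; [apply (conv_nrm2_le E (/ d)); auto|].
    pose proof (sq_delta0_le n). pose proof (pow2_ge_0 (/ d)). nra. }
  assert (NP : forall n, nrm2 (conv phi E') 1 n <= / 4 * nrm2 E' 1 n).
  { intros n. replace (/ 4) with ((/ 2) ^ 2) by field.
    apply conv_nrm2_le; auto; [|lra]. now apply adm_conv. }
  assert (NN : forall n, nrm2 E' 1 n <= 2 * nrm2 E 1 n + 2 * nrm2 (conv phi E') 1 n).
  { intros n. unfold nrm2. rewrite <- !rsum_scal, <- rsum_plus. apply rsum_le. intros i _.
    rewrite (EQ i) at 1. rewrite pow1, !Rmult_1_r.
    pose proof (Cmod_triangle (E i) (- (1) * conv phi E' i)) as T.
    rewrite (Cmod_mult (- (1))), Cmod_m1, Rmult_1_l in T.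
    set (x := Cmod (E i)) in *. set (y := Cmod (conv phi E' i)) in *.
    pose proof (Cmod_ge_0 (E i + - (1) * conv phi E' i)) as T0.
    set (s := Cmod (E i + - (1) * conv phi E' i)) in *.
    apply Rle_trans with ((x + y) ^ 2); [apply pow_incr; lra|].
    pose proof (pow2_ge_0 (x - y)). nra. }
  apply pow2_le_inv; [apply Rdiv_le_0_compat; lra|].
  apply Rle_trans with (nrm2 E' 1 (S N)).
  - rewrite nrm2_1. apply (rsum_term_le (fun i => Cmod (E' i) ^ 2)); [lia|intros; apply pow2_ge_0].
  (* The truncated norm [N'] of [E'] is finite whatever [E'] is, so it can be absorbed:
     [N' <= 2 / d^2 + N' / 2], hence [N' <= 4 / d^2]. *)
  - specialize (NE (S N)). specialize (NP (S N)). specialize (NN (S N)).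
    replace ((2 / d) ^ 2) with (4 * (/ d) ^ 2) by (field; lra). lra.
Qed.

(** One step of the continuation returns the bound [2 / d], whatever bound it started from. The
    admissible step length is therefore constant, and [k >= 2 L / d] equal steps lead from radius
    [0] to radius [1]. *)
Lemma inverse_adm u e d L : adm u -> 0 < d -> 0 <= L ->
  (forall z, Cmod z < 1 -> d <= Cmod (ev u z)) ->
  (forall z w, Cmod z < 1 -> Cmod w < 1 -> Cmod (ev u w - ev u z) <= L * Cmod (w - z)) ->
  (forall n, conv u e n = delta0 n) -> adm e.
Proof.
  intros Hu Hd HL Hlow Hlip He.
  destruct (INR_unbounded (L * 2 / d)) as [k Hk].
  assert (Hk0 : 0 < INR k).
  { apply Rle_lt_trans with (L * 2 / d); [apply Rdiv_le_0_compat; lra|exact Hk]. }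
  assert (P : forall j, (j <= k)%nat -> forall n, Cmod (dil (INR j / INR k) e n) <= 2 / d).
  { induction j as [|j IH]; intros Hj.
    - intros n. unfold dil. replace (INR 0 / INR k) with 0 by (simpl; field; lra).
      destruct n as [|n].
      + simpl. rewrite Cmult_1_r. apply Rle_trans with (/ d).
        * apply (Cmod_inv_bound (u O)); auto; [|apply (He O)].
          rewrite <- ev_0 by auto. apply Hlow. rewrite Cmod_0. lra.
        * unfold Rdiv. pose proof (Rinv_0_lt_compat d Hd). lra.
      + replace (e (S n) * RtoC 0 ^ S n)%C with (RtoC 0) by (simpl; ring).
        rewrite Cmod_0. apply Rdiv_le_0_compat; lra.
    - assert (Hj' : INR (S j) <= INR k) by (apply le_INR; lia).
      assert (0 < / INR k) by now apply Rinv_0_lt_compat.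
      pose proof (pos_INR j).
      apply (inverse_step u e (INR j / INR k) (INR (S j) / INR k) d L (2 / d)); auto.
      + split.
        * apply Rdiv_le_0_compat; auto.
        * unfold Rdiv. apply Rmult_le_compat_r; [lra|]. rewrite S_INR; lra.
      + apply Rmult_le_reg_r with (INR k); auto. unfold Rdiv. rewrite Rmult_assoc, Rinv_l; lra.
      + rewrite S_INR. replace (L * ((INR j + 1) / INR k - INR j / INR k)) with (L / INR k) by (field; lra).
        apply Rmult_le_reg_r with (INR k * 2 / d).
        { apply Rdiv_lt_0_compat; lra. }
        replace (L / INR k * (INR k * 2 / d)) with (L * 2 / d) by (field; lra).
        replace (d / 2 * (INR k * 2 / d)) with (INR k) by (field; lra). lra.
      + apply IH. lia. }
  apply adm_bounded with (2 / d). intros n.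
  specialize (P k (Nat.le_refl k) n). unfold dil in P.
  replace (INR k / INR k) with 1 in P by (field; lra). rewrite Cpow_1_l, Cmult_1_r in P. exact P.
Qed.

(** Compactness of the square around the disk, with a gauge. At a point of the disk the gauge is a
    fraction of [|a(z)|] so small that the Lipschitz bound keeps the function away from [0] nearby;
    at a point outside it is half the distance to the disk, so that no point of the disk can be
    assigned to it. *)
Lemma lower_bound_disk a rho : adm a -> 0 < rho < 1 ->
  (forall z, Cmod z <= rho -> ev a z <> 0%C) ->
  exists d, 0 < d /\ forall z, Cmod z <= rho -> d <= Cmod (ev a z).
Proof.
  intros Ha HR Hnz. destruct (ev_lip a rho Ha HR) as (L & HL & Hlip).
  assert (Hdelta : forall x y : R, exists e : posreal,
    (Cmod (x, y) <= rho /\ pos e = Cmod (ev a (x, y)) / (4 * (L + 1))) \/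
    (rho < Cmod (x, y) /\ pos e = (Cmod (x, y) - rho) / 2)).
  { intros x y. destruct (Rle_lt_dec (Cmod (x, y)) rho) as [H|H].
    - assert (P : 0 < Cmod (ev a (x, y)) / (4 * (L + 1))).
      { apply Rdiv_lt_0_compat; [|lra]. apply Cmod_gt_0. now apply Hnz. }
      exists (mkposreal _ P). left. auto.
    - assert (P : 0 < (Cmod (x, y) - rho) / 2) by lra. exists (mkposreal _ P). right. auto. }
  set (delta := fun x y => proj1_sig (constructive_indefinite_description _ (Hdelta x y))).
  destruct (compactness_value_2d (-1) 1 (-1) 1 delta) as [d Hd].
  exists d. split; [apply cond_pos|]. intros z Hz. destruct z as [x y].
  pose proof (Rmax_Cmod (x, y)) as HM. simpl in HM.
  pose proof (Rmax_l (Rabs x) (Rabs y)). pose proof (Rmax_r (Rabs x) (Rabs y)).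
  pose proof (Rabs_le_between x 1) as [Hx _]. pose proof (Rabs_le_between y 1) as [Hy _].
  destruct (NNPP _ (Hd x y (Hx ltac:(lra)) (Hy ltac:(lra)))) as (p & q & Hp & Hq & Hxp & Hyq & Hdd).
  unfold delta in Hxp, Hyq, Hdd.
  destruct (constructive_indefinite_description _ (Hdelta p q)) as [e He]. simpl in *.
  assert (Hdist : Cmod ((x, y) - (p, q)) < 2 * e).
  { eapply Rle_lt_trans; [apply Cmod_le_Re_Im|]. simpl. unfold Rminus in *. lra. }
  destruct He as [[H1 H2]|[H1 H2]].
  - specialize (Hlip (p, q) (x, y) H1 Hz).
    pose proof (Cmod_rev_triangle (ev a (p, q)) (ev a (x, y))) as T.
    rewrite Cmod_minus_sym in T.
    assert (HE : Cmod (ev a (p, q)) = 4 * (L + 1) * e) by (rewrite H2; field; lra).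
    pose proof (cond_pos e).
    assert (L * Cmod ((x, y) - (p, q)) <= L * (2 * e)) by (apply Rmult_le_compat_l; lra).
    assert (0 <= L * e) by (apply Rmult_le_pos; lra). lra.
  - exfalso. pose proof (Cmod_rev_triangle (p, q) (x, y)) as T. rewrite Cmod_minus_sym in T. lra.
Qed.

(** On the disk of radius [rho] the series [u] is bounded below, so its formal inverse converges
    there; then so does [w = v / u], and it is bounded by [1] pointwise. *)
Lemma zero_free_contractive u v w rho : adm u -> adm v -> 0 < rho < 1 ->
  (forall z, Cmod z <= rho -> ev u z <> 0%C) ->
  (forall z, Cmod z < 1 -> Cmod (ev v z) <= Cmod (ev u z)) ->
  (forall n, conv w u n = v n) -> contractive (dil rho w).
Proof.
  intros Hu Hv HR Hnz Hle Hw.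
  destruct (lower_bound_disk u rho Hu HR Hnz) as (d & Hd & Hlow).
  destruct (ev_lip u rho Hu HR) as (L & HL & Hlip).
  set (U := dil rho u). set (V := dil rho v). set (W := dil rho w).
  assert (AU : adm U) by (apply adm_dil; [lra|auto]).
  assert (AV : adm V) by (apply adm_dil; [lra|auto]).
  assert (U0 : U O <> 0%C).
  { rewrite <- ev_0 by auto. unfold U. rewrite ev_dil. apply Hnz.
    rewrite Cmult_0_r, Cmod_0. lra. }
  set (e := quot U delta0).
  assert (He : forall n, conv U e n = delta0 n) by (intros; now apply conv_quot).
  assert (Ae : adm e).
  { apply (inverse_adm U e d (L * rho)); auto.
    - apply Rmult_le_pos; lra.
    - intros z Hz. unfold U. rewrite ev_dil. apply Hlow. apply Cmod_scal_lt; auto; lra.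
    - intros z z' Hz Hz'. unfold U. rewrite !ev_dil.
      eapply Rle_trans; [apply Hlip; apply Cmod_scal_lt; auto; lra|].
      replace (RtoC rho * z' - RtoC rho * z)%C with (RtoC rho * (z' - z))%C by ring.
      rewrite Cmod_scal_pos by lra. lra. }
  assert (EW : forall n, W n = conv V e n).
  { intros n. rewrite <- (conv_one_r W n).
    rewrite <- (conv_ext W W (conv U e) delta0) by auto. rewrite <- conv_assoc.
    apply conv_ext; auto. intros i _. unfold W, U. rewrite dil_conv. unfold dil, V. now rewrite Hw. }
  assert (AW : adm W).
  { apply adm_ext with (conv V e); auto. now apply adm_conv. }
  apply bounded_contractive; auto. intros z Hz.
  assert (E : (ev U z * ev W z)%C = ev V z).
  { rewrite Cmult_comm, <- ev_conv by auto. apply ev_ext. intros n. unfold W, U.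
    rewrite dil_conv. unfold dil, V. now rewrite Hw. }
  assert (HU : 0 < Cmod (ev U z)).
  { apply Rlt_le_trans with d; auto. unfold U. rewrite ev_dil. apply Hlow. apply Cmod_scal_lt; auto; lra. }
  apply (f_equal Cmod) in E. rewrite Cmod_mult in E.
  assert (HV : Cmod (ev V z) <= Cmod (ev U z)).
  { unfold U, V. rewrite !ev_dil. apply Hle. eapply Rle_lt_trans; [apply (Cmod_scal_lt rho z rho); auto; lra|lra]. }
  apply Rmult_le_reg_l with (Cmod (ev U z)); auto. lra.
Qed.

(** * Removing zeros: linear factors and Blaschke factors *)

Definition lin2 (c0 c1 : C) (n : nat) : C :=
  match n with O => c0 | S O => c1 | _ => 0%C end.

Lemma adm_lin2 c0 c1 : adm (lin2 c0 c1).
Proof. apply (adm_finite _ 2). intros [|[|n]] Hn; [lia|lia|reflexivity]. Qed.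

Lemma ev_lin2 c0 c1 z : Cmod z < 1 -> ev (lin2 c0 c1) z = (c0 + c1 * z)%C.
Proof.
  intros Hz. rewrite (ev_finite _ 2 z Hz).
  - unfold psum; simpl. ring.
  - intros [|[|n]] Hn; [lia|lia|reflexivity].
Qed.

Lemma adm_of_large a s : s < 1 -> (forall r, s < r < 1 -> 0 < r -> exists K, bdd a K r) -> adm a.
Proof.
  intros Hs H r Hr.
  assert (P : exists t, s < t < 1 /\ 0 < t /\ r <= t).
  { exists ((Rmax s r + 1) / 2). pose proof (Rmax_l s r). pose proof (Rmax_r s r).
    assert (Rmax s r < 1) by (apply Rmax_lub_lt; lra). lra. }
  destruct P as (t & H1 & H2 & H3). destruct (H t H1 H2) as [K HK]. exists K. intros n.
  eapply Rle_trans; [|apply (HK n)]. apply Rmult_le_compat_l; [apply Cmod_ge_0|].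
  apply pow_incr. lra.
Qed.

Lemma conv_lin2_S c0 c1 d n : conv (lin2 c0 c1) d (S n) = (c0 * d (S n) + c1 * d n)%C.
Proof.
  change (conv (lin2 c0 c1) d (S n))
    with (c0 * d (S n) + conv (fun k => lin2 c0 c1 (S k)) d n)%C. f_equal.
  transitivity (conv (fun k => c1 * delta0 k)%C d n).
  - apply conv_ext; auto. intros [|i] _; simpl; ring.
  - now rewrite conv_scal_l, conv_one_l.
Qed.

(** The partial sums of [u] at [z0] are [- z0^(n+1) d_n]. As the full sum is [0], they are also
    minus the tails, of size [(|z0| / r)^(n+1)]; comparing the two bounds [|d_n| r^n]. *)
Lemma adm_div_root u d (z0 : C) : adm u -> z0 <> 0%C -> Cmod z0 < 1 -> ev u z0 = 0%C ->
  (forall n, conv (lin2 (- z0) 1) d n = u n) -> adm d.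
Proof.
  intros Hu Hz Hz1 H0 Hd.
  assert (Hz0 : 0 < Cmod z0) by now apply Cmod_gt_0.
  assert (P : forall n, psum u z0 (S n) = (- (z0 ^ S n * d n))%C).
  { induction n as [|n IH].
    - unfold psum; simpl. rewrite <- Hd. simpl. ring.
    - change (psum u z0 (S (S n))) with (psum u z0 (S n) + u (S n) * z0 ^ S n)%C.
      rewrite IH, <- Hd, conv_lin2_S. simpl. ring. }
  apply (adm_of_large d (Cmod z0)); auto. intros r Hr Hr0.
  destruct (Hu r ltac:(lra)) as [K HK].
  pose proof (ratio_lt1 z0 r ltac:(lra)) as Hq.
  exists (K / (1 - Cmod z0 / r) / r). intros n.
  pose proof (ev_tail u K r z0 (S n) HK ltac:(lra)) as T.
  rewrite H0, P in T. replace (0 - - (z0 ^ S n * d n))%C with (z0 ^ S n * d n)%C in T by ring.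
  rewrite Cmod_mult, Cmod_pow in T.
  assert (0 < Cmod z0 ^ S n) by now apply pow_lt.
  assert (0 < r ^ S n) by now apply pow_lt.
  apply Rmult_le_reg_l with (Cmod z0 ^ S n * / r ^ S n * r).
  { apply Rmult_lt_0_compat; auto. apply Rmult_lt_0_compat; auto. now apply Rinv_0_lt_compat. }
  replace (Cmod z0 ^ S n * / r ^ S n * r * (Cmod (d n) * r ^ n))
    with (Cmod z0 ^ S n * Cmod (d n)).
  2:{ simpl. field. split; [apply pow_nonzero|]; lra. }
  eapply Rle_trans; [apply T|]. right. set (c := K / (1 - Cmod z0 / r)).
  unfold Rdiv. rewrite Rpow_mult_distr, pow_inv. field. split; lra.
Qed.

(** An inequality obtained by cancelling [|z - z0|] is missing at [z0]; continuity along [z0 + e],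
    with real [e > 0] halved repeatedly, supplies it. *)
Lemma le_at_limit u v (z0 : C) : adm u -> adm v -> Cmod z0 < 1 ->
  (forall z, Cmod z < 1 -> z <> z0 -> Cmod (ev v z) <= Cmod (ev u z)) ->
  Cmod (ev v z0) <= Cmod (ev u z0).
Proof.
  intros Hu Hv Hz H. pose proof (Cmod_ge_0 z0).
  set (r := (Cmod z0 + 1) / 2). assert (Hr : Cmod z0 < r < 1) by (unfold r; lra).
  destruct (ev_lip u r Hu ltac:(lra)) as (L1 & HL1 & H1).
  destruct (ev_lip v r Hv ltac:(lra)) as (L2 & HL2 & H2).
  apply le_of_lim0 with (fun n => (L1 + L2) * (r - Cmod z0) * (/ 2) ^ n); [|apply geom_lim0; lra].
  intros n. set (e := (r - Cmod z0) * (/ 2) ^ n).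
  assert (He : 0 < e <= r - Cmod z0).
  { assert (0 < (/ 2) ^ n) by (apply pow_lt; lra).
    assert ((/ 2) ^ n <= 1) by (rewrite <- (pow1 n); apply pow_incr; lra). unfold e. split; nra. }
  set (z := (z0 + RtoC e)%C).
  assert (Dz : Cmod (z - z0) = e).
  { unfold z. replace (z0 + RtoC e - z0)%C with (RtoC e) by ring. rewrite Cmod_R, Rabs_pos_eq; lra. }
  assert (Hzr : Cmod z <= r).
  { pose proof (Cmod_rev_triangle z z0). lra. }
  assert (Hne : z <> z0).
  { intros F. rewrite F in Dz. replace (z0 - z0)%C with (RtoC 0) in Dz by ring. rewrite Cmod_0 in Dz. lra. }
  specialize (H z ltac:(lra) Hne). specialize (H1 z0 z ltac:(lra) Hzr). specialize (H2 z0 z ltac:(lra) Hzr).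
  rewrite Dz in H1, H2.
  pose proof (Cmod_rev_triangle (ev u z) (ev u z0)) as T1.
  pose proof (Cmod_rev_triangle (ev v z0) (ev v z)) as T2. rewrite Cmod_minus_sym in T2.
  replace ((L1 + L2) * (r - Cmod z0) * (/ 2) ^ n) with (L1 * e + L2 * e) by (unfold e; ring). lra.
Qed.

(** On this circle [rho^2 = z * Cconj z], so the left factor equals [z * Cconj (z - z0) / rho]. *)
Lemma Cmod_blaschke z0 z rho : 0 < rho -> Cmod z = rho ->
  Cmod (RtoC rho - Cconj z0 / RtoC rho * z) = Cmod (z - z0).
Proof.
  intros Hr Hz. pose proof (Cmod2_conj z) as E. rewrite Hz in E.
  assert (Hne : RtoC rho <> 0%C) by (intros F; apply RtoC_inj in F; lra).
  replace (RtoC rho - Cconj z0 / RtoC rho * z)%C with (z * Cconj (z - z0) / RtoC rho)%C.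
  - rewrite Cmod_div, Cmod_mult, Cmod_conj, Hz, Cmod_R, Rabs_pos_eq by (auto; lra). field; lra.
  - rewrite Cminus_conj. replace (RtoC rho) with (RtoC (rho ^ 2) / RtoC rho)%C at 2.
    + rewrite E. field. auto.
    + rewrite RtoC_pow. field. auto.
Qed.

(** The series [u'] is [u] divided by the Blaschke factor of [z0] for the disk of radius [rho]; both
    identities are given with the denominator multiplied out. *)
Lemma blaschke_divide u (z0 : C) rho : adm u -> z0 <> 0%C -> Cmod z0 < 1 -> ev u z0 = 0%C ->
  exists u', adm u' /\
    (forall n, conv (lin2 (- z0) 1) u' n = conv (lin2 (RtoC rho) (- (Cconj z0 / RtoC rho))) u n) /\
    (forall z, Cmod z < 1 ->
       ((z - z0) * ev u' z = (RtoC rho - Cconj z0 / RtoC rho * z) * ev u z)%C).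
Proof.
  intros Hu Hz Hz1 H0. set (l := lin2 (- z0) 1). set (b := lin2 (RtoC rho) (- (Cconj z0 / RtoC rho))).
  assert (Hl0 : l O <> 0%C).
  { unfold l; simpl. intros F. apply Hz. replace z0 with (- - z0)%C by ring. rewrite F. ring. }
  set (d := quot l u).
  assert (Hd : forall n, conv l d n = u n) by (intros; now apply conv_quot).
  assert (Ad : adm d) by now apply (adm_div_root u d z0).
  exists (conv b d). assert (Ab : adm b) by apply adm_lin2.
  assert (E : forall n, conv l (conv b d) n = conv b u n).
  { intros n. rewrite <- conv_assoc. rewrite (conv_ext (conv l b) (conv b l) d d) by (auto; intros; apply conv_comm).
    rewrite conv_assoc. apply conv_ext; auto. }
  split; [now apply adm_conv|]. split; [exact E|].
  intros z Hz'.
  replace (RtoC rho - Cconj z0 / RtoC rho * z)%C with (ev b z)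
    by (unfold b; rewrite ev_lin2 by auto; ring).
  assert (Ed : ((z - z0) * ev d z)%C = ev u z).
  { replace (z - z0)%C with (ev l z) by (unfold l; rewrite ev_lin2 by auto; ring).
    rewrite <- ev_conv by (auto; apply adm_lin2). now apply ev_ext. }
  rewrite ev_conv, <- Ed by auto. ring.
Qed.

(* Dividing by Blaschke factors of the disk of radius [r] keeps the norm on the circle of radius [r]
   and multiplies [|u 0|] by at least [r / s], so only finitely many zeros can be removed. *)
Lemma quotient_contractive_aux s r m : 0 < s < r -> r < 1 -> forall u v w B, adm u -> adm v ->
  u O <> 0%C ->
  (forall z, Cmod z < 1 -> Cmod (ev v z) <= Cmod (ev u z)) ->
  (forall n, conv w u n = v n) ->
  (forall n, nrm2 u r n <= B) -> B < Cmod (u O) ^ 2 * ((r / s) ^ 2) ^ m ->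
  contractive (dil s w).
Proof.
  intros Hs Hr. induction m as [|m IH]; intros u v w B Hu Hv Hu0 Hle Hw HB HBm.
  (* With no division left the hypotheses clash: [|u 0|^2] is the first term of a norm bounded by
     [B]. *)
  { specialize (HB 1%nat). unfold nrm2 in HB; simpl in *. lra. }
  destruct (classic (exists z0, Cmod z0 <= s /\ ev u z0 = 0%C)) as [(z0 & Hz0 & Ez0)|Hno].
  2:{ apply (zero_free_contractive u v w s); auto; [lra|]. intros z Hz F. apply Hno. now exists z. }
  assert (Hne : z0 <> 0%C).
  { intros ->. apply Hu0. now rewrite <- ev_0. }
  assert (Hz1 : Cmod z0 < 1) by lra.
  (* The zero is shared by [v], so the same Blaschke factor is divided out of both series and the
     quotient [w] does not change. *)
  assert (Evz : ev v z0 = 0%C).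
  { apply Cmod_eq_0. apply Rle_antisym; [|apply Cmod_ge_0]. rewrite <- Cmod_0, <- Ez0. auto. }
  destruct (blaschke_divide u z0 r Hu Hne Hz1 Ez0) as (u' & Au' & Cu' & Eu').
  destruct (blaschke_divide v z0 r Hv Hne Hz1 Evz) as (v' & Av' & Cv' & Ev').
  assert (Hz0p : 0 < Cmod z0) by now apply Cmod_gt_0.
  assert (Hrne : RtoC r <> 0%C) by (intros F; apply RtoC_inj in F; lra).
  assert (E0 : (- z0 * u' O)%C = (RtoC r * u O)%C) by apply (Cu' O).
  assert (M0 : Cmod z0 * Cmod (u' O) = r * Cmod (u O)).
  { rewrite <- (Cmod_opp z0), <- Cmod_mult, E0. apply Cmod_scal_pos. lra. }
  assert (Hdist : forall z, z <> z0 -> 0 < Cmod (z - z0)).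
  { intros z Hz. apply Cmod_gt_0. intros F. apply Hz. now apply Cminus_eq_0. }
  assert (Hle1 : forall z, Cmod z < 1 -> z <> z0 -> Cmod (ev v' z) <= Cmod (ev u' z)).
  { intros z Hz Hzz. apply Rmult_le_reg_l with (Cmod (z - z0)); auto.
    rewrite <- !Cmod_mult, Eu', Ev', !Cmod_mult by auto.
    apply Rmult_le_compat_l; [apply Cmod_ge_0|auto]. }
  apply (IH u' v' w B); auto.
  - intros F. rewrite F, Cmod_0, Rmult_0_r in M0.
    assert (0 < Cmod (u O)) by now apply Cmod_gt_0.
    assert (0 < r * Cmod (u O)) by (apply Rmult_lt_0_compat; lra). lra.
  - intros z Hz. destruct (classic (z = z0)) as [->|Hzz]; auto. now apply le_at_limit.
  (* The relation [w u' = v'] holds after multiplication by [z - z0], whose constant term is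
     nonzero, so the factor can be cancelled formally. *)
  - apply (conv_cancel (lin2 (- z0) 1)).
    + simpl. intros F. apply Hne. replace z0 with (- - z0)%C by ring. rewrite F. ring.
    + intros n. rewrite Cv', <- conv_assoc.
      rewrite (conv_ext (conv (lin2 (- z0) 1) w) (conv w (lin2 (- z0) 1)) u' u') by (auto; intros; apply conv_comm).
      rewrite conv_assoc, (conv_ext w w _ _ n (fun _ _ => eq_refl) (fun i _ => Cu' i)).
      rewrite <- conv_assoc.
      rewrite (conv_ext (conv w _) (conv (lin2 (RtoC r) (- (Cconj z0 / RtoC r))) w) u u) by (auto; intros; apply conv_comm).
      rewrite conv_assoc. apply conv_ext; auto.
  - apply (circle_l2_le u u' r B); auto; [lra|]. intros z Hz.
    assert (Hzz : z <> z0) by (intros ->; lra).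
    apply Rmult_le_reg_l with (Cmod (z - z0)); auto.
    rewrite <- Cmod_mult, Eu', Cmod_mult by lra. rewrite Cmod_blaschke by (auto; lra). lra.
  - eapply Rlt_le_trans; [apply HBm|]. simpl. rewrite <- Rmult_assoc.
    apply Rmult_le_compat_r; [apply pow_le, pow2_ge_0|].
    replace (Cmod (u O) * (Cmod (u O) * 1) * (r / s * (r / s * 1))) with ((Cmod (u O) * (r / s)) ^ 2) by ring.
    replace (Cmod (u' O) * (Cmod (u' O) * 1)) with (Cmod (u' O) ^ 2) by ring.
    apply pow_incr. split.
    + apply Rmult_le_pos; [apply Cmod_ge_0|apply Rdiv_le_0_compat; lra].
    + apply Rmult_le_reg_l with s; [lra|].
      replace (s * (Cmod (u O) * (r / s))) with (r * Cmod (u O)) by (field; lra).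
      rewrite <- M0. apply Rmult_le_compat_r; [apply Cmod_ge_0|auto].
Qed.

Lemma nrm2_bounded u r : adm u -> 0 < r < 1 -> exists B, forall n, nrm2 u r n <= B.
Proof.
  intros Hu Hr. destruct (Hu r Hr) as [K HK]. destruct (Hu ((r + 1) / 2) ltac:(lra)) as [L HL].
  exists (K * (L / (1 - r / ((r + 1) / 2)))). intros n. pose proof (bdd_ge0 _ _ _ HK).
  apply Rle_trans with (K * rsum (fun i => Cmod (u i) * r ^ i) n).
  - unfold nrm2. rewrite <- rsum_scal. apply rsum_le. intros i _. simpl. rewrite Rmult_1_r.
    apply Rmult_le_compat_r; [|apply HK]. apply Rmult_le_pos; [apply Cmod_ge_0|apply pow_le; lra].
  - apply Rmult_le_compat_l; auto. apply bdd_rsum; auto. lra.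
Qed.

Lemma quotient_contractive u v w : adm u -> adm v -> u O <> 0%C ->
  (forall z, Cmod z < 1 -> Cmod (ev v z) <= Cmod (ev u z)) ->
  (forall n, conv w u n = v n) -> contractive w.
Proof.
  intros Hu Hv Hu0 Hle Hw. apply contractive_of_dil. intros s Hs.
  set (r := (s + 1) / 2). assert (Hr : s < r < 1) by (unfold r; lra).
  destruct (nrm2_bounded u r Hu ltac:(lra)) as [B HB].
  assert (H0 : 0 < Cmod (u O) ^ 2) by (apply pow_lt, Cmod_gt_0; auto).
  assert (Hq : 1 < r / s).
  { apply Rmult_lt_reg_r with s; [lra|]. unfold Rdiv. rewrite Rmult_assoc, Rinv_l; lra. }
  assert (Hq2 : Rabs ((r / s) ^ 2) > 1) by (rewrite Rabs_pos_eq by apply pow2_ge_0; nra).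
  (* This [m] bounds the number of zeros that can be divided out before the constant term outgrows
     the norm. *)
  destruct (Pow_x_infinity _ Hq2 (B / Cmod (u O) ^ 2 + 1)) as [m Hm].
  specialize (Hm m (Nat.le_refl m)).
  rewrite Rabs_pos_eq in Hm by (apply pow_le, pow2_ge_0).
  apply (quotient_contractive_aux s r m) with (u := u) (v := v) (B := B); auto; try lra.
  apply Rlt_le_trans with (Cmod (u O) ^ 2 * (B / Cmod (u O) ^ 2 + 1)).
  - replace (Cmod (u O) ^ 2 * (B / Cmod (u O) ^ 2 + 1)) with (B + Cmod (u O) ^ 2) by (field; nra). lra.
  - apply Rmult_le_compat_l; lra.
Qed.

(** A zero of [u] at the origin is shared by [v] and removed by shifting both, with the same [w]. If
    [u] is identically zero, the mean-square comparison forces [v = 0], and [w = 0] serves. *)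
Lemma contractive_quotient u v : adm u -> adm v ->
  (forall z, Cmod z < 1 -> Cmod (ev v z) <= Cmod (ev u z)) ->
  exists w, contractive w /\ forall n, conv w u n = v n.
Proof.
  intros Hu Hv Hle. destruct (classic (exists n, u n <> 0%C)) as [[q Hq]|Hno].
  - revert u v Hu Hv Hle Hq. induction q as [|q IH]; intros u v Hu Hv Hle Hq.
    + exists (quot u v).
      assert (E : forall n, conv (quot u v) u n = v n) by (intros; rewrite conv_comm; now apply conv_quot).
      split; auto. now apply (quotient_contractive u v).
    + destruct (classic (u O = 0%C)) as [H0|H0].
      2:{ exists (quot u v).
          assert (E : forall n, conv (quot u v) u n = v n) by (intros; rewrite conv_comm; now apply conv_quot).
          split; auto. now apply (quotient_contractive u v). }
      assert (V0 : v O = 0%C).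
      { apply Cmod_eq_0. apply Rle_antisym; [|apply Cmod_ge_0].
        specialize (Hle 0%C). rewrite !ev_0, H0, Cmod_0 in Hle by auto. apply Hle; lra. }
      destruct (IH (fun n => u (S n)) (fun n => v (S n))) as (w & Hw & Ew); auto using adm_shift.
      { assert (P : forall z, Cmod z < 1 -> z <> 0%C ->
          Cmod (ev (fun n => v (S n)) z) <= Cmod (ev (fun n => u (S n)) z)).
        { intros z Hz Hz0. specialize (Hle z Hz).
          rewrite (ev_shift u z Hu Hz), (ev_shift v z Hv Hz), H0, V0, !Cplus_0_l, !Cmod_mult in Hle.
          apply Rmult_le_reg_l with (Cmod z); auto. now apply Cmod_gt_0. }
        intros z Hz. destruct (classic (z = 0%C)) as [->|Hz0]; auto.
        apply le_at_limit; auto using adm_shift. }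
      exists w. split; auto. intros [|n].
      * simpl. rewrite H0, V0. ring.
      * rewrite conv_S_r, H0, Ew. ring.
  - assert (Z : forall n, u n = 0%C) by (intros n; apply NNPP; intros F; apply Hno; now exists n).
    exists (fun _ => 0%C).
    assert (CZ : forall x n, conv (fun _ => 0%C) x n = 0%C).
    { intros x n. rewrite conv_csum. apply csum_zero. intros; ring. }
    split.
    + intros x n. unfold nrm2 at 1. rewrite rsum_zero; [apply nrm2_ge0|].
      intros i _. rewrite CZ, Cmod_0. ring.
    + intros n. rewrite CZ. symmetry. apply Cmod_eq_0.
      assert (HB : nrm2 v (/ 2) (S n) <= 0).
      { apply (circle_l2_le u v (/ 2) 0); auto; [lra|intros; apply Hle; lra|].
        intros m. unfold nrm2. rewrite rsum_zero; [lra|]. intros i _. rewrite Z, Cmod_0. ring. }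
      assert (T : (Cmod (v n) * (/ 2) ^ n) ^ 2 <= 0).
      { eapply Rle_trans; [|apply HB].
        apply (rsum_term_le (fun i => (Cmod (v i) * (/ 2) ^ i) ^ 2)); [lia|intros; apply pow2_ge_0]. }
      assert (0 < (/ 2) ^ n) by (apply pow_lt; lra). pose proof (Cmod_ge_0 (v n)).
      assert (Cmod (v n) * (/ 2) ^ n = 0) by nra. nra.
Qed.

(** * The refined Bohr inequality *)

(* The bound for [|a (i + 1)|] given by Carlson's inequalities. *)
Definition cbound (a : nat -> C) (i : nat) : R :=
  1 - sq a (S (Nat.div2 i)) -
  (if Nat.odd i then Cmod (a (S (Nat.div2 i))) ^ 2 / (1 + Cmod (a O)) else 0).

Lemma cbound_even a m : cbound a (2 * m) = 1 - sq a (S m).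
Proof. unfold cbound. rewrite Nat.div2_double, Nat.odd_even. ring. Qed.

Lemma cbound_odd a m :
  cbound a (S (2 * m)) = 1 - sq a (S m) - Cmod (a (S m)) ^ 2 / (1 + Cmod (a O)).
Proof.
  unfold cbound. rewrite Nat.div2_succ_double.
  replace (Nat.odd (S (2 * m))) with true; [ring|].
  symmetry. rewrite <- Nat.add_1_r. apply Nat.odd_odd.
Qed.

Lemma even_odd_cases i : exists m, i = (2 * m)%nat \/ i = S (2 * m).
Proof.
  destruct (Nat.Even_or_Odd i) as [[m H]|[m H]]; exists m; [left|right]; lia.
Qed.

Lemma Cmod_le_cbound a i : contractive a -> Cmod (a (S i)) <= cbound a i.
Proof.
  intros Ha. destruct (even_odd_cases i) as [m [->| ->]].
  - rewrite cbound_even. now apply carlson_odd.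
  - rewrite cbound_odd. replace (S (S (2 * m))) with (2 * S m)%nat by lia. now apply carlson_even.
Qed.

Lemma cbound_ge0 a i : contractive a -> 0 <= cbound a i.
Proof. intros Ha. eapply Rle_trans; [apply Cmod_ge_0|now apply Cmod_le_cbound]. Qed.

(** From an even index to the next, a fraction [1 / (1 + |a_0|)] of a new square is subtracted; the
    following step completes it to the full square. *)
Lemma cbound_decr a i : cbound a (S i) <= cbound a i.
Proof.
  pose proof (Cmod_ge_0 (a O)) as H0.
  destruct (even_odd_cases i) as [m [->| ->]].
  - rewrite cbound_even, cbound_odd.
    assert (0 <= Cmod (a (S m)) ^ 2 / (1 + Cmod (a O)))
      by (apply Rdiv_le_0_compat; [apply pow2_ge_0|lra]). lra.
  - rewrite cbound_odd. replace (S (S (2 * m))) with (2 * S m)%nat by lia. rewrite cbound_even.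
    change (sq a (S (S m))) with (sq a (S m) + Cmod (a (S m)) ^ 2).
    assert (Cmod (a (S m)) ^ 2 / (1 + Cmod (a O)) <= Cmod (a (S m)) ^ 2); [|lra].
    pose proof (pow2_ge_0 (Cmod (a (S m)))).
    apply Rmult_le_reg_r with (1 + Cmod (a O)); [lra|].
    unfold Rdiv. rewrite Rmult_assoc, Rinv_l by lra. nra.
Qed.

Lemma contractive_Cmod_le a i : contractive a -> Cmod (a (S i)) <= 1 - Cmod (a O) ^ 2.
Proof.
  intros Ha. eapply Rle_trans; [now apply Cmod_le_cbound|].
  apply Rle_trans with (cbound a O).
  - induction i as [|i IH]; [lra|]. eapply Rle_trans; [apply cbound_decr|auto].
  - unfold cbound, sq. simpl. lra.
Qed.

Definition refined_weight (a0 r : R) : R := (1 + a0 * r) / ((1 + a0) * (1 - r)).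

Lemma refined_weight_ge0 a0 r : 0 <= a0 -> 0 <= r < 1 -> 0 <= refined_weight a0 r.
Proof. intros H1 H2. apply Rdiv_le_0_compat; [nra|]. apply Rmult_lt_0_compat; lra. Qed.

(** The square [|a_j|^2] is subtracted with weight [1 / (1 + |a_0|)] at the power [r^(2j)] and fully
    at every higher power. In the unrestricted sum it collects [r^(2j) / (1 + |a_0|) + r^(2j+1) / (1
    - r)], which is [r^(2j)] times [refined_weight]. The last term corrects for stopping at
    [2 n]. *)
Lemma cbound_sum_eq a r n : 0 <= r < 1 ->
  rsum (fun i => cbound a i * r ^ S i) (S (2 * n)) =
    (1 - Cmod (a O) ^ 2) * (r - r ^ (2 * n + 2)) / (1 - r)
    - refined_weight (Cmod (a O)) r * rsum (fun j => Cmod (a (S j)) ^ 2 * r ^ (2 * S j)) n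
    + (sq a (S n) - Cmod (a O) ^ 2) * r ^ (2 * n + 2) / (1 - r).
Proof.
  intros Hr. pose proof (Cmod_ge_0 (a O)) as H0. unfold refined_weight.
  induction n as [|n IH].
  - simpl rsum. rewrite (cbound_even a 0 : cbound a 0 = _). unfold sq; simpl. field. lra.
  - replace (S (2 * S n)) with (S (S (S (2 * n)))) by lia.
    change (rsum (fun i => cbound a i * r ^ S i) (S (S (S (2 * n)))))
      with (rsum (fun i => cbound a i * r ^ S i) (S (2 * n))
        + cbound a (S (2 * n)) * r ^ S (S (2 * n)) + cbound a (S (S (2 * n))) * r ^ S (S (S (2 * n)))).
    rewrite IH, cbound_odd. replace (S (S (2 * n))) with (2 * S n)%nat by lia. rewrite cbound_even.
    change (sq a (S (S n))) with (sq a (S n) + Cmod (a (S n)) ^ 2).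
    change (rsum (fun j => Cmod (a (S j)) ^ 2 * r ^ (2 * S j)) (S n))
      with (rsum (fun j => Cmod (a (S j)) ^ 2 * r ^ (2 * S j)) n + Cmod (a (S n)) ^ 2 * r ^ (2 * S n)).
    replace (2 * n + 2)%nat with (2 * S n)%nat by lia.
    replace (r ^ (2 * S n + 2)) with (r ^ (2 * S n) * r ^ 2) by (rewrite <- pow_add; f_equal; lia).
    change (r ^ S (2 * S n)) with (r * r ^ (2 * S n)).
    field. split; lra.
Qed.

Lemma cbound_sum_le a r n : contractive a -> 0 <= r < 1 ->
  rsum (fun i => cbound a i * r ^ S i) n
    + refined_weight (Cmod (a O)) r * rsum (fun j => Cmod (a (S j)) ^ 2 * r ^ (2 * S j)) n
  <= (1 - Cmod (a O) ^ 2) * r / (1 - r).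
Proof.
  intros Ha Hr. pose proof (cbound_sum_eq a r n Hr) as E.
  assert (M : rsum (fun i => cbound a i * r ^ S i) n <= rsum (fun i => cbound a i * r ^ S i) (S (2 * n))).
  { apply rsum_incr; [lia|]. intros i. apply Rmult_le_pos; [now apply cbound_ge0|apply pow_le; lra]. }
  pose proof (contractive_sq_le1 a (S n) Ha) as H1.
  assert (P : 0 <= (1 - sq a (S n)) * r ^ (2 * n + 2) / (1 - r)).
  { apply Rdiv_le_0_compat; [|lra]. apply Rmult_le_pos; [lra|apply pow_le; lra]. }
  (* The two truncation terms combine into a single one, of definite sign because
     [sq a (S n) <= 1]. *)
  assert (E2 : (1 - Cmod (a O) ^ 2) * (r - r ^ (2 * n + 2)) / (1 - r)
     + (sq a (S n) - Cmod (a O) ^ 2) * r ^ (2 * n + 2) / (1 - r)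
     = (1 - Cmod (a O) ^ 2) * r / (1 - r) - (1 - sq a (S n)) * r ^ (2 * n + 2) / (1 - r)) by (field; lra).
  lra.
Qed.

Lemma refined_bohr a r n : contractive a -> 0 <= r < 1 ->
  rsum (fun i => Cmod (a (S i)) * r ^ S i) n
    + refined_weight (Cmod (a O)) r * rsum (fun j => Cmod (a (S j)) ^ 2 * r ^ (2 * S j)) n
  <= (1 - Cmod (a O) ^ 2) * r / (1 - r).
Proof.
  intros Ha Hr. eapply Rle_trans; [|apply (cbound_sum_le a r n Ha Hr)].
  apply Rplus_le_compat_r. apply rsum_le. intros i _.
  apply Rmult_le_compat_r; [apply pow_le; lra|now apply Cmod_le_cbound].
Qed.

(** * Transfer of the inequality to a series with dominated derivative *)

(** Summation by parts; the induction carries the boundary term [w n * (rsum y n - rsum x n)], which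
    is nonnegative and dropped at the end. *)
Lemma abel_rsum_le (x y w : nat -> R) n : (forall n, rsum x n <= rsum y n) ->
  (forall n, 0 <= w (S n) <= w n) ->
  rsum (fun i => w i * x i) n <= rsum (fun i => w i * y i) n.
Proof.
  intros H Hw.
  assert (P : w n * (rsum y n - rsum x n) <= rsum (fun i => w i * y i) n - rsum (fun i => w i * x i) n).
  { induction n as [|n IH]; simpl; [lra|].
    specialize (H (S n)). specialize (Hw n). simpl in H.
    assert (w (S n) * (rsum y n + y n - (rsum x n + x n)) <= w n * (rsum y n + y n - (rsum x n + x n)))
      by (apply Rmult_le_compat_r; lra).
    lra. }
  assert (0 <= w n * (rsum y n - rsum x n)).
  { specialize (H n). specialize (Hw n). apply Rmult_le_pos; lra. }
  lra.
Qed.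

(** Increasing weights against a nonincreasing sequence do no better than their average
    [(n + 1) / 2]; the induction step is [n B_n <= B_0 + ... + B_(n-1)]. *)
Lemma chebyshev_rsum_le (B : nat -> R) n : (forall i, B (S i) <= B i) ->
  2 * rsum (fun j => INR (S j) * B j) n <= INR (S n) * rsum B n.
Proof.
  intros HB.
  assert (P : forall n, INR n * B n <= rsum B n).
  { intros m; induction m as [|m IH]; [simpl; lra|]. rewrite S_INR. simpl rsum.
    specialize (HB m). pose proof (pos_INR m). nra. }
  induction n as [|n IH]; [simpl; lra|]. specialize (P n).
  change (2 * (rsum (fun j => INR (S j) * B j) n + INR (S n) * B n) <= INR (S (S n)) * (rsum B n + B n)).
  rewrite (S_INR (S n)). rewrite S_INR in *. lra.
Qed.

(** Exchanging the sums, [B_j] collects the powers of [r] from [r^(j+2)] on, a geometric series; the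
    subtracted term is the part beyond [n]. *)
Lemma rsum_antidiag_geom B r n : 0 <= r < 1 ->
  rsum (fun i => r ^ S i * rsum B i) n =
    r / (1 - r) * rsum (fun i => B i * r ^ S i) n - r ^ S n / (1 - r) * rsum B n.
Proof.
  intros Hr. induction n as [|n IH]; [simpl; ring|].
  change (rsum (fun i => r ^ S i * rsum B i) n + r ^ S n * rsum B n =
    r / (1 - r) * (rsum (fun i => B i * r ^ S i) n + B n * r ^ S n)
      - r ^ S (S n) / (1 - r) * (rsum B n + B n)).
  rewrite IH. simpl. field. lra.
Qed.

(** Read off the coefficient of [d' = w a']: the term with [w_0] stays separate, the other [w_j] are
    at most [1 - |w_0|^2], and the weights [j + 1] brought in by the derivative are averaged against
    the final division by [i + 1]. *)
Lemma quotient_coef_le a w d i : contractive a -> contractive w ->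
  (forall n, conv w (der a) n = der d n) ->
  Cmod (d (S i)) <= Cmod (w O) * cbound a i + (1 - Cmod (w O) ^ 2) / 2 * rsum (cbound a) i.
Proof.
  intros Ha Hw E. set (c := Cmod (w O)).
  assert (Hc : 0 <= 1 - c ^ 2).
  { eapply Rle_trans; [|apply (contractive_Cmod_le w O Hw)]. apply Cmod_ge_0. }
  assert (HI : 0 < INR (S i)) by (apply lt_0_INR; lia).
  apply Rmult_le_reg_l with (INR (S i)); auto.
  replace (INR (S i) * Cmod (d (S i))) with (Cmod (der d i)).
  2:{ unfold der. apply Cmod_scal_pos. lra. }
  rewrite <- E.
  apply Rle_trans with (c * (INR (S i) * cbound a i) + (1 - c ^ 2) * rsum (fun j => INR (S j) * cbound a j) i).
  - assert (D : forall j, Cmod (der a j) <= INR (S j) * cbound a j).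
    { intros j. unfold der. rewrite Cmod_scal_pos by apply pos_INR.
      apply Rmult_le_compat_l; [apply pos_INR|now apply Cmod_le_cbound]. }
    destruct i as [|i].
    + simpl conv. rewrite Cmod_mult. fold c. specialize (D O).
      assert (c * Cmod (der a O) <= c * (INR 1 * cbound a O)) by (apply Rmult_le_compat_l; [apply Cmod_ge_0|auto]).
      simpl rsum. lra.
    + change (conv w (der a) (S i)) with (w O * der a (S i) + conv (fun k => w (S k)) (der a) i)%C.
      eapply Rle_trans; [apply Cmod_triangle|]. apply Rplus_le_compat.
      * rewrite Cmod_mult. apply Rmult_le_compat_l; [apply Cmod_ge_0|auto].
      * rewrite conv_comm, conv_csum. eapply Rle_trans; [apply Cmod_csum_le|].
        rewrite <- rsum_scal. apply rsum_le. intros j Hj. rewrite Cmod_mult, Rmult_comm.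
        apply Rmult_le_compat; auto using Cmod_ge_0. now apply contractive_Cmod_le.
  - pose proof (chebyshev_rsum_le (cbound a) i (cbound_decr a)) as T.
    assert ((1 - c ^ 2) * (2 * rsum (fun j => INR (S j) * cbound a j) i)
      <= (1 - c ^ 2) * (INR (S i) * rsum (cbound a) i)) by (apply Rmult_le_compat_l; auto).
    lra.
Qed.

Lemma pow_div_decr r n : 0 <= r <= 1 ->
  0 <= r ^ (2 * S (S n)) / INR (S (S n)) ^ 2 <= r ^ (2 * S n) / INR (S n) ^ 2.
Proof.
  intros Hr. assert (H1 : 0 < INR (S n)) by (apply lt_0_INR; lia).
  assert (H2 : INR (S n) <= INR (S (S n))) by (apply le_INR; lia).
  assert (P1 : 0 <= r ^ (2 * S (S n))) by (apply pow_le; lra).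
  assert (P2 : r ^ (2 * S (S n)) <= r ^ (2 * S n)).
  { replace (2 * S (S n))%nat with (2 + 2 * S n)%nat by lia. rewrite pow_add.
    assert (0 <= r ^ (2 * S n)) by (apply pow_le; lra). 
    assert (r ^ 2 <= 1) by nra. nra. }
  assert (0 < INR (S n) ^ 2) by (apply pow_lt; auto).
  split; [apply Rdiv_le_0_compat; [auto|apply pow_lt; lra]|].
  unfold Rdiv. apply Rmult_le_compat; auto.
  - left. apply Rinv_0_lt_compat. apply pow_lt; lra.
  - apply Rinv_le_contravar; auto. apply pow_incr; lra.
Qed.

(** The linear and quadratic parts are compared separately with the bounds for [a]. The linear part
    is compared with the Carlson bounds rather than with [|a_n|], because Chebyshev's inequality
    needs their monotonicity. *)
Lemma refined_bohr_dominated a w d r n : contractive a -> contractive w ->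
  (forall n, conv w (der a) n = der d n) -> 0 <= r <= 1 / 2 ->
  rsum (fun i => Cmod (d (S i)) * r ^ S i) n
    + refined_weight (Cmod (a O)) r * rsum (fun j => Cmod (d (S j)) ^ 2 * r ^ (2 * S j)) n
  <= (1 - Cmod (a O) ^ 2) * r / (1 - r).
Proof.
  intros Ha Hw E Hr. eapply Rle_trans; [|apply (cbound_sum_le a r n Ha); lra].
  apply Rplus_le_compat.
  - set (c := Cmod (w O)). set (W := rsum (fun i => cbound a i * r ^ S i) n).
    assert (Hc0 : 0 <= c) by apply Cmod_ge_0.
    assert (Hc : 0 <= 1 - c ^ 2).
    { eapply Rle_trans; [|apply (contractive_Cmod_le w O Hw)]. apply Cmod_ge_0. }
    assert (HW : 0 <= W).
    { apply rsum_ge0. intros i _. apply Rmult_le_pos; [now apply cbound_ge0|apply pow_le; lra]. }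
    apply Rle_trans with (c * W + (1 - c ^ 2) / 2 * rsum (fun i => r ^ S i * rsum (cbound a) i) n).
    + unfold W. rewrite <- !rsum_scal, <- rsum_plus. apply rsum_le. intros i _.
      pose proof (quotient_coef_le a w d i Ha Hw E) as T. fold c in T.
      assert (0 <= r ^ S i) by (apply pow_le; lra). nra.
    (* Here [r <= 1/2] enters, as [r / (1 - r) <= 1]. What remains is [c + (1 - c^2) / 2 <= 1]. *)
    + assert (X : rsum (fun i => r ^ S i * rsum (cbound a) i) n <= W).
      { rewrite rsum_antidiag_geom by lra. fold W.
        assert (0 <= r ^ S n / (1 - r) * rsum (cbound a) n).
        { apply Rmult_le_pos.
          - apply Rdiv_le_0_compat; [apply pow_le|]; lra.
          - apply rsum_ge0. intros; now apply cbound_ge0. }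
        assert (r / (1 - r) <= 1).
        { apply Rmult_le_reg_r with (1 - r); [lra|]. unfold Rdiv. rewrite Rmult_assoc, Rinv_l; lra. }
        nra. }
      assert ((1 - c ^ 2) / 2 * rsum (fun i => r ^ S i * rsum (cbound a) i) n <= (1 - c ^ 2) / 2 * W)
        by (apply Rmult_le_compat_l; lra).
      assert (0 <= (1 - c) ^ 2 * W) by (apply Rmult_le_pos; [apply pow2_ge_0|auto]). nra.
  - apply Rmult_le_compat_l; [apply refined_weight_ge0; [apply Cmod_ge_0|lra]|].
    (* Since [w] contracts derivatives, the squares are written through [der] with decreasing
       weights [r^(2j) / j^2], to which summation by parts applies. *)
    assert (R1 : forall e, rsum (fun j => Cmod (e (S j)) ^ 2 * r ^ (2 * S j)) n
      = rsum (fun j => (r ^ (2 * S j) / INR (S j) ^ 2) * Cmod (der e j) ^ 2) n).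
    { intros e. apply rsum_ext. intros j _. unfold der. rewrite Cmod_scal_pos by apply pos_INR.
      assert (0 < INR (S j)) by (apply lt_0_INR; lia). field. lra. }
    rewrite !R1. apply abel_rsum_le.
    + intros m. change (sq (der d) m <= sq (der a) m).
      unfold sq at 1. rewrite (rsum_ext _ (fun i => Cmod (conv w (der a) i) ^ 2)) by (intros; now rewrite E).
      now apply contractive_sq.
    + intros m. apply pow_div_decr. lra.
Qed.

(** * The root *)

Lemma series_lim_bounded f M : (forall n, 0 <= f n) -> (forall n, rsum f n <= M) ->
  is_lim_seq (rsum f) (Series f).
Proof.
  intros H0 HM. apply is_series_rsum. apply Series_correct.
  destruct (ex_finite_lim_seq_incr (rsum f) M) as [l Hl]; auto.
  - intros n. simpl. specialize (H0 n). lra.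
  - exists l. now apply is_series_rsum.
Qed.

Lemma series_pair_le f g c M : (forall n, 0 <= f n) -> (forall n, 0 <= g n) -> 0 < c ->
  (forall n, rsum f n + c * rsum g n <= M) -> Series f + c * Series g <= M.
Proof.
  intros Hf Hg Hc H.
  assert (Pf : forall n, 0 <= rsum f n) by (intros; apply rsum_ge0; auto).
  assert (Pg : forall n, 0 <= rsum g n) by (intros; apply rsum_ge0; auto).
  assert (L : Rbar_le (Series f + c * Series g) M); [|exact L].
  apply (is_lim_seq_le (fun n => rsum f n + c * rsum g n) (fun _ => M)); auto.
  - apply is_lim_seq_plus'.
    + apply series_lim_bounded with M; auto. intros n. specialize (H n). specialize (Pg n).
      assert (0 <= c * rsum g n) by (apply Rmult_le_pos; lra). lra.
    + apply (is_lim_seq_scal_l _ c (Finite (Series g))).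
      apply series_lim_bounded with (M / c); auto. intros n. specialize (H n). specialize (Pf n).
      apply Rmult_le_reg_l with c; auto. replace (c * (M / c)) with M by (field; lra). lra.
  - apply is_lim_seq_const.
Qed.

Lemma E_quantity_le a b d w k r : contractive a -> contractive w ->
  (forall n, conv w (der a) n = der d n) ->
  (forall n, b (S n) = (RtoC k * d (S n))%C) -> 0 <= k -> 0 <= r <= 1 / 2 ->
  E_quantity a b k r <= (1 + k) * ((1 - Cmod (a O) ^ 2) * r / (1 - r)).
Proof.
  intros Ha Hw E Hb Hk Hr. unfold E_quantity, Defs.majorant, sq_norm.
  pose proof (Cmod_ge_0 (a O)) as H0.
  set (M := (1 - Cmod (a O) ^ 2) * r / (1 - r)).
  set (c := refined_weight (Cmod (a O)) r).
  assert (Hc : 0 < c) by (apply Rdiv_lt_0_compat; [nra|apply Rmult_lt_0_compat; lra]).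
  replace (1 / (1 + Cmod (a O)) * ((1 + Cmod (a O) * r) / (1 - r))) with c
    by (unfold c, refined_weight; field; lra).
  assert (Pr : forall n, 0 <= r ^ n) by (intros; apply pow_le; lra).
  assert (P1 : forall e, forall n : nat, 0 <= Cmod (e (S n)) * r ^ S n)
    by (intros; apply Rmult_le_pos; [apply Cmod_ge_0|auto]).
  assert (P2 : forall e, forall n : nat, 0 <= Cmod (e (S n)) ^ 2 * r ^ (2 * S n))
    by (intros; apply Rmult_le_pos; [apply pow2_ge_0|auto]).
  assert (B1 := series_pair_le _ _ c M (P1 a) (P2 a) Hc
    (fun n => refined_bohr a r n Ha ltac:(lra))).
  assert (B2 := series_pair_le _ _ c M (P1 d) (P2 d) Hc
    (fun n => refined_bohr_dominated a w d r n Ha Hw E Hr)).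
  rewrite (Series_ext (fun n => Cmod (b (S n)) * r ^ S n) (fun n => k * (Cmod (d (S n)) * r ^ S n))).
  2:{ intros n. rewrite Hb, Cmod_scal_pos by auto. ring. }
  rewrite (Series_ext (fun n => Cmod (b (S n)) ^ 2 * r ^ (2 * S n))
     (fun n => k ^ 2 * (Cmod (d (S n)) ^ 2 * r ^ (2 * S n)))).
  2:{ intros n. rewrite Hb, Cmod_scal_pos by auto. ring. }
  rewrite !Series_scal_l.
  (* This makes the part of [b] equal to [k] times the one estimated for [d]; the convention
     [c(0) = 0] covers [k = 0]. *)
  assert (Ek : c_coef k * k ^ 2 = k).
  { unfold c_coef. destruct (Req_EM_T k 0) as [->|Hk0]; [ring|field; auto]. }
  rewrite <- Rmult_assoc, Ek.
  set (s1 := Series (fun n => Cmod (d (S n)) * r ^ S n)) in *.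
  set (s2 := Series (fun n => Cmod (d (S n)) ^ 2 * r ^ (2 * S n))) in *.
  assert (k * (s1 + c * s2) <= k * M) by (apply Rmult_le_compat_l; auto). lra.
Qed.

Lemma rpow_pos x p : 0 < x -> rpow x p = Rpower x p.
Proof. intros H. unfold rpow. destruct (Req_EM_T x 0); [lra|reflexivity]. Qed.

Lemma rpow_le x y p : 0 <= p -> 0 <= x <= y -> rpow x p <= rpow y p.
Proof.
  intros Hp [H0 H]. unfold rpow.
  destruct (Req_EM_T x 0) as [->|Hx]; destruct (Req_EM_T y 0) as [->|Hy]; try lra.
  - left. apply exp_pos.
  - apply Rle_Rpower_l; lra.
Qed.

Lemma rpow_lt_1 x p : 0 < p -> 0 <= x < 1 -> rpow x p < 1.
Proof.
  intros Hp Hx. unfold rpow. destruct (Req_EM_T x 0); [lra|].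
  unfold Rpower. rewrite <- exp_0. apply exp_increasing.
  assert (ln x < 0) by (rewrite <- ln_1; apply ln_increasing; lra). nra.
Qed.

(** This is where [p <= 2] acts: it places the root at or below [1 / (2 + k)]. *)
Lemma rpow_ge_sq x p : p <= 2 -> 0 < x < 1 -> x ^ 2 <= rpow x p.
Proof.
  intros Hp Hx. rewrite rpow_pos by lra. rewrite <- (Rpower_pow 2 x) by lra.
  assert (ln x < 0) by (rewrite <- ln_1; apply ln_increasing; lra).
  assert (H2 : p * ln x >= INR 2 * ln x) by (simpl; nra).
  unfold Rpower. destruct (Rle_lt_or_eq_dec (INR 2 * ln x) (p * ln x)) as [H3|H3]; [lra| |].
  - left. now apply exp_increasing.
  - rewrite H3. lra.
Qed.

Definition pick_bound (a x : R) : R := (x + a) / (1 + a * x).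

Lemma pick_bound_le a x y : 0 <= a <= 1 -> 0 <= x <= y -> pick_bound a x <= pick_bound a y.
Proof.
  intros Ha Hx. unfold pick_bound.
  assert (0 <= a * x) by (apply Rmult_le_pos; lra).
  assert (0 <= a * y) by (apply Rmult_le_pos; lra).
  apply Rmult_le_reg_r with ((1 + a * x) * (1 + a * y)); [apply Rmult_lt_0_compat; lra|].
  replace ((x + a) / (1 + a * x) * ((1 + a * x) * (1 + a * y))) with ((x + a) * (1 + a * y)) by (field; lra).
  replace ((y + a) / (1 + a * y) * ((1 + a * x) * (1 + a * y))) with ((y + a) * (1 + a * x)) by (field; lra).
  assert (0 <= (1 - a ^ 2) * (y - x)) by (apply Rmult_le_pos; nra). nra.
Qed.

Lemma pick_bound_lt_1 a x : 0 <= a < 1 -> 0 <= x < 1 -> pick_bound a x < 1.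
Proof.
  intros Ha Hx. unfold pick_bound. apply Rmult_lt_reg_r with (1 + a * x); [nra|].
  unfold Rdiv. rewrite Rmult_assoc, Rinv_l by nra. nra.
Qed.

Lemma pick_bound_gt a x : 0 <= a < 1 -> 0 < x -> a < pick_bound a x.
Proof.
  intros Ha Hx. unfold pick_bound. apply Rmult_lt_reg_r with (1 + a * x); [nra|].
  unfold Rdiv. rewrite Rmult_assoc, Rinv_l by nra.
  assert (0 < (1 - a ^ 2) * x) by (apply Rmult_lt_0_compat; nra). nra.
Qed.

(** The proven upper bound for [F - 1]. It is [lambda] divided by the positive factor
    [(1 - r) * rpow (1 + a * r ^ m) p], and monotone where [lambda] is not visibly so. *)
Definition excess (m : nat) (k p a r : R) : R :=
  (1 + k) * ((1 - a ^ 2) * r / (1 - r)) - 1 + rpow (pick_bound a (r ^ m)) p.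

Lemma pow_in_01 r m : 0 < r < 1 -> (1 <= m)%nat -> 0 < r ^ m <= r.
Proof.
  intros Hr Hm. split; [apply pow_lt; lra|]. destruct m as [|m]; [lia|]. simpl.
  assert (0 <= r ^ m) by (apply pow_le; lra).
  assert (r ^ m <= 1) by (rewrite <- (pow1 m); apply pow_incr; lra). nra.
Qed.

Lemma lambda_excess m k p a r : 0 <= a -> 0 < r < 1 ->
  lambda m k p a r = (1 - r) * rpow (1 + a * r ^ m) p * excess m k p a r.
Proof.
  intros Ha Hr. assert (Hx : 0 < r ^ m) by (apply pow_lt; lra).
  assert (H1 : 0 < 1 + a * r ^ m) by nra.
  assert (H2 : 0 < pick_bound a (r ^ m)) by (apply Rdiv_lt_0_compat; lra).
  unfold lambda, excess.
  replace (r ^ m + a) with (pick_bound a (r ^ m) * (1 + a * r ^ m)) by (unfold pick_bound; field; lra).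
  rewrite (rpow_pos (pick_bound a (r ^ m) * _)) by (apply Rmult_lt_0_compat; auto).
  rewrite <- Rpower_mult_distr, !rpow_pos by auto. field. lra.
Qed.

Lemma excess_increasing m k p a r s : 0 <= a < 1 -> 0 <= k -> 0 < p -> 0 < r < s -> s < 1 ->
  excess m k p a r < excess m k p a s.
Proof.
  intros Ha Hk Hp Hr Hs. unfold excess.
  assert (H1 : r / (1 - r) < s / (1 - s)).
  { apply Rmult_lt_reg_r with ((1 - r) * (1 - s)); [nra|].
    replace (r / (1 - r) * ((1 - r) * (1 - s))) with (r * (1 - s)) by (field; lra).
    replace (s / (1 - s) * ((1 - r) * (1 - s))) with (s * (1 - r)) by (field; lra). nra. }
  assert (HT : 0 < (1 + k) * (1 - a ^ 2)) by (apply Rmult_lt_0_compat; nra).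
  assert (H2 : rpow (pick_bound a (r ^ m)) p <= rpow (pick_bound a (s ^ m)) p).
  { assert (0 < r ^ m) by (apply pow_lt; lra).
    assert (r ^ m <= s ^ m) by (apply pow_incr; lra).
    apply rpow_le; [lra|]. split; [apply Rdiv_le_0_compat; nra|]. apply pick_bound_le; lra. }
  replace ((1 + k) * ((1 - a ^ 2) * r / (1 - r))) with ((1 + k) * (1 - a ^ 2) * (r / (1 - r))) by (unfold Rdiv; ring).
  replace ((1 + k) * ((1 - a ^ 2) * s / (1 - s))) with ((1 + k) * (1 - a ^ 2) * (s / (1 - s))) by (unfold Rdiv; ring).
  assert ((1 + k) * (1 - a ^ 2) * (r / (1 - r)) < (1 + k) * (1 - a ^ 2) * (s / (1 - s)))
    by (apply Rmult_lt_compat_l; auto). lra.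
Qed.

Lemma excess_continuous m k p a r : 0 <= a -> 0 < r < 1 ->
  continuity_pt (fun r => (1 + k) * ((1 - a ^ 2) * r / (1 - r)) - 1
     + Rpower (pick_bound a (r ^ m)) p) r.
Proof.
  intros Ha Hr. assert (0 < r ^ m) by (apply pow_lt; lra).
  apply continuity_pt_filterlim.
  match goal with |- filterlim ?f _ _ => apply (@ex_derive_continuous R_AbsRing R_NormedModule f r) end.
  unfold Rpower, pick_bound.
  auto_derive. repeat split; try nra; try lra.
  apply Rmult_lt_0_compat; [lra|]. apply Rinv_0_lt_compat. nra.
Qed.

Lemma excess_root m k p a : 0 <= a < 1 -> 0 <= k <= 1 -> 0 < p <= 2 -> (1 <= m)%nat ->
  exists r, 0 < r <= 1 / 2 /\ excess m k p a r = 0.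
Proof.
  intros Ha Hk Hp Hm. set (s := 1 / (2 + k)).
  (* At [s] one has [s / (1 - s) = 1 / (1 + k)], so the first term of [excess] is [1 - a^2] and the
     sign is decided by comparing the power term with [a^2]. *)
  assert (Hs : 1 / 3 <= s <= 1 / 2).
  { unfold s. split; apply Rmult_le_reg_r with (2 + k); try lra;
      unfold Rdiv; rewrite (Rmult_assoc _ (/ (2 + k))), Rinv_l by lra; lra. }
  set (sg := rpow (pick_bound a (1 / 2)) p).
  assert (Hb0 : 0 <= pick_bound a (1 / 2)) by (apply Rdiv_le_0_compat; nra).
  assert (Hsg : sg < 1) by (apply rpow_lt_1; [lra|split; [auto|apply pick_bound_lt_1; lra]]).
  assert (Hsg0 : 0 <= sg).
  { unfold sg, rpow. destruct (Req_EM_T _ 0); [lra|]. left; apply exp_pos. }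
  (* At [r1] the first term is at most [4 r1 = (1 - sg) / 4] and the power term at most [sg], so the
     sum stays below [1]. Starting at [r1 > 0] keeps the base positive, where [rpow] and [Rpower]
     agree, even for [a = 0]. *)
  set (r1 := (1 - sg) / 16). assert (Hr1 : 0 < r1 <= 1 / 16) by (unfold r1; lra).
  set (f := fun r => (1 + k) * ((1 - a ^ 2) * r / (1 - r)) - 1 + Rpower (pick_bound a (r ^ m)) p).
  assert (Ef : forall r, 0 < r < 1 -> excess m k p a r = f r).
  { intros r Hr. unfold excess, f. rewrite rpow_pos; [reflexivity|].
    assert (0 < r ^ m) by (apply pow_lt; lra). apply Rdiv_lt_0_compat; nra. }
  assert (N : f r1 < 0).
  { rewrite <- Ef by lra. unfold excess. destruct (pow_in_01 r1 m) as [Hx1 Hx2]; [lra|auto|].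
    assert (rpow (pick_bound a (r1 ^ m)) p <= sg).
    { apply rpow_le; [lra|]. split; [apply Rdiv_le_0_compat; nra|]. apply pick_bound_le; lra. }
    assert (B : (1 + k) * ((1 - a ^ 2) * r1 / (1 - r1)) <= 2 * (2 * r1)).
    { assert (H0 : 0 <= (1 - a ^ 2) * r1 / (1 - r1)) by (apply Rdiv_le_0_compat; [apply Rmult_le_pos; nra|lra]).
      assert (H1 : (1 - a ^ 2) * r1 / (1 - r1) <= 2 * r1).
      { apply Rmult_le_reg_r with (1 - r1); [lra|].
        replace ((1 - a ^ 2) * r1 / (1 - r1) * (1 - r1)) with ((1 - a ^ 2) * r1) by (field; lra). nra. }
      nra. }
    unfold r1 in B at 3. lra. }
  assert (P : 0 < f s).
  { rewrite <- Ef by lra. unfold excess.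
    replace ((1 + k) * ((1 - a ^ 2) * s / (1 - s))) with (1 - a ^ 2) by (unfold s; field; lra).
    destruct (pow_in_01 s m) as [Hx1 Hx2]; [lra|auto|].
    pose proof (pick_bound_gt a (s ^ m) Ha Hx1) as G.
    pose proof (pick_bound_lt_1 a (s ^ m) Ha ltac:(lra)) as G1.
    pose proof (rpow_ge_sq (pick_bound a (s ^ m)) p ltac:(lra) ltac:(lra)) as G2.
    set (y := pick_bound a (s ^ m)) in *. assert (a ^ 2 < y ^ 2) by nra. lra. }
  destruct (IVT_interv f r1 s) as [r [Hr Hfr]]; try lra.
  - intros r Hr1' Hr2. unfold f. apply excess_continuous; lra.
  - exists r. split; [lra|]. rewrite Ef by lra. exact Hfr.
Qed.

Lemma lambda_root_excess m k p a r : 0 <= a ->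
  lambda_root m k p a r <-> 0 < r < 1 /\ excess m k p a r = 0.
Proof.
  intros Ha. split; intros [Hr H]; split; auto.
  - rewrite lambda_excess in H by auto.
    assert (Hx : 0 < r ^ m) by (apply pow_lt; lra).
    assert (0 < rpow (1 + a * r ^ m) p) by (rewrite rpow_pos by nra; apply exp_pos).
    apply Rmult_integral in H. destruct H as [H|H]; auto.
    apply Rmult_integral in H. destruct H; lra.
  - rewrite lambda_excess, H by auto. ring.
Qed.

Lemma lambda_root_unique m k p a r s : 0 <= a < 1 -> 0 <= k -> 0 < p ->
  lambda_root m k p a r -> lambda_root m k p a s -> r = s.
Proof.
  intros Ha Hk Hp Hr Hs. apply lambda_root_excess in Hr; [|lra]. apply lambda_root_excess in Hs; [|lra].
  destruct (Rtotal_order r s) as [H|[H|H]]; auto; exfalso.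
  - pose proof (excess_increasing m k p a r s Ha Hk Hp ltac:(lra) ltac:(lra)). lra.
  - pose proof (excess_increasing m k p a s r Ha Hk Hp ltac:(lra) ltac:(lra)). lra.
Qed.

(** * The theorem *)

Lemma adm_zero : adm (fun _ => RtoC 0).
Proof. apply (adm_finite _ 0). reflexivity. Qed.

Lemma ev_zero z : Cmod z < 1 -> ev (fun _ => RtoC 0) z = RtoC 0.
Proof. intros Hz. rewrite (ev_finite _ 0 z Hz); reflexivity. Qed.

Lemma bounded_class_contractive h a : bounded_class h -> has_expansion h a -> contractive a.
Proof.
  intros [_ Hb] Ha. apply bounded_contractive; [now apply has_expansion_adm with h|].
  intros z Hz. rewrite <- (has_expansion_ev h a z Ha Hz). now apply Hb.
Qed.

(** If [|a_0| >= 1], the bound [|a_n| <= 1 - |a_0|^2] makes all further coefficients vanish; this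
    replaces the maximum principle. *)
Lemma nonconstant_Cmod_lt_1 h a : bounded_class h -> has_expansion h a -> ~ constant_in_disk h ->
  Cmod (a O) < 1.
Proof.
  intros Hb Ha Hn. pose proof (bounded_class_contractive h a Hb Ha) as Hc.
  apply Rnot_le_lt. intros H. apply Hn. exists (a O). intros z Hz.
  rewrite (has_expansion_ev h a z Ha Hz), (ev_finite a 1 z Hz).
  - unfold psum; simpl. ring.
  - intros [|n] Hn'; [lia|]. apply Cmod_eq_0, Rle_antisym; [|apply Cmod_ge_0].
    pose proof (contractive_Cmod_le a n Hc). nra.
Qed.

Lemma derivative_dominated_quotient k f h g a b : 0 <= k -> harmonic_class k f h g ->
  has_expansion h a -> has_expansion g b ->
  exists d w, contractive w /\ (forall n, conv w (der a) n = der d n) /\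
    (forall n, b (S n) = (RtoC k * d (S n))%C).
Proof.
  intros Hk (_ & _ & _ & _ & Hd) Ha Hb.
  pose proof (has_expansion_adm h a Ha) as Aa. pose proof (has_expansion_adm g b Hb) as Ab.
  assert (D : forall z, Cmod z < 1 -> Cmod (ev (der b) z) <= k * Cmod (ev (der a) z)).
  { intros z Hz. rewrite <- (C_derive_ev h a z Ha Hz), <- (C_derive_ev g b z Hb Hz). now apply Hd. }
  destruct (Req_dec k 0) as [->|Hk0].
  - destruct (contractive_quotient (der a) (fun _ => RtoC 0)) as (w & Hw & Ew).
    { now apply adm_der. }
    { apply adm_zero. }
    { intros z Hz. rewrite ev_zero, Cmod_0 by auto. apply Cmod_ge_0. }
    exists (fun _ => RtoC 0), w. repeat split; auto.
    + intros n. rewrite Ew. unfold der. ring.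
    (* For [k = 0] the series [der b] is dominated by the zero series, hence a product with it; so
       every coefficient of [b] after the first is [0]. *)
    + intros n. destruct (contractive_quotient (fun _ => RtoC 0) (der b)) as (w' & _ & Ew').
      { apply adm_zero. }
      { now apply adm_der. }
      { intros z Hz. rewrite ev_zero by auto. rewrite Cmod_0. specialize (D z Hz). lra. }
      specialize (Ew' n). rewrite conv_csum, csum_zero in Ew' by (intros; ring).
      apply (f_equal Cmod) in Ew'. unfold der in Ew'.
      rewrite Cmod_scal_pos, Cmod_0 in Ew' by apply pos_INR.
      assert (0 < INR (S n)) by (apply lt_0_INR; lia).
      rewrite Cmult_0_r. apply Cmod_eq_0. symmetry in Ew'. apply Rmult_integral in Ew'.
      destruct Ew'; lra.
  - assert (Hkc : RtoC k <> RtoC 0) by (intros F; apply RtoC_inj in F; lra).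
    set (d := fun n => (RtoC (/ k) * b n)%C).
    assert (Ad : adm d) by now apply adm_scal.
    destruct (contractive_quotient (der a) (der d)) as (w & Hw & Ew).
    { now apply adm_der. }
    { now apply adm_der. }
    { intros z Hz. rewrite (ev_ext (der d) (fun n => RtoC (/ k) * der b n)%C).
      - rewrite ev_scal by (auto; now apply adm_der).
        assert (0 < / k) by (apply Rinv_0_lt_compat; lra).
        rewrite Cmod_scal_pos by lra. specialize (D z Hz).
        apply Rmult_le_reg_l with k; [lra|]. rewrite <- Rmult_assoc, Rinv_r by lra. lra.
      - intros n. unfold der, d. ring. }
    exists d, w. repeat split; auto. intros n. unfold d. rewrite RtoC_inv by auto. field. auto.
Qed.

Lemma excess_le_0 m k p a r r0 : 0 <= a < 1 -> 0 <= k -> 0 < p -> (1 <= m)%nat ->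
  0 < r0 < 1 -> excess m k p a r0 = 0 -> 0 <= r <= r0 -> excess m k p a r <= 0.
Proof.
  intros Ha Hk Hp Hm Hr0 E Hr. destruct (Req_dec r 0) as [->|Hr1].
  (* At [r = 0], outside the range of the monotonicity lemma, the value is [a^p - 1], with [0^p = 0]
     when [a = 0]. *)
  - unfold excess. replace (0 ^ m) with 0 by (destruct m; [lia|simpl; ring]).
    unfold pick_bound. replace ((0 + a) / (1 + a * 0)) with a by field.
    pose proof (rpow_lt_1 a p Hp ltac:(lra)).
    replace ((1 + k) * ((1 - a ^ 2) * 0 / (1 - 0))) with 0 by field. lra.
  - destruct (Req_dec r r0) as [->|Hr2]; [lra|].
    pose proof (excess_increasing m k p a r r0 Ha Hk Hp ltac:(lra) ltac:(lra)). lra.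
Qed.

Lemma F_quantity_le_1 k p m f h g a b r0 : 0 <= k <= 1 -> 0 < p <= 2 -> (1 <= m)%nat ->
  harmonic_class k f h g -> has_expansion h a -> has_expansion g b -> ~ constant_in_disk h ->
  0 < r0 <= 1 / 2 -> excess m k p (Cmod (a O)) r0 = 0 ->
  forall z, Cmod z <= r0 -> F_quantity h a b k p m z <= 1.
Proof.
  intros Hk Hp Hm Hf Ha Hb Hn Hr0 E z Hz.
  assert (Hbd : bounded_class h) by apply Hf.
  pose proof (bounded_class_contractive h a Hbd Ha) as Hc.
  pose proof (nonconstant_Cmod_lt_1 h a Hbd Ha Hn) as H1.
  pose proof (has_expansion_adm h a Ha) as Aa.
  pose proof (Cmod_ge_0 (a O)) as H0. pose proof (Cmod_ge_0 z) as Hz0.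
  destruct (derivative_dominated_quotient k f h g a b) as (d & w & Hw & Ew & Hd); auto; [lra|].
  pose proof (E_quantity_le a b d w k (Cmod z) Hc Hw Ew Hd ltac:(lra) ltac:(lra)) as HE.
  assert (Hzm : Cmod (z ^ m) < 1).
  { rewrite Cmod_pow. destruct m as [|m]; [lia|]. simpl.
    assert (Cmod z ^ m <= 1) by (rewrite <- (pow1 m); apply pow_incr; lra).
    assert (0 <= Cmod z ^ m) by (apply pow_le; lra). nra. }
  pose proof (schwarz_pick a (z ^ m) Hc Aa Hzm) as HS.
  rewrite <- (has_expansion_ev h a _ Ha Hzm), Cmod_pow in HS. fold (pick_bound (Cmod (a O)) (Cmod z ^ m)) in HS.
  pose proof (rpow_le _ _ p ltac:(lra) (conj (Cmod_ge_0 (h (z ^ m)%C)) HS)) as HR.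
  pose proof (excess_le_0 m k p (Cmod (a O)) (Cmod z) r0 ltac:(lra) ltac:(lra) ltac:(lra) Hm
    ltac:(lra) E ltac:(lra)) as HX.
  unfold excess in HX. unfold F_quantity. lra.
Qed.

(* The coefficients of [(c + z) / (1 + c z)]. *)
Definition moebius_coef (c : R) (n : nat) : C :=
  match n with O => RtoC c | S n => (RtoC (1 - c ^ 2) * RtoC (- c) ^ n)%C end.

Lemma adm_moebius c : 0 <= c < 1 -> adm (moebius_coef c).
Proof.
  intros Hc. apply adm_bounded with 1. intros [|n]; simpl.
  - rewrite Cmod_R, Rabs_pos_eq; lra.
  - rewrite Cmod_mult, Cmod_pow, !Cmod_R, Rabs_Ropp, !Rabs_pos_eq by nra.
    assert (c ^ n <= 1) by (rewrite <- (pow1 n); apply pow_incr; lra).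
    assert (0 <= c ^ n) by (apply pow_le; lra). nra.
Qed.

Lemma ev_moebius c z : 0 <= c < 1 -> Cmod z < 1 ->
  ((1 + RtoC c * z) * ev (moebius_coef c) z = RtoC c + z)%C.
Proof.
  intros Hc Hz. rewrite ev_shift by (auto; now apply adm_moebius).
  change (ev (fun n => moebius_coef c (S n)) z)
    with (ev (fun n => RtoC (1 - c ^ 2) * RtoC (- c) ^ n)%C z).
  change (moebius_coef c 0) with (RtoC c).
  assert (Hg : Cmod (RtoC (- c)) < 1) by (rewrite Cmod_R, Rabs_Ropp, Rabs_pos_eq; lra).
  rewrite ev_scal; auto.
  2:{ apply adm_bounded with 1. intros n. rewrite Cmod_pow, <- (pow1 n). apply pow_incr.
      split; [apply Cmod_ge_0|lra]. }
  pose proof (ev_geom (RtoC (- c)) z Hg Hz) as G. set (e := ev (fun n => (RtoC (- c) ^ n)%C) z) in *.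
  transitivity (RtoC c * (1 + RtoC c * z) + z * RtoC (1 - c ^ 2) * ((1 - RtoC (- c) * z) * e))%C.
  - rewrite RtoC_opp. ring.
  - rewrite G, RtoC_minus, RtoC_pow. ring.
Qed.

(** The identity behind it is [|1 + c z|^2 - |c + z|^2 = (1 - c^2) (1 - |z|^2)]. *)
Lemma moebius_bounded c z : 0 <= c < 1 -> Cmod z < 1 -> Cmod (ev (moebius_coef c) z) <= 1.
Proof.
  intros Hc Hz. pose proof (ev_moebius c z Hc Hz) as E. apply (f_equal Cmod) in E.
  rewrite Cmod_mult in E.
  assert (P : 0 < Cmod (1 + RtoC c * z)).
  { pose proof (Cmod_rev_triangle 1 (- (RtoC c * z))) as T.
    rewrite Cmod_opp, Cmod_scal_pos, Cmod_1 in T by lra.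
    replace (1 - - (RtoC c * z))%C with (1 + RtoC c * z)%C in T by ring.
    pose proof (Cmod_ge_0 z). nra. }
  apply Rmult_le_reg_l with (Cmod (1 + RtoC c * z)); auto. rewrite E, Rmult_1_r.
  apply pow2_le_inv; [lra|]. pose proof (Cmod2_alt z) as Z.
  rewrite !Cmod2_alt. destruct z as [x y]. simpl in *.
  assert (Z1 : x * (x * 1) + y * (y * 1) <= 1).
  { rewrite <- Z. rewrite Rmult_1_r. pose proof (Cmod_ge_0 (x, y)). nra. }
  assert (0 <= (1 - c * c) * (1 - (x * (x * 1) + y * (y * 1)))) by (apply Rmult_le_pos; nra). nra.
Qed.

Lemma moebius_series c r : 0 <= c < 1 -> 0 <= r < 1 ->
  Series (fun n => Cmod (moebius_coef c (S n)) * r ^ S n) = (1 - c ^ 2) * r / (1 - c * r).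
Proof.
  intros Hc Hr. assert (0 <= c * r < 1) by (split; nra).
  rewrite (Series_ext _ (fun n => (1 - c ^ 2) * r * (c * r) ^ n)).
  - rewrite Series_scal_l, Series_geom by (rewrite Rabs_pos_eq; lra). reflexivity.
  - intros n. simpl moebius_coef. rewrite Cmod_mult, Cmod_pow, !Cmod_R, Rabs_Ropp, !Rabs_pos_eq by nra.
    rewrite Rpow_mult_distr. simpl. ring.
Qed.

Lemma moebius_sq_series c r : 0 <= c < 1 -> 0 <= r < 1 ->
  Series (fun n => Cmod (moebius_coef c (S n)) ^ 2 * r ^ (2 * S n))
   = (1 - c ^ 2) ^ 2 * r ^ 2 / (1 - c ^ 2 * r ^ 2).
Proof.
  intros Hc Hr. assert (0 <= c * r < 1) by (split; nra).
  rewrite (Series_ext _ (fun n => (1 - c ^ 2) ^ 2 * r ^ 2 * (c ^ 2 * r ^ 2) ^ n)).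
  - rewrite Series_scal_l, Series_geom by (rewrite Rabs_pos_eq; nra). reflexivity.
  - intros n. simpl moebius_coef. rewrite Cmod_mult, Cmod_pow, !Cmod_R, Rabs_Ropp, !Rabs_pos_eq by nra.
    replace (2 * S n)%nat with (2 + n * 2)%nat by lia.
    rewrite pow_add, !Rpow_mult_distr, <- !pow_mult, (Nat.mul_comm 2 n). ring.
Qed.

(** The linear part [(1 - c^2) r / (1 - c r)] and the weighted quadratic part [(1 - c^2) (1 - c) r^2
    / ((1 - r) (1 - c r))] add up to [(1 - c^2) r / (1 - r)], so the bound for [E_f] is attained at
    every radius. *)
Lemma moebius_E_quantity c k r : 0 <= c < 1 -> 0 <= k -> 0 <= r < 1 ->
  E_quantity (moebius_coef c) (fun n => match n with O => RtoC 0 | S n => RtoC k * moebius_coef c (S n) end)%C k r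
   = (1 + k) * ((1 - c ^ 2) * r / (1 - r)).
Proof.
  intros Hc Hk Hr. unfold E_quantity, Defs.majorant, sq_norm.
  assert (0 <= c * r < 1) by (split; nra).
  rewrite (Series_ext (fun n => Cmod (RtoC k * moebius_coef c (S n))%C * r ^ S n)
    (fun n => k * (Cmod (moebius_coef c (S n)) * r ^ S n))).
  2:{ intros n. rewrite Cmod_scal_pos by auto. ring. }
  rewrite (Series_ext (fun n => Cmod (RtoC k * moebius_coef c (S n))%C ^ 2 * r ^ (2 * S n))
    (fun n => k ^ 2 * (Cmod (moebius_coef c (S n)) ^ 2 * r ^ (2 * S n)))).
  2:{ intros n. rewrite Cmod_scal_pos by auto. ring. }
  rewrite !Series_scal_l, !moebius_series, !moebius_sq_series by auto.
  assert (Ek : c_coef k * k ^ 2 = k).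
  { unfold c_coef. destruct (Req_EM_T k 0) as [->|Hk0]; [ring|field; auto]. }
  rewrite <- (Rmult_assoc (c_coef k)), Ek.
  change (Cmod (moebius_coef c 0)) with (Cmod (RtoC c)). rewrite Cmod_R, Rabs_pos_eq by lra.
  field. repeat split; nra.
Qed.

(** At a positive real point the Schwarz-Pick bound is attained as well, so there [F - 1] equals
    [excess]. *)
Lemma sharpness k p m c r : (1 <= m)%nat -> 0 <= k -> 0 <= c < 1 -> 0 < r < 1 -> 0 < excess m k p c r ->
  exists (f1 h1 g1 : C -> C) (a1 b1 : nat -> C),
    harmonic_class k f1 h1 g1 /\ has_expansion h1 a1 /\ has_expansion g1 b1 /\
    ~ constant_in_disk h1 /\ Cmod (h1 (RtoC 0)) = c /\
    1 < F_quantity h1 a1 b1 k p m (RtoC r).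
Proof.
  intros Hm Hk Hc Hr HX. set (a := moebius_coef c).
  set (b := fun n => match n with O => RtoC 0 | S n => RtoC k * a (S n) end%C).
  assert (Aa : adm a) by now apply adm_moebius.
  assert (Ab : adm b).
  { intros s Hs. destruct (Aa s Hs) as [K HK]. exists (k * K). intros [|n].
    - simpl. rewrite Cmod_0, Rmult_0_l. apply Rmult_le_pos; auto. now apply (bdd_ge0 a K s).
    - simpl b. rewrite Cmod_scal_pos, Rmult_assoc by auto. apply Rmult_le_compat_l; auto. apply (HK (S n)). }
  assert (Ha : has_expansion (ev a) a) by now apply ev_has_expansion.
  assert (Hb : has_expansion (ev b) b) by now apply ev_has_expansion.
  assert (Ea0 : ev a (RtoC 0) = RtoC c) by now rewrite ev_0.
  exists (fun z => ev a z + Cconj (ev b z))%C, (ev a), (ev b), a, b.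
  split; [|split; [exact Ha|split; [exact Hb|split; [|split]]]].
  - split; [reflexivity|]. split; [split|].
    + intros z Hz. exists (ev (der a) z). now apply is_derive_ev.
    + intros z Hz. now apply moebius_bounded.
    + split; [|split].
      * intros z Hz. exists (ev (der b) z). now apply is_derive_ev.
      * now rewrite ev_0.
      * intros z Hz. rewrite (C_derive_ev _ a z Ha Hz), (C_derive_ev _ b z Hb Hz).
        rewrite (ev_ext (der b) (fun n => RtoC k * der a n)%C).
        -- rewrite ev_scal by (auto; now apply adm_der). rewrite Cmod_scal_pos by auto. lra.
        -- intros n. unfold der. change (b (S n)) with (RtoC k * a (S n))%C. ring.
  (* Equal values at [0] and [1/2] would give [(1 + c / 2) c = c + 1 / 2], that is [c^2 = 1]. *)
  - intros [v Hv]. assert (H2 : Cmod (RtoC (/ 2)) < 1) by (rewrite Cmod_R, Rabs_pos_eq; lra).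
    assert (H0 : Cmod (RtoC 0) < 1) by (rewrite Cmod_0; lra).
    pose proof (ev_moebius c _ Hc H2) as E. fold a in E.
    rewrite (Hv _ H2), <- (Hv _ H0), Ea0 in E.
    rewrite <- RtoC_mult, <- !RtoC_plus, <- RtoC_mult in E. apply RtoC_inj in E. nra.
  - rewrite Ea0, Cmod_R, Rabs_pos_eq; lra.
  - unfold F_quantity. rewrite Cmod_R, (Rabs_pos_eq r) by lra.
    unfold a, b. rewrite moebius_E_quantity by lra. fold a.
    replace (Cmod (ev a (RtoC r ^ m)%C)) with (pick_bound c (r ^ m)).
    + unfold excess in HX. lra.
    + destruct (pow_in_01 r m Hr Hm) as [Hx Hx1]. rewrite <- RtoC_pow. set (x := r ^ m) in *.
      pose proof (ev_moebius c (RtoC x) Hc) as E. fold a in E.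
      rewrite Cmod_R, Rabs_pos_eq in E by lra. specialize (E ltac:(lra)).
      rewrite <- RtoC_mult, <- !RtoC_plus in E. apply (f_equal Cmod) in E.
      assert (0 <= c * x) by (apply Rmult_le_pos; lra).
      rewrite Cmod_scal_pos, Cmod_R, Rabs_pos_eq in E by lra.
      unfold pick_bound. apply Rmult_eq_reg_l with (1 + c * x); [|lra]. rewrite E. field. lra.
Qed.

Theorem theorem3 (k p : R) (m : nat) (f h g : C -> C) (a b : nat -> C) (q : nat)
    (hk : 0 <= k <= 1) (hp : 0 < p <= 2) (hm : (1 <= m)%nat)
    (hf : harmonic_class k f h g)
    (ha : has_expansion h a) (hb : has_expansion g b)
    (hh : ~ constant_in_disk h)
    (hq : zero_order_at_0 (fun z : C => (h z - h (RtoC 0))%C) q) :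
  exists r0 : R,
    unique (lambda_root m k p (Cmod (h (RtoC 0)))) r0 /\
    ((k = 0 \/ Cmod (b q) <= 1 / (2 * k * Cmod (a q))) ->
       forall z : C, Cmod z <= r0 -> F_quantity h a b k p m z <= 1) /\
    ((k = 0 \/ k = 1 \/ (0 < k < 1 /\ r0 <= 1 / 3)) ->
       (forall z : C, Cmod z <= r0 -> F_quantity h a b k p m z <= 1) /\
       (forall rho : R, r0 < rho ->
          exists (f1 h1 g1 : C -> C) (a1 b1 : nat -> C) (z : C),
            harmonic_class k f1 h1 g1 /\
            has_expansion h1 a1 /\ has_expansion g1 b1 /\
            ~ constant_in_disk h1 /\
            Cmod (h1 (RtoC 0)) = Cmod (h (RtoC 0)) /\
            in_disk z /\ Cmod z <= rho /\
            1 < F_quantity h1 a1 b1 k p m z)).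
Proof.
  assert (E0 : h (RtoC 0) = a O).
  { rewrite (has_expansion_ev h a _ ha) by (unfold in_disk; rewrite Cmod_0; lra).
    apply ev_0. now apply has_expansion_adm with h. }
  rewrite E0.
  assert (H1 : 0 <= Cmod (a O) < 1).
  { split; [apply Cmod_ge_0|]. apply nonconstant_Cmod_lt_1 with h; auto. apply hf. }
  destruct (excess_root m k p (Cmod (a O)) H1 hk hp hm) as (r0 & Hr0 & Er0).
  assert (Root : lambda_root m k p (Cmod (a O)) r0) by (apply lambda_root_excess; [lra|split; [lra|auto]]).
  assert (Bound : forall z, Cmod z <= r0 -> F_quantity h a b k p m z <= 1)
    by now apply (F_quantity_le_1 k p m f h g a b r0).
  exists r0. split; [split; auto|split; auto].
  - intros s Hs. apply (lambda_root_unique m k p (Cmod (a O))); auto; lra.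
  - intros _. split; auto. intros rho Hrho.
    (* The second argument keeps the point inside the disk when [rho >= 1]; past [r0] the strictly
       increasing [excess] is positive. *)
    set (r := Rmin rho ((r0 + 1) / 2)).
    assert (Hr : r0 < r) by (apply Rmin_glb_lt; lra).
    assert (Hr1 : r <= rho) by apply Rmin_l.
    assert (Hr2 : r <= (r0 + 1) / 2) by apply Rmin_r.
    destruct (sharpness k p m (Cmod (a O)) r) as (f1 & h1 & g1 & a1 & b1 & P1 & P2 & P3 & P4 & P5 & P6);
      auto; try lra.
    { rewrite <- Er0. apply excess_increasing; lra. }
    exists f1, h1, g1, a1, b1, (RtoC r).
    assert (Cr : Cmod (RtoC r) = r) by (rewrite Cmod_R, Rabs_pos_eq; lra).
    unfold in_disk. rewrite Cr. repeat (split; [first [assumption|lra]|]). exact P6.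
Qed.
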